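(* Let $n\ge2$. Any harmonic function $U$ on $\mathbb B^n$ can be written as the Poisson transform $U=P[f]$ of an analytic functional $f\in\mathcal A'(\mathbb S^{n-1})$ on $\mathbb S^{n-1}$.
   Context: $\mathbb B^n$ is the open unit ball and $\mathbb S^{n-1}$ the unit sphere of $\mathbb R^n$; $\mathbb N=\{0,1,2,\dots\}$. For smooth $\varphi$ on $\mathbb S^{n-1}$ put $\varphi^{\upharpoonright}(x)=\varphi(x/|x|)$, $x\in\mathbb R^n\setminus\{0\}$, and $(\partial^\alpha_{\mathbb S^{n-1}}\varphi)(\omega)=(\partial^\alpha\varphi^{\upharpoonright})(\omega)$, $\alpha\in\mathbb N^n$, $\omega\in\mathbb S^{n-1}$. $\mathcal A(\mathbb S^{n-1})$ is the space of real analytic functions on $\mathbb S^{n-1}$; it equals the space of $\varphi\in C^\infty(\mathbb S^{n-1})$ with $\|\varphi\|_h=\sup_{\alpha\in\mathbb N^n}h^{|\alpha|}\|\partial^\alpha_{\mathbb S^{n-1}}\varphi\|_{L^\infty(\mathbb S^{n-1})}/|\alpha|!<\infty$ for some $h>0$, and is topologized as the locally convex inductive limit, as $h\to0^+$, of the Banach spaces $\{\varphi\in C^\infty(\mathbb S^{n-1}):\|\varphi\|_h<\infty\}$. The space $\mathcal A'(\mathbb S^{n-1})$ of analytic functionals is its strong dual. The Poisson kernel is $P(x,\xi)=\frac{1}{|\mathbb S^{n-1}|}\frac{1-|x|^2}{|x-\xi|^n}$, $\xi\in\mathbb S^{n-1}$, $x\in\mathbb B^n$ (real analytic in $\xi$),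 and $P[f](x)=\langle f(\xi),P(x,\xi)\rangle$ for $f\in\mathcal A'(\mathbb S^{n-1})$. *)

(* Defs.v *)
From mathcomp Require Import all_boot all_order all_algebra.
From mathcomp Require Import complex.
From mathcomp Require Import all_classical all_reals all_analysis.
Set Implicit Arguments.
Unset Strict Implicit.
Unset Printing Implicit Defensive.
Import Order.TTheory GRing.Theory Num.Theory.
Import numFieldNormedType.Exports.
Local Open Scope classical_set_scope.
Local Open Scope ring_scope.
Local Open Scope complex_scope.

(* The library norm on 'rV[R]_n is the sup norm. *)
Definition enorm (R : realType) (n : nat) (x : 'rV[R]_n) : R :=
  Num.sqrt (\sum_(i < n) x ord0 i ^+ 2).

Definition eball (R : realType) (n : nat) : set 'rV[R]_n :=
  [set x | enorm x < 1].

Definition esphere (R : realType) (n : nat) : Type :=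
  {x : 'rV[R]_n | enorm x == 1}.

(* Functions of n real variables. A real or complex function is taken to be
   total on 'rV[R]_n, and only its behaviour on the open set D matters. *)

(* For s = [:: i1; ...; ik], d_{i1} (... (d_{ik} g)). *)
Definition pderivs (R : realType) (n : nat) (s : seq 'I_n)
    (g : 'rV[R]_n -> R) : 'rV[R]_n -> R :=
  foldr (fun i (g' : 'rV[R]_n -> R) x => 'D_(delta_mx ord0 i) g' x) g s.

Definition Ck_on (R : realType) (n k : nat) (D : set 'rV[R]_n)
    (g : 'rV[R]_n -> R) : Prop :=
  (forall (s : seq 'I_n) (i : 'I_n) (x : 'rV[R]_n), (size s < k)%N -> D x ->
     derivable (pderivs s g) x (delta_mx ord0 i)) /\
  (forall (s : seq 'I_n) (x : 'rV[R]_n), (size s <= k)%N -> D x ->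
     {for x, continuous (pderivs s g)}).

(* Complex functions are differentiated componentwise. *)
Definition re_part (R : realType) (T : Type) (u : T -> R[i]) : T -> R :=
  fun x => complex.Re (u x).
Definition im_part (R : realType) (T : Type) (u : T -> R[i]) : T -> R :=
  fun x => complex.Im (u x).

Definition cpderivs (R : realType) (n : nat) (s : seq 'I_n)
    (u : 'rV[R]_n -> R[i]) : 'rV[R]_n -> R[i] :=
  fun x => pderivs s (re_part u) x +i* pderivs s (im_part u) x.

Definition cCk_on (R : realType) (n k : nat) (D : set 'rV[R]_n)
    (u : 'rV[R]_n -> R[i]) : Prop :=
  Ck_on k D (re_part u) /\ Ck_on k D (im_part u).

Definition cCoo_on (R : realType) (n : nat) (D : set 'rV[R]_n)
    (u : 'rV[R]_n -> R[i]) : Prop :=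
  forall k : nat, cCk_on k D u.

Definition laplacian (R : realType) (n : nat) (u : 'rV[R]_n -> R[i]) :
    'rV[R]_n -> R[i] :=
  fun x => \sum_(i < n) cpderivs [:: i; i] u x.

Definition harmonic_on (R : realType) (n : nat) (D : set 'rV[R]_n)
    (u : 'rV[R]_n -> R[i]) : Prop :=
  cCk_on 2 D u /\ forall x, D x -> laplacian u x = 0.

Definition multi_index (n : nat) : Type := {ffun 'I_n -> nat}.

Definition mi_size (n : nat) (a : multi_index n) : nat := (\sum_(i < n) a i)%N.

Definition mi_word (n : nat) (a : multi_index n) : seq 'I_n :=
  flatten [seq nseq (a i) i | i <- enum 'I_n].

(* phi(x / |x|) for x != 0; the value at 0 is junk. *)
Definition hom_ext (R : realType) (n : nat) (phi : esphere R n -> R[i]) :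
    'rV[R]_n -> R[i] :=
  fun x => oapp phi 0 (insub ((enorm x)^-1 *: x)).

Definition smooth_sphere (R : realType) (n : nat)
    (phi : esphere R n -> R[i]) : Prop :=
  cCoo_on [set x | x != 0] (hom_ext phi).

Definition dsphere (R : realType) (n : nat) (a : multi_index n)
    (phi : esphere R n -> R[i]) : esphere R n -> R[i] :=
  fun w => cpderivs (mi_word a) (hom_ext phi) (val w).

(* For continuous functions the L^oo norm is the supremum norm. *)
Definition supnorm (R : realType) (T : Type) (psi : T -> R[i]) : \bar R :=
  ereal_sup (range (fun w => (ComplexField.Normc.normc (psi w))%:E)).

Definition hnorm (R : realType) (n : nat) (h : R)
    (phi : esphere R n -> R[i]) : \bar R :=
  ereal_sup (range (fun a : multi_index n =>
    ((h ^+ mi_size a / (mi_size a)`!%:R)%:E * supnorm (dsphere a phi))%E)).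

Definition analytic_step (R : realType) (n : nat) (h : R) :
    set (esphere R n -> R[i]) :=
  [set phi | smooth_sphere phi /\ (hnorm h phi < +oo)%E].

Definition analytic_sphere (R : realType) (n : nat) :
    set (esphere R n -> R[i]) :=
  [set phi | exists2 h : R, 0 < h & analytic_step h phi].

Definition absolutely_convex (R : realType) (T : Type)
    (W : set (T -> R[i])) : Prop :=
  forall (a b : R[i]) (phi psi : T -> R[i]), `|a| + `|b| <= 1 ->
    W phi -> W psi -> W (fun w => a * phi w + b * psi w).

(* Neighbourhoods in the locally convex inductive limit topology: the finest
   locally convex topology for which every inclusion of a step is continuous.
   The sets W below form a base of neighbourhoods of 0. *)
Definition indlim_nbhs0 (R : realType) (n : nat)
    (V : set (esphere R n -> R[i])) : Prop :=
  exists W : set (esphere R n -> R[i]),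
    [/\ absolutely_convex W,
        W `<=` @analytic_sphere R n,
        (forall h : R, 0 < h -> exists2 r : R, 0 < r &
           forall phi, analytic_step h phi -> (hnorm h phi < r%:E)%E -> W phi)
      & W `<=` V].

Definition indlim_nbhs (R : realType) (n : nat) (phi : esphere R n -> R[i])
    (V : set (esphere R n -> R[i])) : Prop :=
  indlim_nbhs0 [set psi | V (fun w => phi w + psi w)].

(* Elements of the dual of the space of real analytic functions: only the
   values of f on analytic_sphere matter. *)
Definition analytic_functional (R : realType) (n : nat)
    (f : (esphere R n -> R[i]) -> R[i]) : Prop :=
  (forall (a : R[i]) (phi psi : esphere R n -> R[i]),
     analytic_sphere phi -> analytic_sphere psi ->
     f (fun w => a * phi w + psi w) = a * f phi + f psi) /\
  (forall phi : esphere R n -> R[i], analytic_sphere phi ->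
     forall e : R, 0 < e ->
     indlim_nbhs phi
       [set psi | ComplexField.Normc.normc (f psi - f phi) < e]).

(* Integral over R^n against Lebesgue measure, as an iterated integral. *)
Fixpoint integral_rV (R : realType) (n : nat) :
    ('rV[R]_n -> \bar R) -> \bar R :=
  match n return ('rV[R]_n -> \bar R) -> \bar R with
  | 0 => fun g => g 0
  | m.+1 => fun g =>
      (\int[@lebesgue_measure R]_t
         integral_rV (fun y : 'rV[R]_m => g (row_mx (t%:M : 'rV[R]_1) y)))%E
  end.

(* The surface measure of the unit sphere of R^n is n times the volume of the
   unit ball (integration in polar coordinates). *)
Definition sphere_area (R : realType) (n : nat) : R :=
  n%:R * fine (integral_rV (fun x : 'rV[R]_n => (\1_(@eball R n) x)%:E)).

Definition poisson_kernel (R : realType) (n : nat) (x : 'rV[R]_n) :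
    esphere R n -> R[i] :=
  fun xi => ((sphere_area R n)^-1 *
    ((1 - enorm x ^+ 2) / enorm (x - val xi) ^+ n))%:C.

Definition poisson_transform (R : realType) (n : nat)
    (f : (esphere R n -> R[i]) -> R[i]) : 'rV[R]_n -> R[i] :=
  fun x => f (poisson_kernel x).

(* Main.v *)
Require Import Defs.
From mathcomp Require Import all_boot all_order all_algebra.
From mathcomp Require Import complex.
From mathcomp Require Import all_classical all_reals all_analysis.
From mathcomp Require Import ring lra.

(* For a radial weight supported in the shell a <= |y|^2 <= b, let <g> be the weighted
   mean of g, where the mean over the cube is an ultralimit of lattice averages: it is
   linear and positive, and it satisfies integration by parts, which is all that is
   needed of an integral. Put c = (n - 2) / 2. If u is harmonic and g is homogeneous of
   degree 0, Green's formula says that F(s) = e^(c s) <u(e^s y) g(y)> has second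
   derivative e^(c s) <u(e^s y) (A g)(y)>, where A g = c^2 g - |y|^2 Lap g. If g extends
   an analytic function on the sphere then A^m g is O(B^(2m) (2m)!), so the even part of
   the Taylor expansion of F at a small -sg bounds <u g> = F(0) by the analytic norm of g
   times the supremum of |u| on a fixed compact ball, independently of the shell. Hence
   <u g> / <1> has an ultralimit as the shells approach the sphere, and it is continuous
   in g for the inductive limit topology; with the factor |S| this is the functional f.
   Finally, for d in ]ln |x|, 0], Green's formula shows that the mean of
   u(e^d y) P(e^(-d) x, y / |y|) does not depend on d, and d -> ln |x| gives f(P(x, .)) = u(x). *)

Set Implicit Arguments.
Unset Strict Implicit.
Unset Printing Implicit Defensive.
Import Order.TTheory GRing.Theory Num.Theory.
Import numFieldNormedType.Exports.
Local Open Scope classical_set_scope.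
Local Open Scope ring_scope.

(** * Continuity and derivatives of functions of several variables *)

(** U may grow arbitrarily fast at the sphere, so no bound of U up to the boundary is available.
    What compensates is that for analytic g the value F(0) can be recovered from F on s <= -sg, that
    is, from U on |y| <= e^(-sg). Only the derivatives of even order of F are expressed through
    powers of A; those of odd order also contain a radial derivative of u. Hence the passage to F(t0
    + t) + F(t0 - t), whose odd derivatives vanish at t = 0. The length sg is 1/(2B) with B fixed by
    the radius of analyticity alone, and this is the uniformity that continuity on one step of the
    inductive limit asks for. The constant c removes the first-order term from F''; as n >= 2 it is
    nonnegative, so e^(c s) <= 1 for s <= 0. No integral over the sphere is ever formed: a thin
    shell stands for it, its mass cancels in the quotient by <1>, and the only link with the
    normalisation of the kernel is <P> = <1>, which is again Green's formula, with u = 1. *)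

Section PointwiseContinuity.
Context {R : realType} {T : topologicalType}.
Implicit Types (f g : T -> R) (x : T).

Lemma cont_cst (a : R) x : {for x, continuous (fun=> a)}.
Proof. exact: cvg_cst. Qed.

Lemma contD f g x : {for x, continuous f} -> {for x, continuous g} ->
  {for x, continuous (fun y => f y + g y)}.
Proof. by move=> cf cg; exact: cvgD. Qed.

Lemma contM f g x : {for x, continuous f} -> {for x, continuous g} ->
  {for x, continuous (fun y => f y * g y)}.
Proof. by move=> cf cg; exact: cvgM. Qed.

Lemma contZ (a : R) f x : {for x, continuous f} ->
  {for x, continuous (fun y => a * f y)}.
Proof. by move=> cf; apply: contM => //; exact: cont_cst. Qed.

Lemma contB f g x : {for x, continuous f} -> {for x, continuous g} ->
  {for x, continuous (fun y => f y - g y)}.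
Proof. by move=> cf cg; exact: cvgB. Qed.

Lemma contV f x : f x != 0 -> {for x, continuous f} ->
  {for x, continuous (fun y => (f y)^-1)}.
Proof. by move=> f0 cf; exact: cvgV. Qed.

Lemma contX f m x : {for x, continuous f} -> {for x, continuous (fun y => f y ^+ m)}.
Proof.
move=> cf; elim: m => [|m IH]; first exact: cont_cst.
have -> : (fun y => f y ^+ m.+1) = (fun y => f y * f y ^+ m).
  by apply: funext => y; rewrite exprS.
exact: contM.
Qed.

Lemma cont_sum m (f : 'I_m -> T -> R) x : (forall i, {for x, continuous (f i)}) ->
  {for x, continuous (fun y => \sum_i f i y)}.
Proof.
move=> cf; elim: m f cf => [|m IH] f cf.
  have -> : (fun y => \sum_(i < 0) f i y) = (fun=> 0).
    by apply: funext => y; rewrite big_ord0.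
  exact: cont_cst.
have -> : (fun y => \sum_(i < m.+1) f i y) =
    (fun y => f ord0 y + \sum_(i < m) f (lift ord0 i) y).
  by apply: funext => y; rewrite big_ord_recl.
by apply: contD => //; apply: IH.
Qed.

Lemma cont_comp (U : topologicalType) (h : T -> U) (f : U -> R) x :
  {for x, continuous h} -> {for h x, continuous f} ->
  {for x, continuous (fun y => f (h y))}.
Proof. by move=> ch cf; exact: (continuous_comp ch cf). Qed.

End PointwiseContinuity.

Section DirectionalDerivatives.
Context {R : realType} {V : normedModType R}.

Lemma is_derive_line (f : V -> R) (x v : V) (d : R) :
  is_derive x v f d <-> is_derive (0 : R) 1 (fun h : R => f (h *: v + x)) d.
Proof.
have E : 'D_v f x = 'D_1 (fun h : R => f (h *: v + x)) 0.
  rewrite /derive; set g1 := fun h => h^-1 *: _; set g2 := fun h => h^-1 *: _.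
  suff -> : g1 = g2 by [].
  by rewrite funeqE /g1 /g2 => h /=; rewrite addr0 scale0r add0r [_%:A]mulr1.
have [dl ld] := derivable1P f x v.
split=> -[f1 f2]; split.
- exact: dl.
- by rewrite -E.
- exact: ld.
- by rewrite E.
Qed.

Lemma is_derive_comp1 (g : R -> R) (f : V -> R) (x v : V) (dg df : R) :
  is_derive x v f df -> is_derive (f x) 1 g dg ->
  is_derive x v (fun y => g (f y)) (dg * df).
Proof.
move=> /is_derive_line hf hg; apply/is_derive_line.
have hg' : is_derive ((fun h : R => f (h *: v + x)) 0) 1 g dg.
  by rewrite /= scale0r add0r.
exact: (@is_derive1_comp _ g (fun h : R => f (h *: v + x)) 0 dg df hg' hf).
Qed.

End DirectionalDerivatives.

Lemma MVT0 (R : realType) (g g' : R -> R) (t : R) :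
  (forall s : R, `|s| <= `|t| -> is_derive s 1 g (g' s)) ->
  exists2 s, `|s| <= `|t| & g t - g 0 = t * g' s.
Proof.
move=> dg.
have cg s : `|s| <= `|t| -> {for s, continuous g}.
  move=> st; apply: differentiable_continuous; apply/derivable1_diffP.
  by case: (dg s st).
have [t0|t0] := leP 0 t.
- have [s st E] : exists2 s, s \in `[0, t]%R & g t - g 0 = g' s * (t - 0).
    apply: MVT_segment => // [x|].
      rewrite in_itv /= => /andP[x0 xt]; apply: dg.
      by rewrite !ger0_norm // ltW.
    apply: continuous_in_subspaceT => x; rewrite inE /= in_itv /= => /andP[x0 xt].
    by apply: cg; rewrite !ger0_norm.
  exists s; last by rewrite E subr0 mulrC.
  by move: st; rewrite in_itv /= => /andP[x0 xt]; rewrite !ger0_norm.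
- have [s st E] : exists2 s, s \in `[t, 0]%R & g 0 - g t = g' s * (0 - t).
    apply: MVT_segment => //; first exact: ltW.
      move=> x; rewrite in_itv /= => /andP[x0 xt]; apply: dg.
      by rewrite !ler0_norm ?lerN2 ltW.
    apply: continuous_in_subspaceT => x; rewrite inE /= in_itv /= => /andP[x0 xt].
    by apply: cg; rewrite !ler0_norm ?lerN2 // ltW.
  exists s; last by rewrite -[LHS]opprB E sub0r mulrN opprK mulrC.
  by move: st; rewrite in_itv /= => /andP[x0 xt]; rewrite !ler0_norm ?lerN2 // ltW.
Qed.

Lemma is_derive_shift0 (R : realType) (g : R -> R) (s d : R) :
  is_derive s 1 g d <-> is_derive (0 : R) 1 (fun h => g (h + s)) d.
Proof.
have -> : (fun h => g (h + s)) = (fun h : R => g (h *: 1 + s)).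
  by apply: funext => h; rewrite [_%:A]mulr1.
exact: is_derive_line.
Qed.

Section RowVectors.
Context {R : realType} {n : nat}.
Local Notation V := 'rV[R]_n.
Local Notation e i := (delta_mx ord0 i : V).
Implicit Types (x y z w : V) (f : V -> R).

Lemma norm_rV_le z (d : R) : 0 <= d -> (forall j, `|z ord0 j| <= d) -> `|z| <= d.
Proof.
move=> d0 h; rewrite [`|z|]mx_normrE; elim/big_ind: _ => // [a b ad bd|i _].
  by rewrite ge_max ad bd.
by rewrite (ord1 i.1).
Qed.

Lemma coord_le_norm z j : `|z ord0 j| <= `|z|.
Proof.
rewrite [`|z|]mx_normrE.
exact: (@le_bigmax _ _ _ 0 (fun i : 'I_1 * 'I_n => `|z i.1 i.2|) (ord0, j)).
Qed.

Lemma norm_delta_mx i : `|e i| <= 1.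
Proof.
apply: norm_rV_le => // j; rewrite mxE eqxx /=.
by case: (j == i); rewrite ?normr1 ?normr0.
Qed.

Lemma MVT_coord f f' x i (t : R) :
  (forall s : R, `|s| <= `|t| -> is_derive (s *: e i + x) (e i) f (f' (s *: e i + x))) ->
  exists2 s : R, `|s| <= `|t| & f (t *: e i + x) - f x = t * f' (s *: e i + x).
Proof.
move=> df.
have [|s st E] := @MVT0 R (fun s => f (s *: e i + x)) (fun s => f' (s *: e i + x)) t.
  move=> s /df /is_derive_line h; apply/is_derive_shift0.
  by under eq_fun do rewrite scalerDl -addrA.
by exists s; rewrite // -E scale0r add0r.
Qed.

(** The segment from [x] to [w + x] is replaced by axis-parallel legs, each handled by the
    one-variable mean value theorem. The norm is the sup norm, so the truncations [p k] of [w] never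
    leave the ball of radius [d]. *)
Lemma C1_increment f (f' : 'I_n -> V -> R) x (d eps : R) :
  (forall i z, `|z - x| < d -> is_derive z (e i) f (f' i z)) ->
  (forall i z, `|z - x| < d -> `|f' i z - f' i x| <= eps) ->
  forall w, `|w| < d ->
  `|f (w + x) - f x - \sum_i w ord0 i * f' i x| <= eps * \sum_i `|w ord0 i|.
Proof.
move=> df cf w wd.
pose p (k : nat) : V := \row_j (if (j < k)%N then w ord0 j else 0).
have pw k : `|p k| <= `|w|.
  apply: norm_rV_le => // j; rewrite mxE; case: ifP => _; last by rewrite normr0.
  exact: coord_le_norm.
have p0 : p 0%N = 0 by apply/rowP => j; rewrite !mxE.
have pn : p n = w by apply/rowP => j; rewrite !mxE ltn_ord.
have pS (k : 'I_n) : p k.+1 = w ord0 k *: e k + p k.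
  apply/rowP => j; rewrite !mxE eqxx /= ltnS leq_eqVlt -val_eqE /=.
  have [/val_inj ->|_] := eqVneq (j : nat) k; first by rewrite ltnn mulr1 addr0.
  by rewrite mulr0 add0r.
have -> : f (w + x) - f x = \sum_(k < n) (f (p k.+1 + x) - f (p k + x)).
  rewrite -(big_mkord xpredT (fun k => f (p k.+1 + x) - f (p k + x))).
  by rewrite (telescope_sumr (fun k => f (p k + x))) // pn p0 add0r.
rewrite -sumrB mulr_sumr; apply: le_trans (ler_norm_sum _ _ _) _.
apply: ler_sum => k _.
have near (s : R) : `|s| <= `|w ord0 k| -> `|s *: e k + (p k + x) - x| < d.
  move=> sw; rewrite addrA addrK; apply: le_lt_trans wd; apply: norm_rV_le => // j.
  rewrite !mxE eqxx /=; have [->|jk] := eqVneq j k.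
    by rewrite ltnn mulr1 addr0 (le_trans sw) // coord_le_norm.
  rewrite mulr0 add0r; case: ifP => _; last by rewrite normr0.
  exact: coord_le_norm.
have [s sw] := MVT_coord (fun s sw => df k _ (near s sw)).
rewrite addrA -pS => ->.
by rewrite -mulrBr normrM mulrC ler_wpM2r // cf // near.
Qed.

(** Needed for the radial direction: differentiation along rays and Euler's identity both rest on
    it. The previous estimate is used with [eps] divided by slightly more than the l^1 norm of
    [v]. *)
Lemma C1_is_derive f (f' : 'I_n -> V -> R) (D : set V) x v :
  open D -> D x -> (forall i z, D z -> is_derive z (e i) f (f' i z)) ->
  (forall i, {for x, continuous (f' i)}) ->
  is_derive x v f (\sum_i v ord0 i * f' i x).
Proof.
move=> oD Dx df cf; apply/is_derive_line.
set L := \sum_i _.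
suff H : (fun h : R => h^-1 *: ((fun h0 : R => f (h0 *: v + x)) (h *: 1 + 0)
     - (fun h0 : R => f (h0 *: v + x)) 0)) @ 0^' --> L.
  by split; [apply/cvg_ex; exists L | apply: cvg_lim].
apply/cvgrPdist_le => /= eps eps0.
pose S : R := \sum_i `|v ord0 i| + 1.
have S0 : 0 < S by rewrite ltr_wpDl // sumr_ge0.
have [d d0 hd] : exists2 d : R, 0 < d & forall z, `|z - x| < d ->
    D z /\ forall i, `|f' i z - f' i x| <= eps / S.
  have cf' i : \forall z \near x, `|f' i z - f' i x| <= eps / S.
    near=> z; rewrite distrC; near: z.
    by move/cvgrPdist_le: (cf i); apply; rewrite divr_gt0.
  have : \forall z \near x, D z /\ forall i, `|f' i z - f' i x| <= eps / S.
    apply: filterI; first by move: oD; rewrite openE; apply.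
    exact: (@filter_forall _ _ _ (nbhs x) _ cf').
  by case/nbhs_normP => d /= d0 hd; exists d => // z zx; apply: hd; rewrite /= distrC.
have dv : v != 0 -> 0 < d / `|v| by move=> v0; rewrite divr_gt0 // normr_gt0.
have [v0|v0] := eqVneq v 0.
  near=> h.
  rewrite v0 !scaler0 subrr scaler0 subr0 /L big1 ?normr0 ?ltW // => i _.
  by rewrite v0 mxE mul0r.
near=> h.
have h0 : h != 0 by near: h; exact: nbhs_dnbhs_neq.
have hv : `|h *: v| < d.
  rewrite normrZ -ltr_pdivlMr ?normr_gt0 //; near: h.
  exact: (@dnbhs0_lt R R^o _ (dv v0)).
have := C1_increment (fun i z zx => df i z (proj1 (hd z zx)))
  (fun i z zx => proj2 (hd z zx) i) hv.
rewrite [h%:A]mulr1 addr0 scale0r add0r => H.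
have {}H : `|f (h *: v + x) - f x - h * L| <= `|h| * eps.
  have -> : h * L = \sum_i (h *: v) ord0 i * f' i x.
    by rewrite mulr_sumr; apply: eq_bigr => i _; rewrite mxE mulrA.
  apply: le_trans H _.
  have -> : \sum_i `|(h *: v) ord0 i| = `|h| * \sum_i `|v ord0 i|.
    by rewrite mulr_sumr; apply: eq_bigr => i _; rewrite mxE normrM.
  rewrite mulrCA ler_wpM2l // mulrAC ler_pdivrMr // ler_wpM2l ?ltW //.
  by rewrite /S ltrDl.
have -> : L - h^-1 *: (f (h *: v + x) - f x) = - (h^-1 * (f (h *: v + x) - f x - h * L)).
  by rewrite [_ *: _]/(_ * _) mulrBr mulKf // opprB.
rewrite normrN normrM normfV ler_pdivrMl ?normr_gt0 //.
Unshelve. all: by end_near. Qed.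

End RowVectors.

(** * Ultralimits *)

Section Ultralimits.
Context {R : realType}.
Implicit Types u v : nat -> R.

Lemma nat_ultrafilter : exists G : set_system nat, UltraFilter G /\ \oo `<=` G.
Proof. exact: ultraFilterLemma. Qed.

Definition ultra : set_system nat := projT1 (cid nat_ultrafilter).

Lemma ultraP : UltraFilter ultra. Proof. by case: (projT2 (cid nat_ultrafilter)). Qed.

Lemma ultra_oo : \oo `<=` ultra. Proof. by case: (projT2 (cid nat_ultrafilter)). Qed.

#[local] Instance ultra_pf : ProperFilter ultra.
Proof. exact: (@ultra_proper _ _ ultraP). Qed.

Definition ulim u : R := lim (u @ ultra).

(** If [A] belongs to a larger filter, its preimage meets every set of [F]. The traces of [F] on the
    preimage then generate a proper filter containing [F], and maximality of [F] puts the preimage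
    in [F]. *)
Lemma ultra_map T (F : set_system nat) (f : nat -> T) : UltraFilter F ->
  UltraFilter (f @ F).
Proof.
move=> UF; split; first exact: fmap_proper_filter.
move=> G GP sG; apply/predeqP => A; split; last exact: sG.
move=> GA; have [//|nA] := pselect ((f @ F) A).
exfalso.
have nB : ~ F (~` (f @^-1` A)).
  move=> h; have : G (~` A) by apply: sG.
  move=> h'; have : G set0 by rewrite -(setICr A); exact: filterI.
  by move/filter_not_empty.
apply: nA; rewrite /fmap /=; set B := f @^-1` A.
have PH : ProperFilter (filter_from F (fun C => C `&` B)).
  apply: filter_from_proper.
    apply: filter_from_filter; first by exists setT; exact: filterT.
    move=> C D FC FD; exists (C `&` D); first exact: filterI.
    by move=> x [[? ?] ?].
  move=> C FC; apply: contrapT => h; apply: nB; apply: filterS FC => x Cx Bx.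
  by apply: h; exists x.
have -> : F = filter_from F (fun C => C `&` B).
  symmetry; apply: max_filter => C FC; exists C => //; exact: subIsetl.
by exists setT; [exact: filterT | exact: subIsetr].
Qed.

(** Compactness of [-M, M]: along an ultrafilter every bounded sequence converges, so ultralimits of
    sums split with no convergence left to prove. *)
Lemma ulim_cvg u (M : R) : (forall k, `|u k| <= M) -> u @ ultra --> ulim u.
Proof.
move=> uM; have := @segment_compact R (- M) M; rewrite compact_ultra => h.
have [||l [_ ul]] := h (u @ ultra) _ _.
- exact: ultra_map ultraP.
- have E : u @^-1` `[- M, M]%classic = setT.
    by apply/seteqP; split => // k _ /=; rewrite in_itv /= -ler_norml.
  by rewrite /fmap /= E; exact: filterT.
- by apply/cvg_ex; exists l.
Qed.

Lemma ulim_eq u (l : R) : u @ ultra --> l -> ulim u = l.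
Proof. by move=> ul; apply: cvg_lim. Qed.

(** The ultralimit agrees with a genuine limit; this gives its value in the two places where one is
    known, integration by parts and the Poisson formula. *)
Lemma ulim_cvgn u (l : R) : u @ \oo --> l -> ulim u = l.
Proof.
move=> ul; apply: ulim_eq; apply: cvg_trans ul; move=> A hA; exact: ultra_oo.
Qed.

Lemma ulimD u v M N : (forall k, `|u k| <= M) -> (forall k, `|v k| <= N) ->
  ulim (fun k => u k + v k) = ulim u + ulim v.
Proof.
by move=> uM vN; apply: ulim_eq; apply: cvgD; [exact: ulim_cvg uM | exact: ulim_cvg vN].
Qed.

Lemma ulimZ u M (a : R) : (forall k, `|u k| <= M) ->
  ulim (fun k => a * u k) = a * ulim u.
Proof.
by move=> uM; apply: ulim_eq; apply: cvgM; [exact: cvg_cst | exact: ulim_cvg uM].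
Qed.

Lemma ulim_le u v M N : (forall k, `|u k| <= M) -> (forall k, `|v k| <= N) ->
  (\forall k \near \oo, u k <= v k) -> ulim u <= ulim v.
Proof.
move=> uM vN uv; apply: ler_lim.
- by apply/cvg_ex; exists (ulim u); exact: ulim_cvg uM.
- by apply/cvg_ex; exists (ulim v); exact: ulim_cvg vN.
- exact: ultra_oo.
Qed.

Lemma ulim_cst (a : R) : ulim (fun=> a) = a.
Proof. by apply: ulim_eq; exact: cvg_cst. Qed.

Lemma ulim_norm_le u (M : R) : (forall k, `|u k| <= M) -> `|ulim u| <= M.
Proof.
move=> uM; have uM' k : - M <= u k <= M by rewrite -ler_norml.
have cM (a : R) : forall k : nat, `|(fun=> a) k| <= `|a| by [].
have l1 := ulim_cst (- M); have l2 := ulim_cst M.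
rewrite ler_norml -l1 -[X in _ && (_ <= X)]l2.
by apply/andP; split; [apply: ulim_le (cM _) uM _ | apply: ulim_le uM (cM _) _];
  apply: nearW => k; case/andP: (uM' k).
Qed.

End Ultralimits.

(** * Means over the cube *)

Section LatticeMean.
Context {R : realType} {n : nat}.
Local Notation V := 'rV[R]_n.
Local Notation e i := (delta_mx ord0 i : V).
Implicit Types (x y z : V) (f g : V -> R) (N : nat).

Definition bounded_fun g := exists M : R, forall y, `|g y| <= M.

(** There are 2(N+1) + 1 indices per axis: the grid of mesh 1/(N+1) on [-1, 1] with both endpoints.
    The cube contains the unit ball, hence every shell in use. *)
Definition lattice_index N := {ffun 'I_n -> 'I_(N.+1.*2.+1)}.

Definition lattice_point N (k : lattice_index N) : V :=
  \row_i ((k i)%:R / N.+1%:R - 1).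

Definition lattice_mean g N : R :=
  (\sum_(k : lattice_index N) g (lattice_point k)) / #|{: lattice_index N}|%:R.

Definition mean g : R := ulim (lattice_mean g).

Lemma card_lattice_gt0 N : 0 < #|{: lattice_index N}|%:R :> R.
Proof. by rewrite ltr0n card_ffun expn_gt0 card_ord. Qed.

Lemma lattice_mean_le g (M : R) N : (forall y, `|g y| <= M) ->
  `|lattice_mean g N| <= M.
Proof.
move=> gM; rewrite /lattice_mean normrM normfV.
rewrite (ger0_norm (ltW (card_lattice_gt0 N))) ler_pdivrMr ?card_lattice_gt0 //.
apply: le_trans (ler_norm_sum _ _ _) _.
apply: le_trans (ler_sum _ (fun k _ => gM (lattice_point k))) _.
by rewrite sumr_const mulr_natr.
Qed.

Lemma lattice_meanD f g N :
  lattice_mean (fun y => f y + g y) N = lattice_mean f N + lattice_mean g N.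
Proof. by rewrite /lattice_mean big_split mulrDl. Qed.

Lemma lattice_meanZ (a : R) g N :
  lattice_mean (fun y => a * g y) N = a * lattice_mean g N.
Proof. by rewrite /lattice_mean -mulr_sumr mulrA. Qed.

Lemma le_lattice_mean f g N : (forall y, f y <= g y) ->
  lattice_mean f N <= lattice_mean g N.
Proof.
by move=> fg; rewrite ler_wpM2r ?invr_ge0 ?ler0n //; apply: ler_sum => k _.
Qed.

Lemma meanD f g : bounded_fun f -> bounded_fun g ->
  mean (fun y => f y + g y) = mean f + mean g.
Proof.
move=> [M fM] [M' gM]; rewrite /mean.
rewrite -(ulimD (fun k => lattice_mean_le k fM) (fun k => lattice_mean_le k gM)).
by congr ulim; apply: funext => N; exact: lattice_meanD.
Qed.

Lemma meanZ (a : R) g : bounded_fun g -> mean (fun y => a * g y) = a * mean g.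
Proof.
move=> [M gM]; rewrite /mean -(ulimZ a (fun k => lattice_mean_le k gM)).
by congr ulim; apply: funext => N; exact: lattice_meanZ.
Qed.

Lemma le_mean f g : bounded_fun f -> bounded_fun g -> (forall y, f y <= g y) ->
  mean f <= mean g.
Proof.
move=> [M fM] [M' gM] fg.
apply: ulim_le (fun k => lattice_mean_le k fM) (fun k => lattice_mean_le k gM) _.
by apply: nearW => N; exact: le_lattice_mean.
Qed.

Lemma mean_sum m (g : 'I_m -> V -> R) : (forall i, bounded_fun (g i)) ->
  mean (fun y => \sum_i g i y) = \sum_i mean (g i).
Proof.
move=> hg.
suff [//] : mean (fun y => \sum_i g i y) = \sum_i mean (g i) /\
  bounded_fun (fun y => \sum_i g i y).
elim: m g hg => [|m IH] g hg.
  rewrite big_ord0; split; last by exists 0 => y; rewrite big_ord0 normr0.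
  rewrite -[RHS](ulim_cst 0); congr ulim; apply: funext => N.
  by rewrite /lattice_mean big1 ?mul0r // => k _; rewrite big_ord0.
under eq_fun do rewrite big_ord_recl.
have [E [M hM]] := IH (fun i => g (lift ord0 i)) (fun i => hg _).
rewrite big_ord_recl -E; split; first by apply: meanD => //; exists M.
have [M0 hM0] := hg ord0.
by exists (M0 + M) => y; apply: le_trans (ler_normD _ _) _; rewrite lerD.
Qed.

Definition lattice_shift i N (k : lattice_index N) : lattice_index N :=
  [ffun j => if j == i then ordS (k j) else k j].

Lemma lattice_shift_inj i N : injective (@lattice_shift i N).
Proof.
move=> k k' /ffunP E; apply/ffunP => j; have := E j; rewrite !ffunE.
by case: eqP => // _; exact: ordS_inj.
Qed.

(** A shift by one mesh is a cyclic permutation of the indices, except that the last layer leaves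
    the cube while its index wraps around to the first layer. Both places have sup norm at least 1,
    where [X] vanishes. *)
Lemma lattice_sum_shift (X : V -> R) i N :
  (forall y, 1 <= `|y| -> X y = 0) ->
  \sum_(k : lattice_index N) X (N.+1%:R^-1 *: e i + lattice_point k) =
  \sum_(k : lattice_index N) X (lattice_point k).
Proof.
move=> X0; rewrite [RHS](reindex_inj (@lattice_shift_inj i N)).
apply: eq_bigr => k _.
have N0 : N.+1%:R != 0 :> R by rewrite pnatr_eq0.
have := ltn_ord (k i); rewrite ltnS leq_eqVlt => /predU1P[kN|kN].
  rewrite !X0 //.
    apply: le_trans (coord_le_norm _ i); rewrite !mxE ffunE eqxx /=.
    by rewrite kN modnn mul0r sub0r normrN normr1.
  apply: le_trans (coord_le_norm _ i); rewrite !mxE !eqxx /= kN -mul2n natrM mulfK //.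
  have Ni : 0 <= N.+1%:R^-1 :> R by rewrite invr_ge0 ler0n.
  by rewrite mulr1 [2]mulr2n addrK ger0_norm ?lerDr ?addr_ge0.
congr X; apply/rowP => j; rewrite !mxE ffunE eqxx /=.
have [->|_] := eqVneq j i; last by rewrite mulr0 add0r.
rewrite mulr1 /= modn_small; last by rewrite ltnS.
by rewrite -[(k i).+1]add1n natrD mulrDl mul1r addrA.
Qed.

(* Discrete integration by parts: the difference quotients of X with the mesh as
   increment have zero lattice mean by telescoping. *)
Lemma mean_derive (X dX : V -> R) i :
  (forall y, is_derive y (e i) X (dX y)) ->
  (forall y, 1 <= `|y| -> X y = 0) ->
  bounded_fun dX ->
  (forall eps : R, 0 < eps -> exists2 d : R, 0 < d &
    forall y z, `|z| < d -> `|dX (z + y) - dX y| <= eps) ->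
  mean dX = 0.
Proof.
move=> hX X0 bdX uc; apply: ulim_cvgn; apply/cvgrPdist_le => /= eps eps0.
have [d d0 hd] := uc _ eps0.
have inv_lt : \forall N \near \oo, (N.+1%:R : R)^-1 < d.
  by near=> N; near: N; exact: near_infty_natSinv_lt (PosNum d0).
near=> N; rewrite sub0r normrN.
have N0 : 0 < N.+1%:R :> R by rewrite ltr0n.
have Nd : (N.+1%:R : R)^-1 < d by near: N.
have -> : lattice_mean dX N = lattice_mean (fun y =>
    dX y - N.+1%:R * (X (N.+1%:R^-1 *: e i + y) - X y)) N.
  rewrite /lattice_mean sumrB -mulr_sumr sumrB lattice_sum_shift //.
  by rewrite subrr mulr0 subr0.
apply: lattice_mean_le => y.
have [s sN ->] := @MVT_coord _ _ X dX y i N.+1%:R^-1 (fun s _ => hX _).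
rewrite mulVKf ?gt_eqF // distrC; apply: hd.
rewrite normrZ; apply: le_lt_trans Nd.
rewrite -[leRHS]mulr1; apply: ler_pM => //; last exact: norm_delta_mx.
by rewrite (le_trans sN) // ger0_norm // invr_ge0 ltW.
Unshelve. all: by end_near. Qed.

End LatticeMean.

(** Near each (t0, y) both [g t] and [g t0] stay within eps / 2 of the value at (t0, y); compactness
    of [K], in its filter form, makes the neighbourhood of [t0] independent of [y]. *)
Lemma uniform_on_compact (R : realType) (T X : topologicalType) (K : set X)
    (g : T -> X -> R) (t0 : T) : compact K ->
  (forall y, K y -> {for (t0, y), continuous (fun p : T * X => g p.1 p.2)}) ->
  forall eps : R, 0 < eps ->
  \forall t \near t0, forall y, K y -> `|g t y - g t0 y| <= eps.
Proof.
move=> /compact_near_coveringP cK cg eps eps0.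
have eps2 : 0 < eps / 2 by rewrite divr_gt0.
have := cK T (nbhs t0) (fun t y => `|g t y - g t0 y| <= eps) _; apply => y Ky.
have /cvgrPdist_le /(_ _ eps2) := cg y Ky; rewrite /= => -[[A B] /= [At By] AB].
exists (B, A) => //= -[y' t] /= [By' At'].
have h1 := AB (t, y') (conj At' By'); have h2 := AB (t0, y') (conj (nbhs_singleton At) By').
rewrite [leRHS]splitr -(subrKA (g t0 y)) (le_trans (ler_normD _ _)) // lerD //=.
by rewrite distrC.
Qed.

(** * Weighted means, differentiation under the mean, positivity *)

Section WeightedMean.
Context {R : realType} {n : nat}.
Local Notation V := 'rV[R]_n.
Local Notation e i := (delta_mx ord0 i : V).
Implicit Types (x y z : V) (f g : V -> R) (N : nat).

Lemma continuous_compact_support_uniform f :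
  (forall y, {for y, continuous f}) -> (forall y, 1 <= `|y| -> f y = 0) ->
  forall eps : R, 0 < eps -> exists2 d : R, 0 < d &
    forall y z, `|z| < d -> `|f (z + y) - f y| <= eps.
Proof.
move=> cf f0 eps eps0.
(* Radius 2 leaves room for shifts of length below 1: when |y| > 2, both y and z + y lie where [f]
   vanishes. *)
have cK : compact [set y : V | `|y| <= 2].
  apply: bounded_closed_compact.
    by exists 2; split=> // M M2 y /= y2; rewrite (le_trans y2) // ltW.
  have -> : [set y : V | `|y| <= 2] = Num.norm @^-1` [set x : R | x <= 2] by [].
  by apply: closed_comp => [y _|]; [exact: norm_continuous | exact: closed_le].
have cg y : [set y : V | `|y| <= 2] y ->
    {for (0, y), continuous (fun p : V * V => f (p.1 + p.2))}.
  move=> _; apply: (@continuous_comp _ _ _ (fun p : V * V => p.1 + p.2) f).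
    exact: add_continuous.
  exact: cf.
have /nbhs_normP [d /= d0 hd] :=
  @uniform_on_compact R V V _ (fun z y => f (z + y)) 0 cK cg _ eps0.
exists (Num.min d 1); first by rewrite lt_min d0 ltr01.
move=> y z; rewrite lt_min => /andP[zd z1].
have [y2|y2] := leP `|y| 2.
  have zd' : ball_ Num.norm 0 d z by rewrite /= sub0r normrN.
  by have := hd z zd' y y2; rewrite add0r.
rewrite !f0 ?subrr ?normr0 ?ltW //.
  by rewrite (lt_trans _ y2) // ltr1n.
have := lerB_normD y z; rewrite [y + z]addrC; move: z1 y2.
by set a := `|y|; set b := `|z|; set c := `|_|; lra.
Qed.

Lemma mean_derive_support (X dX : V -> R) i :
  (forall y, is_derive y (e i) X (dX y)) ->
  (forall y, {for y, continuous dX}) ->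
  (forall y, 1 <= `|y| -> X y = 0) ->
  (forall y, 1 <= `|y| -> dX y = 0) ->
  mean dX = 0.
Proof.
move=> hX cdX X0 dX0; apply: (mean_derive hX X0).
  have [d d0 hd] := continuous_compact_support_uniform cdX dX0 ltr01.
  have cK : compact [set y : V | `|y| <= 1].
    apply: bounded_closed_compact.
      by exists 1; split=> // M M2 y /= y2; rewrite (le_trans y2) // ltW.
    have -> : [set y : V | `|y| <= 1] = Num.norm @^-1` [set x : R | x <= 1] by [].
    by apply: closed_comp => [y _|]; [exact: norm_continuous | exact: closed_le].
  have [||c cK1 hc] := @EVT_max_rV R n (fun y => `|dX y|) [set y : V | `|y| <= 1] _ cK.
  - by exists 0; rewrite /= normr0.
  - apply: continuous_subspaceT => y; apply: continuous_comp; first exact: cdX.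
    exact: norm_continuous.
  exists `|dX c| => y; have [y1|y1] := leP `|y| 1; first by apply: hc; rewrite inE.
  by rewrite dX0 ?normr0 // ltW.
exact: continuous_compact_support_uniform.
Qed.

Section Weight.
Variables (w : V -> R) (K : set V) (C : R).
Hypotheses (w_ge0 : forall y, 0 <= w y) (w_leC : forall y, w y <= C).
Hypotheses (cK : compact K) (wK : forall y, ~ K y -> w y = 0).

(** Not normalised: the mass is [wmean (fun=> 1)], and estimates are relative to it. Outside [K] the
    weight is 0, so [g] may be arbitrary there. *)
Definition wmean g := mean (fun y => w y * g y).

Lemma bounded_weighted g (M : R) : (forall y, K y -> `|g y| <= M) ->
  bounded_fun (fun y => w y * g y).
Proof.
move=> gM; exists (C * `|M|) => y; have [Ky|nKy] := pselect (K y); last first.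
  by rewrite wK // mul0r normr0 mulr_ge0 // (le_trans (w_ge0 y)).
rewrite normrM ger0_norm // ler_pM //.
by apply: le_trans (gM _ Ky) _; exact: ler_norm.
Qed.

Lemma continuous_bounded_on g : (forall y, K y -> {for y, continuous g}) ->
  exists2 M : R, 0 <= M & forall y, K y -> `|g y| <= M.
Proof.
move=> cg; have [->|/set0P K0] := eqVneq K set0; first by exists 0.
have [|c Kc hc] := @EVT_max_rV R n (fun y => `|g y|) K K0 cK.
  apply: continuous_in_subspaceT => y; rewrite inE => Ky.
  by apply: continuous_comp; [exact: cg | exact: norm_continuous].
by exists `|g c| => // y Ky; apply: hc; rewrite inE.
Qed.

Lemma bounded_wcontinuous g : (forall y, K y -> {for y, continuous g}) ->
  bounded_fun (fun y => w y * g y).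
Proof. by move=> /continuous_bounded_on[M _ /bounded_weighted]. Qed.

Lemma wmeanD f g : (forall y, K y -> {for y, continuous f}) ->
  (forall y, K y -> {for y, continuous g}) ->
  wmean (fun y => f y + g y) = wmean f + wmean g.
Proof.
move=> cf cg; rewrite /wmean; under eq_fun do rewrite mulrDr.
by apply: meanD; exact: bounded_wcontinuous.
Qed.

Lemma wmeanZ (a : R) g : (forall y, K y -> {for y, continuous g}) ->
  wmean (fun y => a * g y) = a * wmean g.
Proof.
move=> cg; rewrite /wmean; under eq_fun do rewrite mulrCA.
by apply: meanZ; exact: bounded_wcontinuous.
Qed.

Lemma eq_wmean f g : (forall y, K y -> f y = g y) -> wmean f = wmean g.
Proof.
move=> fg; congr mean; apply: funext => y.
by have [/fg ->//|/wK ->] := pselect (K y); rewrite !mul0r.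
Qed.

Lemma wmean_le g (M : R) : (forall y, K y -> `|g y| <= M) ->
  `|wmean g| <= M * wmean (fun=> 1).
Proof.
move=> gM.
have b1 : bounded_fun (fun y => w y * 1) by apply: (@bounded_weighted _ 1) => y; rewrite normr1.
have bM (a : R) : bounded_fun (fun y => a * (w y * 1)).
  by case: b1 => C' hC'; exists (`|a| * C') => y; rewrite normrM ler_pM.
have bg := bounded_weighted gM.
have pw y : - M * (w y * 1) <= w y * g y <= M * (w y * 1).
  have [Ky|nKy] := pselect (K y); last by rewrite wK // !mul0r !mulr0 lexx.
  rewrite !mulr1 mulrC [M * _]mulrC !ler_wpM2l //.
    by have := gM y Ky; rewrite ler_norml => /andP[].
  by have := gM y Ky; rewrite ler_norml => /andP[].
rewrite ler_norml -mulNr -!meanZ //.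
by apply/andP; split; apply: le_mean => // y; case/andP: (pw y).
Qed.

(** By the mean value theorem the error of the difference quotient at [y] is G'(s + t0, y) - G'(t0,
    y), which is small uniformly on [K]; the mean of a uniformly small function is small. *)
Lemma wmean_is_derive (G G' : R -> V -> R) (t0 : R) :
  (\forall t \near t0, forall y, K y -> is_derive (t : R) 1 (G ^~ y) (G' t y)) ->
  (\forall t \near t0, forall y, K y -> {for y, continuous (G t)}) ->
  (forall y, K y -> {for (t0, y), continuous (fun p : R * V => G' p.1 p.2)}) ->
  is_derive t0 1 (fun t => wmean (G t)) (wmean (G' t0)).
Proof.
move=> dG cG cG'.
suff H : (fun h : R => h^-1 *: (wmean (G (h *: 1 + t0)) - wmean (G t0))) @ 0^' -->
    wmean (G' t0).
  by split; [apply/cvg_ex; exists (wmean (G' t0)) | apply: cvg_lim].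
apply/cvgrPdist_le => /= eps eps0.
have C0 : 0 <= C by exact: le_trans (w_ge0 0) (w_leC 0).
have eps1 : 0 < eps / (C + 1) by rewrite divr_gt0 // ltr_wpDl.
have U := uniform_on_compact cK cG' eps1.
have cGt0 : forall y, K y -> {for y, continuous (G t0)} by exact: nbhs_singleton cG.
have cG't0 : forall y, K y -> {for y, continuous (G' t0)}.
  move=> y Ky; apply: (@continuous_comp _ _ _ (fun z : V => (t0, z)) (fun p => G' p.1 p.2)).
    move=> A [[P Q] /= [Pt Qy] PQ]; apply: filterS Qy => z Qz.
    by apply: (PQ (t0, z)); split => //=; exact: nbhs_singleton.
  exact: cG'.
have : \forall t \near t0, (forall y, K y -> is_derive (t : R) 1 (G ^~ y) (G' t y)) /\
    (forall y, K y -> {for y, continuous (G t)}) /\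
    (forall y, K y -> `|G' t y - G' t0 y| <= eps / (C + 1)).
  by apply: filterI => //; exact: filterI.
move=> /nbhs_normP[d /= d0 hd].
near=> h.
have h0 : h != 0 by near: h; exact: nbhs_dnbhs_neq.
have hh : `|h| < d by near: h; exact: dnbhs0_lt.
have inb (s : R) : `|s| <= `|h| -> `|t0 - (s + t0)| < d.
  by move=> sh; rewrite opprD addrCA subrr addr0 normrN (le_lt_trans sh).
have cGh : forall y, K y -> {for y, continuous (G (h + t0))}.
  by have [_ [+ _]] := hd _ (inb h (lexx _)).
rewrite [h%:A]mulr1 /GRing.scale /=.
have -> : wmean (G' t0) - h^-1 * (wmean (G (h + t0)) - wmean (G t0)) =
   wmean (fun y => G' t0 y + - h^-1 * (G (h + t0) y + - 1 * G t0 y)).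
  have cN : forall y, K y -> {for y, continuous (fun y => -1 * G t0 y)}.
    by move=> y Ky; apply: contZ; exact: cGt0.
  have cS : forall y, K y -> {for y, continuous (fun y => G (h + t0) y + -1 * G t0 y)}.
    by move=> y Ky; apply: contD; [exact: cGh | exact: cN].
  rewrite wmeanD // ?wmeanZ // ?wmeanD // ?wmeanZ // ?mulN1r ?mulNr //.
  by move=> y Ky; apply: contZ; exact: cS.
rewrite /wmean; apply: ulim_norm_le => N; apply: lattice_mean_le => y.
have [Ky|/wK ->] := pselect (K y); last by rewrite mul0r normr0 ltW.
have [|s sh E] := @MVT0 R (fun s => G (s + t0) y) (fun s => G' (s + t0) y) h.
  move=> s sh; have [+ _] := hd _ (inb s sh); move=> /(_ y Ky) /is_derive_shift0 hs.
  apply/is_derive_shift0.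
  by under eq_fun do rewrite -addrA.
have [_ [_ /(_ y Ky)]] := hd _ (inb s sh).
rewrite add0r in E; rewrite mulN1r E mulrA mulNr mulVf // mulN1r distrC => H.
rewrite normrM ger0_norm // [leRHS](_ : _ = (C + 1) * (eps / (C + 1))).
  by rewrite ler_pM // (le_trans (w_leC _)) // lerDl.
by rewrite mulrCA mulfV ?mulr1 // gt_eqF // ltr_wpDl.
Unshelve. all: by end_near. Qed.

End Weight.

(** Division by the mass requires it to be positive, and a nonnegative [w] might have zero mean. It
    does not, because a box contains a fixed fraction of the grid points for every large [N]. *)
Lemma mean_box_gt0 (w : V -> R) (C a b c : R) :
  (forall y, 0 <= w y) -> (forall y, w y <= C) -> 0 <= a + 1 -> a < b -> b <= 1 -> 0 < c ->
  (forall y, (forall j, a <= y ord0 j <= b) -> c <= w y) -> 0 < mean w.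
Proof.
move=> w0 wC a1 ab b1 c0 wc.
have [q q0 hq] : exists2 q, (0 < q)%N & 2 / q%:R <= b - a.
  exists (Num.truncn (2 / (b - a))).+1 => //.
  rewrite ler_pdivrMr ?ltr0n // mulrC -ler_pdivrMr ?subr_gt0 //.
  exact/ltW/truncnS_gt.
(* With [m] indices per axis inside [a, b] and M <= 2 m q, one has 2M + 1 <= 3M <= 6 q m, so each
   axis retains at least the fraction 1/(6q). *)
pose r : R := (6 * q%:R)^-1.
have r0 : 0 < r by rewrite invr_gt0 mulr_gt0 // ltr0n.
apply: (@lt_le_trans _ _ (c * r ^+ n)); first by rewrite mulr_gt0 // exprn_gt0.
rewrite -[leLHS]ulim_cst; apply: (ulim_le (M := `|c * r ^+ n|) (N := C)) => //.
  by move=> N; apply: lattice_mean_le => y; rewrite ger0_norm.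
near=> N; set M := N.+1.
have qM : (q <= M)%N by apply: leqW; near: N; exact: nbhs_infty_ge.
have M0 : 0 < M%:R :> R by rewrite ltr0n.
(* [i0] is an index whose coordinate is at least [a] and exceeds it by at most one mesh; the
   inequality 2/q <= b - a keeps the [m] indices from [i0] on below [b]. *)
pose m := (M %/ q)%N; pose i0 := (Num.truncn ((a + 1) * M%:R)).+1.
have mq : m%:R * q%:R <= M%:R :> R by rewrite -natrM ler_nat leq_divM.
have m1 : (1 <= m)%N by rewrite divn_gt0.
have Mm : M%:R <= 2 * m%:R * q%:R :> R.
  rewrite -!natrM ler_nat -mulnA mul2n -addnn.
  apply: leq_trans (ltnW (ltn_ceil M q0)) _; rewrite -/m mulSn addnC leq_add2l.
  by rewrite leq_pmull.
have i0l : (a + 1) * M%:R <= i0%:R by apply/ltW/truncnS_gt.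
have i0u : i0%:R <= (a + 1) * M%:R + 1.
  by rewrite /i0 -natr1 lerD2r truncn_le // mulr_ge0 // ltW.
have qm : 1 + m%:R <= (b - a) * M%:R.
  apply: (@le_trans _ _ (2 / q%:R * M%:R)); last by rewrite ler_wpM2r // ltW.
  have q0' : 0 < q%:R :> R by rewrite ltr0n.
  rewrite mulrAC ler_pdivlMr // mulrDl mul1r [2]mulr2n mulrDl mul1r lerD //.
  by rewrite ler_nat.
have kin (k : 'I_m) : (i0 + k < M.*2.+1)%N.
  rewrite ltnS -(ler_nat R) natrD -mul2n natrM.
  have : (k%:R : R) <= m%:R by rewrite ler_nat ltnW.
  have : (b + 1) * M%:R <= 2 * M%:R by rewrite ler_pM2r //; lra.
  by move: i0u qm; set A := M%:R; set B := m%:R; lra.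
pose D := [set Ordinal (kin k) | k : 'I_m].
have cD : #|D| = m.
  rewrite card_imset ?card_ord // => k k' [] /eqP; rewrite eqn_add2l => /eqP.
  exact: val_inj.
pose S := [pred k : @lattice_index n N | k \in ffun_on (mem D)].
have cS : #|S| = (m ^ n)%N by rewrite -cD -[n in RHS]card_ord -card_ffun_on; apply: eq_card.
rewrite /lattice_mean ler_pdivlMr ?card_lattice_gt0 //.
apply: (@le_trans _ _ (\sum_(k in S) w (lattice_point k))); last first.
  by rewrite [leRHS](bigID (mem S)) /= lerDl sumr_ge0.
apply: (@le_trans _ _ (\sum_(k in S) c)); last first.
  apply: ler_sum => k; rewrite inE => /ffun_onP kD; apply: wc => j.
  have /imsetP[k' _ kE] := kD j; rewrite mxE kE /=.
  rewrite lerBrDr ler_pdivlMr // lerBlDr ler_pdivrMr // natrD.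
  have : (k'%:R : R) <= m%:R by rewrite ler_nat ltnW.
  have : 0 <= (k'%:R : R) by rewrite ler0n.
  move: i0u i0l qm; set A := M%:R; set B := m%:R; set k0 := k'%:R => ? ? ? ? ?.
  by apply/andP; split; lra.
rewrite sumr_const cS -[leRHS]mulr_natr -mulrA ler_pM2l // card_ffun !card_ord natrX natrX -exprMn.
have rm : 0 <= r * M.*2.+1%:R by rewrite mulr_ge0 // ?ltW // ler0n.
apply: lerXn2r; rewrite ?nnegrE ?ler0n //.
rewrite mulrC ler_pdivrMr ?mulr_gt0 ?ltr0n // -natr1 -mul2n natrM.
have : 1 <= (M%:R : R) by rewrite ler1n.
move: Mm; rewrite -/M; set A := m%:R; set B := q%:R; lra.
Unshelve. all: by end_near. Qed.

End WeightedMean.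

(** * Differential calculus *)

Section DerivativeRules.
Context {R : realType} {V : normedModType R}.
Implicit Types (f g : V -> R) (x v : V).

Lemma derC (a : R) x v : is_derive x v (fun=> a) 0.
Proof. exact: is_derive_cst. Qed.

Lemma derD f g x v (df dg : R) : is_derive x v f df -> is_derive x v g dg ->
  is_derive x v (fun y => f y + g y) (df + dg).
Proof. by move=> hf hg; exact: is_deriveD. Qed.

Lemma derN f x v (df : R) : is_derive x v f df -> is_derive x v (fun y => - f y) (- df).
Proof. by move=> hf; exact: is_deriveN. Qed.

Lemma derB f g x v (df dg : R) : is_derive x v f df -> is_derive x v g dg ->
  is_derive x v (fun y => f y - g y) (df - dg).
Proof. by move=> hf hg; exact: is_deriveB. Qed.

Lemma derM f g x v (df dg : R) : is_derive x v f df -> is_derive x v g dg ->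
  is_derive x v (fun y => f y * g y) (df * g x + f x * dg).
Proof.
move=> hf hg; have H := @is_deriveM R V f g x v df dg hf hg.
apply: is_derive_eq H _; by rewrite /GRing.scale /= addrC [g x * _]mulrC.
Qed.

Lemma derZ (a : R) f x v (df : R) : is_derive x v f df ->
  is_derive x v (fun y => a * f y) (a * df).
Proof.
move=> hf; have := derM (derC a x v) hf.
by rewrite mul0r add0r.
Qed.

Lemma derX f x v (df : R) m : is_derive x v f df ->
  is_derive x v (fun y => f y ^+ m.+1) (m.+1%:R * f x ^+ m * df).
Proof.
move=> hf; elim: m => [|m IH].
  by rewrite expr0 mulr1 mul1r; under eq_fun do rewrite expr1.
have -> : (fun y => f y ^+ m.+2) = (fun y => f y * f y ^+ m.+1).
  by apply: funext => y; rewrite exprS.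
apply: is_derive_eq (derM hf IH) _.
by rewrite exprS -[in RHS]natr1; ring.
Qed.

Lemma derV f x v (df : R) : f x != 0 -> is_derive x v f df ->
  is_derive x v (fun y => (f y)^-1) (- df / f x ^+ 2).
Proof.
move=> f0 [hf <-]; split; first exact: derivableV.
by rewrite deriveV // /GRing.scale /= mulNr mulrC mulNr.
Qed.

Lemma der_sum m (f : 'I_m -> V -> R) (df : 'I_m -> R) x v :
  (forall i, is_derive x v (f i) (df i)) ->
  is_derive x v (fun y => \sum_i f i y) (\sum_i df i).
Proof.
move=> hf; have -> : (fun y => \sum_i f i y) = \sum_i f i.
  by apply: funext => y; rewrite fct_sumE.
exact: is_derive_sum.
Qed.

Lemma near_der f g x v (df : R) : (\forall y \near x, f y = g y) ->
  is_derive x v f df -> is_derive x v g df.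
Proof.
have [->|v0] := eqVneq v 0.
  move=> _ [_ <-]; rewrite derive0; exact: is_derive0.
by move=> fg; apply: near_eq_is_derive => //; apply: filterS fg => y ->.
Qed.

(** Off the closed set the function is locally 0, so only points of [K] need checking. In this way
    fields built from functions that are controlled only on the shell become differentiable on the
    whole space. *)
Lemma der_support (K : set V) (f df : V -> R) v : closed K ->
  (forall y, ~ K y -> f y = 0) -> (forall y, ~ K y -> df y = 0) ->
  (forall y, K y -> is_derive y v f (df y)) ->
  forall y, is_derive y v f (df y).
Proof.
move=> cK f0 df0 df1 y; have [/df1 //|nKy] := pselect (K y).
rewrite df0 //; apply: (near_der _ (derC 0 y v)).
have : open (~` K) by exact: closed_openC.
rewrite openE => /(_ y nKy); apply: filterS => z /= nz; by rewrite f0.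
Qed.

Lemma cont_support (K : set V) (f : V -> R) : closed K ->
  (forall y, ~ K y -> f y = 0) -> (forall y, K y -> {for y, continuous f}) ->
  forall y, {for y, continuous f}.
Proof.
move=> cK f0 cf y; have [/cf //|nKy] := pselect (K y).
have : open (~` K) by exact: closed_openC.
rewrite openE => /(_ y nKy) hK.
move=> A /nbhs_singleton; rewrite f0 // => A0.
suff : nbhs y (f @^-1` A) by [].
by apply: filterS hK => z nz; rewrite /preimage /= f0.
Qed.

End DerivativeRules.

Lemma is_derive_comp_scale (R : realType) (V : normedModType R) (f : V -> R) (a : R) x v (d : R) :
  is_derive (a *: x) v f d -> is_derive x v (fun y => f (a *: y)) (a * d).
Proof.
move=> /is_derive_line h; apply/is_derive_line.
have -> : (fun h : R => f (a *: (h *: v + x))) =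
    (fun h : R => (fun k : R => f (k *: v + a *: x)) (a * h)).
  by apply: funext => k; rewrite scalerDr scalerA.
rewrite mulrC; apply: (@is_derive_comp1 R R^o (fun k : R => f (k *: v + a *: x)) (fun h => a * h)).
  by rewrite -[X in is_derive _ _ _ X]mulr1; apply: derZ; exact: is_derive_id.
by rewrite mulr0.
Qed.

Section Coordinates.
Context {R : realType} {n : nat}.
Local Notation V := 'rV[R]_n.
Local Notation e i := (delta_mx ord0 i : V).
Implicit Types (x y z : V).

Definition sqnorm y : R := \sum_i y ord0 i ^+ 2.

Lemma enormE y : enorm y = Num.sqrt (sqnorm y). Proof. by []. Qed.

Lemma sqnorm_ge0 y : 0 <= sqnorm y.
Proof. by apply: sumr_ge0 => i _; exact: sqr_ge0. Qed.

Lemma enorm_sqr y : enorm y ^+ 2 = sqnorm y.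
Proof. by rewrite sqr_sqrtr // sqnorm_ge0. Qed.

Lemma enorm_ge0 y : 0 <= enorm y. Proof. exact: sqrtr_ge0. Qed.

Lemma eballE y : eball y = (sqnorm y < 1) :> Prop.
Proof.
rewrite /eball /= enormE -[X in _ < X]sqrtr1.
by rewrite ltr_sqrt.
Qed.

Lemma sqr_coord_le y i : y ord0 i ^+ 2 <= sqnorm y.
Proof.
by rewrite /sqnorm (bigD1 i) //= lerDl sumr_ge0 // => j _; exact: sqr_ge0.
Qed.

Lemma sqnorm_eq0 y : (sqnorm y == 0) = (y == 0).
Proof.
apply/eqP/eqP => [h|->]; last by rewrite /sqnorm big1 // => i _; rewrite mxE expr0n.
apply/rowP => i; rewrite mxE; apply/eqP; rewrite -sqrf_eq0 eq_le sqr_ge0 andbT -h.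
exact: sqr_coord_le.
Qed.

Lemma sqnorm_gt0 y : (0 < sqnorm y) = (y != 0).
Proof. by rewrite lt_def sqnorm_ge0 andbT sqnorm_eq0. Qed.

Lemma enorm_gt0 y : (0 < enorm y) = (y != 0).
Proof. by rewrite sqrtr_gt0 sqnorm_gt0. Qed.

Lemma sqnormZ (a : R) y : sqnorm (a *: y) = a ^+ 2 * sqnorm y.
Proof. by rewrite /sqnorm mulr_sumr; apply: eq_bigr => i _; rewrite mxE exprMn. Qed.

Lemma enormZ (a : R) y : 0 <= a -> enorm (a *: y) = a * enorm y.
Proof. by move=> a0; rewrite !enormE sqnormZ sqrtrM ?sqr_ge0 // sqrtr_sqr ger0_norm. Qed.

Lemma norm_le_enorm y : `|y| <= enorm y.
Proof.
apply: norm_rV_le => [|j]; first exact: enorm_ge0.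
by rewrite -sqrtr_sqr enormE ler_wsqrtr // sqr_coord_le.
Qed.

Lemma coord_le_enorm y j : `|y ord0 j| <= enorm y.
Proof. exact: le_trans (coord_le_norm y j) (norm_le_enorm y). Qed.

Lemma der_coord i j y : is_derive y (e i) (fun y : V => y ord0 j) (i == j)%:R.
Proof.
have d : differentiable (fun y : V => y ord0 j) y by exact: differentiable_coord.
split; first exact: diff_derivable.
rewrite /derive; apply: cvg_lim => //.
apply: cvg_near_cst; near=> h; have h0 : h != 0 by near: h; exact: nbhs_dnbhs_neq.
by rewrite /= !mxE eqxx /= addrK /GRing.scale /= mulrA mulVf // mul1r eq_sym.
Unshelve. all: by end_near. Qed.

Lemma cont_coord j y : {for y, continuous (fun y : V => y ord0 j)}.
Proof. exact: coord_continuous. Qed.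

Lemma der_sqnorm i y : is_derive y (e i) sqnorm (2 * y ord0 i).
Proof.
apply: is_derive_eq; first by apply: der_sum => j; apply: derX; exact: der_coord.
rewrite (bigD1 i) //= big1 => [|j ji]; first by rewrite eqxx expr1 mulr1 addr0.
by rewrite eq_sym (negbTE ji) mulr0.
Qed.

Lemma cont_sqnorm y : {for y, continuous sqnorm}.
Proof. by apply: cont_sum => i; apply: contX; exact: cont_coord. Qed.

Lemma sum_coord_delta (f : 'I_n -> R) i : \sum_j (i == j)%:R * f j = f i.
Proof.
rewrite (bigD1 i) //= big1 => [|j ji]; first by rewrite eqxx mul1r addr0.
by rewrite eq_sym (negbTE ji) mul0r.
Qed.

Definition shell (a b : R) : set V := [set y | a <= sqnorm y <= b].

Lemma closed_shell a b : closed (shell a b).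
Proof.
have -> : shell a b = sqnorm @^-1` [set x | a <= x <= b] by [].
apply: closed_comp => [y _|]; first exact: cont_sqnorm.
have -> : [set x : R | a <= x <= b] = [set x | a <= x] `&` [set x | x <= b].
  by apply/seteqP; split => x /=; [move/andP | move=> [-> ->]].
by apply: closedI; [exact: closed_ge | exact: closed_le].
Qed.

Lemma compact_shell a b : compact (shell a b).
Proof.
apply: bounded_closed_compact; last exact: closed_shell.
exists (Num.sqrt b); split; first exact: num_real.
move=> M bM y /= /andP[_ yb]; apply: le_trans (norm_le_enorm y) _.
by rewrite enormE; apply: le_trans (ltW bM); exact: ler_wsqrtr.
Qed.

End Coordinates.

(** * A continuously differentiable cutoff *)

Section Bump.
Context {R : realType}.

Lemma der_max0_sqr (z : R) : is_derive z 1 (fun t : R => Num.max 0 t ^+ 2) (2 * Num.max 0 z).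
Proof.
have [z0|z0|->] := ltgtP z 0.
- rewrite mulr0; apply: (near_der _ (derC 0 z 1)).
  near=> t; have t0 : t < 0 by near: t; exact: lt_nbhsl.
  by rewrite max_l ?expr0n // ltW.
- have H : is_derive z 1 (fun t : R => t ^+ 2) (2 * z).
    by have := derX 1 (is_derive_id z (1 : R)); rewrite expr1 mulr1.
  apply: (near_der _ H).
  near=> t; have t0 : 0 < t by near: t; exact: lt_nbhsr.
  by rewrite max_r // ltW.
- rewrite mulr0.
  suff H : (fun h : R => h^-1 *: ((fun t : R => Num.max 0 t ^+ 2) (h *: 1 + 0)
      - (fun t : R => Num.max 0 t ^+ 2) 0)) @ 0^' --> (0 : R).
    by split; [apply/cvg_ex; exists 0 | apply: cvg_lim].
  apply/cvgrPdist_le => /= eps eps0; near=> h.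
  have h0 : h != 0 by near: h; exact: nbhs_dnbhs_neq.
  have hh : `|h| < eps by near: h; exact: dnbhs0_lt.
  rewrite sub0r normrN [h%:A]mulr1 addr0 maxxx expr0n subr0 /GRing.scale /=.
  rewrite normrM normfV ler_pdivrMl ?normr_gt0 // normrX expr2.
  have : `|Num.max 0 h| <= `|h|.
    by case: (leP 0 h) => h1; rewrite ?normr0.
  by move=> H; apply: ler_pM => //; exact: le_trans H (ltW hh).
Unshelve. all: by end_near. Qed.

(** The square of the positive part is C^1 across the endpoints, which is all the regularity that a
    single integration by parts requires. *)
Definition bump (a b t : R) : R := Num.max 0 ((t - a) * (b - t)) ^+ 2.
Definition dbump (a b t : R) : R :=
  2 * Num.max 0 ((t - a) * (b - t)) * (a + b - 2 * t).

Lemma der_bump (a b t : R) : is_derive t 1 (bump a b) (dbump a b t).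
Proof.
rewrite /dbump; apply: (@is_derive_comp1 _ R^o (fun t => Num.max 0 t ^+ 2) (fun t => (t - a) * (b - t))).
  by apply: is_derive_eq; rewrite /GRing.scale /=; ring.
exact: der_max0_sqr.
Qed.

Lemma bump_ge0 a b t : 0 <= bump a b t. Proof. exact: sqr_ge0. Qed.

Lemma bump_out a b t : ~ (a <= t <= b) -> a <= b -> bump a b t = 0 /\ dbump a b t = 0.
Proof.
move=> h ab; suff E : Num.max 0 ((t - a) * (b - t)) = 0.
  by rewrite /bump /dbump E expr0n mulr0 mul0r.
apply/max_idPl; have [at_|ta] := leP a t; have [tb|bt] := leP t b.
- by case: h; rewrite at_.
- by rewrite mulr_ge0_le0 // ?subr_ge0 // subr_le0 ltW.
- by rewrite mulr_le0_ge0 // ?subr_ge0 // subr_le0 ltW.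
- by move: (lt_trans bt ta); rewrite ltNge ab.
Qed.

Lemma bump_le a b t : a <= b -> bump a b t <= (b - a) ^+ 4.
Proof.
move=> ab; have [/andP[h1 h2]|/negP h] := boolP (a <= t <= b); last first.
  by rewrite (bump_out h ab).1 exprn_ge0 // subr_ge0.
have p : 0 <= (t - a) * (b - t) by rewrite mulr_ge0 // subr_ge0.
rewrite /bump max_r // (exprM _ 2 2); apply: lerXn2r; rewrite ?nnegrE ?sqr_ge0 //.
by rewrite expr2; apply: ler_pM; rewrite ?subr_ge0 // ?lerB.
Qed.

Lemma cont_bump a b t : {for t, continuous (bump a b)}.
Proof.
by apply: differentiable_continuous; apply/derivable1_diffP; case: (der_bump a b t).
Qed.

Lemma cont_max0 (t : R) : {for t, continuous (fun t : R => Num.max 0 t)}.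
Proof.
have -> : (fun t : R => Num.max 0 t) = (fun t => (t + `|t|) / 2).
  apply: funext => s; case: (leP 0 s) => h; first by rewrite ger0_norm //; lra.
  by rewrite ltr0_norm //; lra.
apply: contM; last exact: cont_cst.
by apply: contD; [exact: cvg_id | exact: norm_continuous].
Qed.

Lemma cont_dbump a b t : {for t, continuous (dbump a b)}.
Proof.
have cid : {for t, continuous (fun t : R => t)} by exact: cvg_id.
have cc (c : R) : {for t, continuous (fun=> c)} by exact: cont_cst.
apply: contM; last by apply: contB => //; exact: contZ.
apply: contZ; apply: (@cont_comp _ _ _ (fun t => (t - a) * (b - t)) (fun s => Num.max 0 s)).
  by apply: contM; apply: contB.
exact: cont_max0.
Qed.

End Bump.

(** * Green's formula on a shell *)

Section PotentialData.
Context {R : realType} {n : nat}.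
Local Notation V := 'rV[R]_n.
Local Notation e i := (delta_mx ord0 i : V).
Implicit Types y : V.

(** [r] bounds |y|^2, so the radius is its square root; [u2 i j] is the derivative in direction [i]
    of [u1 j]. Derivatives are carried as explicit functions so that a dilate of [u] can be given
    its own. *)
Record harmonic_data (r : R) (u : V -> R) (u1 : 'I_n -> V -> R)
    (u2 : 'I_n -> 'I_n -> V -> R) : Prop := HarmonicData {
  hd_der : forall y i, sqnorm y < r -> is_derive y (e i) u (u1 i y);
  hd_der2 : forall y i j, sqnorm y < r -> is_derive y (e i) (u1 j) (u2 i j y);
  hd_cont : forall y, sqnorm y < r -> {for y, continuous u};
  hd_cont1 : forall y i, sqnorm y < r -> {for y, continuous (u1 i)};
  hd_cont2 : forall y i j, sqnorm y < r -> {for y, continuous (u2 i j)};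
  hd_lap : forall y, sqnorm y < r -> \sum_i u2 i i y = 0 }.

(* C^2 functions on the punctured space, homogeneous of degree 0 by Euler's
   identity; f2 i is the second derivative in the direction i. *)
Record homogeneous_data (f : V -> R) (f1 f2 : 'I_n -> V -> R) : Prop := HomogeneousData {
  ho_der : forall y i, y != 0 -> is_derive y (e i) f (f1 i y);
  ho_der2 : forall y i, y != 0 -> is_derive y (e i) (f1 i) (f2 i y);
  ho_cont : forall y, y != 0 -> {for y, continuous f};
  ho_cont1 : forall y i, y != 0 -> {for y, continuous (f1 i)};
  ho_cont2 : forall y i, y != 0 -> {for y, continuous (f2 i)};
  ho_euler : forall y, y != 0 -> \sum_i y ord0 i * f1 i y = 0 }.

End PotentialData.

Arguments hd_der {R n r u u1 u2} h {y} i _.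
Arguments hd_der2 {R n r u u1 u2} h {y} i j _.
Arguments hd_cont {R n r u u1 u2} h {y} _ t _.
Arguments hd_cont1 {R n r u u1 u2} h {y} i _ t _.
Arguments hd_cont2 {R n r u u1 u2} h {y} i j _ t _.
Arguments ho_der {R n f f1 f2} h {y} i _.
Arguments ho_der2 {R n f f1 f2} h {y} i _.
Arguments ho_cont {R n f f1 f2} h {y} _ t _.
Arguments ho_cont1 {R n f f1 f2} h {y} i _ t _.
Arguments ho_cont2 {R n f f1 f2} h {y} i _ t _.

Section ShellMean.
Context {R : realType} {n : nat}.
Local Notation V := 'rV[R]_n.
Local Notation e i := (delta_mx ord0 i : V).
Implicit Types (x y z : V) (f g : V -> R).

Definition euler (u1 : 'I_n -> V -> R) y : R := \sum_j y ord0 j * u1 j y.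

(** The Euler operator y . grad applied twice. *)
Definition euler2 (u1 : 'I_n -> V -> R) (u2 : 'I_n -> 'I_n -> V -> R) y : R :=
  euler u1 y + \sum_i y ord0 i * \sum_j y ord0 j * u2 i j y.

(** On functions homogeneous of degree 0 this is the Laplace-Beltrami operator of the sphere. *)
Definition slap (f2 : 'I_n -> V -> R) y : R := sqnorm y * \sum_i f2 i y.

Lemma cont_euler u1 y : (forall i, {for y, continuous (u1 i)}) ->
  {for y, continuous (euler u1)}.
Proof. by move=> c; apply: cont_sum => i; apply: contM => //; exact: cont_coord. Qed.

Lemma cont_euler2 u1 u2 y : (forall i, {for y, continuous (u1 i)}) ->
  (forall i j, {for y, continuous (u2 i j)}) -> {for y, continuous (euler2 u1 u2)}.
Proof.
move=> c1 c2; apply: contD; first exact: cont_euler.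
apply: cont_sum => i; apply: contM; first exact: cont_coord.
by apply: cont_sum => j; apply: contM => //; exact: cont_coord.
Qed.

Lemma cont_slap (f2 : 'I_n -> V -> R) y : (forall i, {for y, continuous (f2 i)}) ->
  {for y, continuous (slap f2)}.
Proof. by move=> c; apply: contM; [exact: cont_sqnorm | exact: cont_sum]. Qed.

Variables (a b : R).
Hypotheses (a0 : 0 < a) (ab : a < b) (b1 : b < 1).
Local Notation K := (@shell R n a b).

Definition weight y : R := bump a b (sqnorm y).
Definition dweight y : R := dbump a b (sqnorm y).
Definition smean g : R := wmean weight g.

Lemma weight_ge0 y : 0 <= weight y. Proof. exact: bump_ge0. Qed.
Lemma weight_le y : weight y <= (b - a) ^+ 4. Proof. exact/bump_le/ltW. Qed.
Lemma weight_out y : ~ K y -> weight y = 0.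
Proof. by move=> h; have [] := bump_out h (ltW ab). Qed.
Lemma dweight_out y : ~ K y -> dweight y = 0.
Proof. by move=> h; have [] := bump_out h (ltW ab). Qed.
Lemma shell_neq0 y : K y -> y != 0.
Proof. by case/andP => h _; rewrite -sqnorm_gt0 (lt_le_trans a0). Qed.
Lemma shell_lt1 y : K y -> sqnorm y < 1.
Proof. by case/andP => _ h; exact: le_lt_trans b1. Qed.
Lemma shell_norm_ge1 y : 1 <= `|y| -> ~ K y.
Proof.
move=> y1 /shell_lt1; apply/negP; rewrite -leNgt -enorm_sqr -[1](expr1n _ 2).
by rewrite ler_pXn2r ?nnegrE ?enorm_ge0 // (le_trans y1) // norm_le_enorm.
Qed.

Lemma der_weight i y : is_derive y (e i) weight (dweight y * (2 * y ord0 i)).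
Proof. by apply: is_derive_comp1; [exact: der_sqnorm | exact: der_bump]. Qed.
Lemma cont_weight y : {for y, continuous weight}.
Proof. by apply: cont_comp; [exact: cont_sqnorm | exact: cont_bump]. Qed.
Lemma cont_dweight y : {for y, continuous dweight}.
Proof. by apply: cont_comp; [exact: cont_sqnorm | exact: cont_dbump]. Qed.

Lemma smeanD f g : (forall y, K y -> {for y, continuous f}) ->
  (forall y, K y -> {for y, continuous g}) ->
  smean (fun y => f y + g y) = smean f + smean g.
Proof.
exact: (wmeanD weight_ge0 weight_le (@compact_shell R n a b) weight_out).
Qed.

Lemma smeanZ (c : R) g : (forall y, K y -> {for y, continuous g}) ->
  smean (fun y => c * g y) = c * smean g.
Proof.
exact: (wmeanZ weight_ge0 weight_le (@compact_shell R n a b) weight_out).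
Qed.

Lemma smeanB f g : (forall y, K y -> {for y, continuous f}) ->
  (forall y, K y -> {for y, continuous g}) ->
  smean (fun y => f y - g y) = smean f - smean g.
Proof.
move=> cf cg; rewrite -[- smean g]mulN1r -smeanZ // -smeanD //.
  by congr (smean _); apply: funext => y; rewrite mulN1r.
by move=> y Ky; apply: contZ; exact: cg.
Qed.

Lemma eq_smean f g : (forall y, K y -> f y = g y) -> smean f = smean g.
Proof. exact: (eq_wmean weight_out). Qed.

Lemma smean_le g (M : R) : (forall y, K y -> `|g y| <= M) ->
  `|smean g| <= M * smean (fun=> 1).
Proof. exact: (wmean_le weight_ge0 weight_le weight_out). Qed.

Lemma smean_is_derive (G G' : R -> V -> R) (t0 : R) :
  (\forall t \near t0, forall y, K y -> is_derive (t : R) 1 (G ^~ y) (G' t y)) ->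
  (\forall t \near t0, forall y, K y -> {for y, continuous (G t)}) ->
  (forall y, K y -> {for (t0, y), continuous (fun p : R * V => G' p.1 p.2)}) ->
  is_derive t0 1 (fun t => smean (G t)) (smean (G' t0)).
Proof.
exact: (wmean_is_derive weight_ge0 weight_le (@compact_shell R n a b) weight_out).
Qed.

Lemma continuous_bounded_on_shell g : (forall y, K y -> {for y, continuous g}) ->
  exists2 M : R, 0 <= M & forall y, K y -> `|g y| <= M.
Proof. exact: (continuous_bounded_on (@compact_shell R n a b)). Qed.

Section Green.
Variables (r : R) (br : b < r) (v : V -> R) (v1 : 'I_n -> V -> R).
Variables (v2 : 'I_n -> 'I_n -> V -> R) (f : V -> R) (f1 f2 : 'I_n -> V -> R).
Hypotheses (hv : harmonic_data r v v1 v2) (hf : homogeneous_data f f1 f2).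

(** The first summand is Green's field times |y|^2. Its radial component is -|y|^2 f E v, with E the
    Euler operator and E f = 0, and the second summand cancels exactly this. The field is therefore
    tangent to the spheres, and the derivative of the radial weight drops out of the divergence. *)
Let field i y : R :=
  sqnorm y * (v y * f1 i y - f y * v1 i y) + y ord0 i * (f y * euler v1 y).

Let dfield i y : R :=
  2 * y ord0 i * (v y * f1 i y - f y * v1 i y)
  + sqnorm y * (v y * f2 i y - f y * v2 i i y)
  + f y * euler v1 y
  + y ord0 i * (f1 i y * euler v1 y
     + f y * (v1 i y + \sum_j y ord0 j * v2 i j y)).

Let Kr y : K y -> sqnorm y < r.
Proof. by case/andP => _ h; exact: le_lt_trans br. Qed.

Let der_euler i y : sqnorm y < r ->
  is_derive y (e i) (euler v1) (v1 i y + \sum_j y ord0 j * v2 i j y).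
Proof.
move=> yr; apply: is_derive_eq.
  by apply: der_sum => j; apply: derM; [exact: der_coord | exact: (hd_der2 hv)].
by rewrite /= big_split /= sum_coord_delta.
Qed.

Let der_field i y : K y -> is_derive y (e i) (field i) (dfield i y).
Proof.
move=> Ky; have y0 := shell_neq0 Ky; have yr := Kr Ky.
have df := ho_der hf i y0; have df1 := ho_der2 hf i y0.
have dv := hd_der hv i yr; have dv1 := hd_der2 hv i i yr.
have d1 := derM (der_sqnorm i y) (derB (derM dv df1) (derM df dv1)).
have d2 := derM (der_coord i i y) (derM df (der_euler i yr)).
apply: is_derive_eq (derD d1 d2) _.
by rewrite /dfield eqxx /=; ring.
Qed.

Let cont_field i y : K y -> {for y, continuous (field i)} /\ {for y, continuous (dfield i)}.
Proof.
move=> Ky; have y0 := shell_neq0 Ky; have yr := Kr Ky.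
have cv := hd_cont hv yr.
have cv1 j := hd_cont1 hv j yr.
have cv2 i' j := hd_cont2 hv i' j yr.
have cf := ho_cont hf y0; have cf1 i' := ho_cont1 hf i' y0; have cf2 i' := ho_cont2 hf i' y0.
have cs := @cont_sqnorm R n y; have cy j := @cont_coord R n j y.
have cE : {for y, continuous (euler v1)} by exact: cont_euler.
split.
  apply: contD; first by apply: contM => //; apply: contB; exact: contM.
  by apply: contM => //; exact: contM.
apply: contD.
  apply: contD; last exact: contM.
  apply: contD; apply: contM => //; first exact: contZ.
    by apply: contB; exact: contM.
  by apply: contB; exact: contM.
apply: contM => //; apply: contD; first exact: contM.
apply: contM => //; apply: contD => //; apply: cont_sum => j.
exact: contM.
Qed.

(* Green's formula on the shell: the right-hand side minus the left-hand side is the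
   mean of the divergence of the compactly supported field weight * field. *)
Lemma green_shell :
  smean (fun y => f y * (euler2 v1 v2 y + (n%:R - 2) * euler v1 y)) =
  - smean (fun y => v y * slap f2 y).
Proof.
pose X i y := weight y * field i y.
pose dX i y := dweight y * (2 * y ord0 i) * field i y + weight y * dfield i y.
have X0 i y : ~ K y -> X i y = 0 by move=> nK; rewrite /X weight_out // mul0r.
have dX0 i y : ~ K y -> dX i y = 0.
  by move=> nK; rewrite /dX weight_out // dweight_out // !mul0r addr0.
have derX' i y : is_derive y (e i) (X i) (dX i y).
  apply: (der_support (@closed_shell R n a b) (X0 i) (dX0 i)) => z Kz.
  exact: (derM (der_weight i z) (der_field i Kz)).
have contdX i y : {for y, continuous (dX i)}.
  apply: (cont_support (@closed_shell R n a b) (dX0 i)) => z Kz.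
  have [c1 c2] := cont_field i Kz; apply: contD; last by apply: contM => //; exact: cont_weight.
  apply: contM => //; apply: contM; first exact: cont_dweight.
  by apply: contZ; exact: cont_coord.
have m0 i : mean (dX i) = 0.
  by apply: mean_derive_support (derX' i) (contdX i) _ _ => y y1;
    [apply: X0 | apply: dX0]; exact: shell_norm_ge1.
have bdX i : bounded_fun (dX i).
  have [M M0 hM] := continuous_bounded_on_shell (fun y _ => contdX i y).
  exists M => y; have [/hM //|/dX0 ->] := pselect (K y).
  by rewrite normr0.
have key y : K y -> \sum_i dX i y = weight y *
    (f y * (euler2 v1 v2 y + (n%:R - 2) * euler v1 y) + v y * slap f2 y).
  move=> Ky; have y0 := shell_neq0 Ky; have yr := Kr Ky.
  have E0 := ho_euler hf y0; have L0 := hd_lap hv yr.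
  rewrite /dX big_split /= -!mulr_sumr.
  have -> : \sum_i dweight y * (2 * y ord0 i) * field i y = 0.
    transitivity (\sum_i (2 * dweight y * sqnorm y * v y * (y ord0 i * f1 i y)
        + - (2 * dweight y * sqnorm y * f y) * (y ord0 i * v1 i y)
        + 2 * dweight y * f y * euler v1 y * y ord0 i ^+ 2)).
      by apply: eq_bigr => i _; rewrite /field; ring.
    by rewrite !big_split /= -!mulr_sumr E0 -/(euler v1 y) -/(sqnorm y); ring.
  rewrite add0r; congr (_ * _).
  transitivity (\sum_i ((2 * v y + euler v1 y) * (y ord0 i * f1 i y)
      + - f y * (y ord0 i * v1 i y) + sqnorm y * v y * f2 i y
      + - (sqnorm y * f y) * v2 i i y + f y * euler v1 y * 1
      + f y * (y ord0 i * \sum_j y ord0 j * v2 i j y))).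
    by apply: eq_bigr => i _; rewrite /dfield; ring.
  rewrite !big_split /= -!mulr_sumr E0 L0 sumr_const card_ord.
  by rewrite /euler2 /slap -/(euler v1 y); ring.
have cf y : K y -> {for y, continuous f} by move=> /shell_neq0 y0; exact: (ho_cont hf y0).
have cE y : K y -> {for y, continuous (euler v1)}.
  by move=> /Kr yr; apply: cont_euler => i; exact: (hd_cont1 hv i yr).
have cE2 y : K y -> {for y, continuous (euler2 v1 v2)}.
  move=> /Kr yr; apply: cont_euler2 => [i|i j]; first exact: (hd_cont1 hv i yr).
  exact: (hd_cont2 hv i j yr).
have cs y : K y -> {for y, continuous (slap f2)}.
  by move=> /shell_neq0 y0; apply: cont_slap => i; exact: (ho_cont2 hf i y0).
apply/eqP; rewrite -addr_eq0 -smeanD.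
- rewrite -[eqbRHS](_ : mean (fun y => \sum_i dX i y) = 0).
    apply/eqP; congr mean; apply: funext => y.
    have [/key -> //|nK] := pselect (K y).
    by rewrite weight_out // mul0r big1 // => i _; exact: dX0.
  by rewrite mean_sum // big1.
- move=> y Ky; apply: contM; first exact: cf.
  by apply: contD; [exact: cE2 | apply: contZ; exact: cE].
- move=> y Ky; apply: contM; last exact: cs.
  exact: (hd_cont hv (Kr Ky)).
Qed.

End Green.

End ShellMean.

Lemma cont_fst (T U X : topologicalType) (f : T -> X) (s : T) (y : U) :
  {for s, continuous f} -> {for (s, y), continuous (fun p : T * U => f p.1)}.
Proof.
move=> cf A /cf hA; exists (f @^-1` A, setT); last by move=> [? ?] [].
by split => //=; exact: filterT.
Qed.

Lemma cont_snd (T U X : topologicalType) (f : U -> X) (s : T) (y : U) :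
  {for y, continuous f} -> {for (s, y), continuous (fun p : T * U => f p.2)}.
Proof.
move=> cf A /cf hA; exists (setT, f @^-1` A); last by move=> [? ?] [].
by split => //=; exact: filterT.
Qed.

(** * The flow of a harmonic function along rays *)

Section Rays.
Context {R : realType} {n : nat}.
Local Notation V := 'rV[R]_n.
Local Notation e i := (delta_mx ord0 i : V).
Implicit Types (x y z : V).

Lemma open_sqnorm_lt (r : R) : open [set y : V | sqnorm y < r].
Proof.
have -> : [set y : V | sqnorm y < r] = sqnorm @^-1` [set x | x < r] by [].
by apply: open_comp => [y _|]; [exact: cont_sqnorm | exact: open_lt].
Qed.

Lemma cont_scale_pair (g : R -> R) (f : V -> R) (s : R) y :
  {for s, continuous g} -> {for g s *: y, continuous f} ->
  {for (s, y), continuous (fun p : R * V => f (g p.1 *: p.2))}.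
Proof.
move=> cg cf.
have ce : {for (s, y), continuous (fun p : R * V => g p.1)}.
  exact: (@cont_fst R V R g s y cg).
have ci : {for (s, y), continuous (fun p : R * V => p.2)}.
  exact: (@cont_snd R V V id s y (@cvg_id _ (nbhs y))).
have ch : {for (s, y), continuous (fun p : R * V => g p.1 *: p.2)}.
  exact: (cvgZ ce ci).
exact: (@continuous_comp _ _ _ (fun p : R * V => g p.1 *: p.2) f (s, y) ch cf).
Qed.

Lemma cont_scale (f : V -> R) (l : R) y : {for l *: y, continuous f} ->
  {for y, continuous (fun y => f (l *: y))}.
Proof.
move=> cf.
exact: (@continuous_comp _ _ _ (fun y : V => l *: y) f y (@scaler_continuous _ _ l y) cf).
Qed.

(** The Euler operator generates the dilations: in the logarithmic parameter [s] the derivative is E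
    f at the moved point, with no extra factor. This is the reason for the exponential
    parametrisation. *)
Lemma der_ray (r : R) (f : V -> R) (f1 : 'I_n -> V -> R) (s : R) y :
  (forall z i, sqnorm z < r -> is_derive z (e i) f (f1 i z)) ->
  (forall z i, sqnorm z < r -> {for z, continuous (f1 i)}) ->
  sqnorm (expR s *: y) < r ->
  is_derive s 1 (fun s => f (expR s *: y)) (euler f1 (expR s *: y)).
Proof.
move=> df cf sr.
have d : is_derive (expR s *: y) y f (\sum_i y ord0 i * f1 i (expR s *: y)).
  exact: (C1_is_derive y (@open_sqnorm_lt r) sr (fun i z => df z i) (fun i => cf _ i sr)).
have d1 : is_derive (expR s) 1 (fun l : R => f (l *: y)) (\sum_i y ord0 i * f1 i (expR s *: y)).
  apply/is_derive_shift0; move/is_derive_line : d.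
  by under eq_fun do rewrite -scalerDl.
have := @is_derive_comp1 R R^o (fun l : R => f (l *: y)) expR s 1 _ _ (is_derive_expR s) d1.
congr is_derive; rewrite /euler mulr_suml; apply: eq_bigr => i _.
by rewrite mxE; ring.
Qed.

End Rays.

Section HarmonicFlow.
Context {R : realType} {n : nat}.
Local Notation V := 'rV[R]_n.
Local Notation e i := (delta_mx ord0 i : V).
Implicit Types (x y z : V).
Variables (u : V -> R) (u1 : 'I_n -> V -> R) (u2 : 'I_n -> 'I_n -> V -> R).
Hypothesis hu : harmonic_data 1 u u1 u2.

(** Dilating the function rather than the shell keeps the weight fixed, so that one Green's formula
    serves for all times [s]. *)
Lemma harmonic_scale (l r : R) : l ^+ 2 * r <= 1 ->
  harmonic_data r (fun y => u (l *: y)) (fun i y => l * u1 i (l *: y))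
    (fun i j y => l ^+ 2 * u2 i j (l *: y)).
Proof.
move=> lr.
have h y : sqnorm y < r -> sqnorm (l *: y) < 1.
  move=> yr; rewrite sqnormZ; have [->|l0] := eqVneq l 0.
    by rewrite expr0n mul0r.
  by apply: lt_le_trans lr; rewrite ltr_pM2l // exprn_even_gt0.
split=> [y i /h yr|y i j /h yr|y /h yr|y i /h yr|y i j /h yr|y /h yr].
- by apply: is_derive_comp_scale; exact: (hd_der hu i yr).
- rewrite expr2 -mulrA; apply: derZ; apply: is_derive_comp_scale.
  exact: (hd_der2 hu i j yr).
- exact: (cont_scale (hd_cont hu yr)).
- by apply: contZ; exact: (cont_scale (hd_cont1 hu i yr)).
- by apply: contZ; exact: (cont_scale (hd_cont2 hu i j yr)).
- by rewrite -mulr_sumr (hd_lap hu yr) mulr0.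
Qed.

Lemma euler_scale (l : R) y :
  euler (fun i y => l * u1 i (l *: y)) y = euler u1 (l *: y).
Proof. by apply: eq_bigr => i _; rewrite mxE; ring. Qed.

Lemma euler2_scale (l : R) y :
  euler2 (fun i y => l * u1 i (l *: y)) (fun i j y => l ^+ 2 * u2 i j (l *: y)) y =
  euler2 u1 u2 (l *: y).
Proof.
rewrite /euler2 euler_scale; congr (_ + _); apply: eq_bigr => i _.
by rewrite !mulr_sumr; apply: eq_bigr => j _; rewrite !mxE; ring.
Qed.

Lemma der_ray_harmonic (s : R) y : sqnorm (expR s *: y) < 1 ->
  is_derive s 1 (fun s => u (expR s *: y)) (euler u1 (expR s *: y)).
Proof.
move=> h; apply: (der_ray (r := 1)) h => z i zr; first exact: (hd_der hu i zr).
exact: (hd_cont1 hu i zr).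
Qed.

Lemma cont_euler_harmonic y : sqnorm y < 1 -> {for y, continuous (euler u1)}.
Proof. by move=> yr; apply: cont_euler => i; exact: (hd_cont1 hu i yr). Qed.

Lemma cont_euler2_harmonic y : sqnorm y < 1 -> {for y, continuous (euler2 u1 u2)}.
Proof.
move=> yr; apply: cont_euler2 => [i|i j]; first exact: (hd_cont1 hu i yr).
exact: (hd_cont2 hu i j yr).
Qed.

Lemma der_ray_euler (s : R) y : sqnorm (expR s *: y) < 1 ->
  is_derive s 1 (fun s => euler u1 (expR s *: y)) (euler2 u1 u2 (expR s *: y)).
Proof.
move=> h.
have -> : euler2 u1 u2 (expR s *: y) =
   euler (fun i y => u1 i y + \sum_j y ord0 j * u2 i j y) (expR s *: y).
  by rewrite /euler2 /euler -big_split /=; apply: eq_bigr => i _; rewrite mulrDr.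
apply: (der_ray (r := 1)) h => z i zr.
  apply: is_derive_eq.
    by apply: der_sum => j; apply: derM; [exact: der_coord | exact: (hd_der2 hu i j zr)].
  by rewrite /= big_split /= sum_coord_delta.
apply: contD; first exact: (hd_cont1 hu i zr).
by apply: cont_sum => j; apply: contM; [exact: cont_coord | exact: (hd_cont2 hu i j zr)].
Qed.

Variables (a b : R).
Hypotheses (a0 : 0 < a) (ab : a < b) (b1 : b < 1).
Local Notation K := (@shell R n a b).
Local Notation smean := (@smean R n a b).

(** The dilation by e^s carries the shell into the unit ball. All s <= 0 qualify and the condition
    is open, so derivatives at s = 0 are two-sided. *)
Definition in_time (s : R) : Prop := expR s ^+ 2 * b < 1.

Lemma in_time_le0 s : s <= 0 -> in_time s.
Proof.
move=> s0; have : expR s <= 1 by rewrite -expR0 ler_expR.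
move=> h; apply: le_lt_trans b1; rewrite ler_piMl ?(ltW (lt_trans a0 ab)) //.
by rewrite expr2 mulr_ile1 // expR_ge0.
Qed.

Lemma in_time_near s : in_time s -> \forall t \near s, in_time t.
Proof.
move=> hs.
have c : {for s, continuous (fun t : R => expR t ^+ 2 * b)}.
  by apply: contM; [apply: contX; exact: continuous_expR | exact: cont_cst].
exact: (c [set x | x < 1] (open_nbhs_nbhs (conj (@open_lt R 1) hs))).
Qed.

Lemma in_time_lt1 s y : in_time s -> K y -> sqnorm (expR s *: y) < 1.
Proof.
move=> hs /andP[_ yb]; rewrite sqnormZ; apply: le_lt_trans hs.
by rewrite ler_wpM2l // sqr_ge0.
Qed.

Section Homogeneous.
Variables (f : V -> R) (f1 f2 : 'I_n -> V -> R).
Hypothesis hf : homogeneous_data f f1 f2.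

Let cf y : K y -> {for y, continuous f}.
Proof. by move=> /(shell_neq0 a0) y0; exact: (ho_cont hf y0). Qed.

Let cf_pair s y : K y -> {for (s, y), continuous (fun p : R * V => f p.2)}.
Proof.
by move=> Ky; exact: (@cont_snd R V R f s y (cf Ky)).
Qed.

Lemma smean_flow_der s : in_time s ->
  is_derive s 1 (fun s => smean (fun y => u (expR s *: y) * f y))
    (smean (fun y => euler u1 (expR s *: y) * f y)).
Proof.
move=> hs; apply: (@smean_is_derive R n a b ab (fun s y => u (expR s *: y) * f y)
  (fun s y => euler u1 (expR s *: y) * f y) s) => [||y Ky].
- apply: filterS (in_time_near hs) => t ht y Ky.
  have := derM (der_ray_harmonic (in_time_lt1 ht Ky)) (derC (f y) t 1).
  by rewrite mulr0 addr0.
- apply: filterS (in_time_near hs) => t ht y Ky; apply: contM; last exact: cf.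
  exact: (cont_scale (hd_cont hu (in_time_lt1 ht Ky))).
- apply: contM; last exact: cf_pair.
  exact: (cont_scale_pair (@continuous_expR R s) (cont_euler_harmonic (in_time_lt1 hs Ky))).
Qed.

Lemma smean_flow_der2 s : in_time s ->
  is_derive s 1 (fun s => smean (fun y => euler u1 (expR s *: y) * f y))
    (smean (fun y => euler2 u1 u2 (expR s *: y) * f y)).
Proof.
move=> hs; apply: (@smean_is_derive R n a b ab (fun s y => euler u1 (expR s *: y) * f y)
  (fun s y => euler2 u1 u2 (expR s *: y) * f y) s) => [||y Ky].
- apply: filterS (in_time_near hs) => t ht y Ky.
  have := derM (der_ray_euler (in_time_lt1 ht Ky)) (derC (f y) t 1).
  by rewrite mulr0 addr0.
- apply: filterS (in_time_near hs) => t ht y Ky; apply: contM; last exact: cf.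
  exact: (cont_scale (cont_euler_harmonic (in_time_lt1 ht Ky))).
- apply: contM; last exact: cf_pair.
  exact: (cont_scale_pair (@continuous_expR R s) (cont_euler2_harmonic (in_time_lt1 hs Ky))).
Qed.

(** Green's formula for the dilate u(e^s y), harmonic for |y|^2 < e^(-2s); Euler operators commute
    with dilations. *)
Lemma smean_flow_green s : in_time s ->
  smean (fun y => euler2 u1 u2 (expR s *: y) * f y)
  + (n%:R - 2) * smean (fun y => euler u1 (expR s *: y) * f y) =
  - smean (fun y => u (expR s *: y) * slap f2 y).
Proof.
move=> hs; set l := expR s.
have l0 : 0 < l ^+ 2 by rewrite exprn_gt0 // expR_gt0.
have br : b < l ^- 2 by rewrite -[l ^- 2]mul1r ltr_pdivlMr // mulrC.
have l1 : l ^+ 2 * l ^- 2 <= 1 by rewrite mulfV // gt_eqF.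
rewrite -(green_shell a0 ab b1 br (harmonic_scale l1) hf).
rewrite -smeanZ //; last first.
  move=> y Ky; apply: contM; last exact: cf.
  exact: (cont_scale (cont_euler_harmonic (in_time_lt1 hs Ky))).
rewrite -smeanD //.
- congr (smean _); apply: funext => y; rewrite euler_scale euler2_scale.
  by ring.
- move=> y Ky; apply: contM; last exact: cf.
  exact: (cont_scale (cont_euler2_harmonic (in_time_lt1 hs Ky))).
- move=> y Ky; apply: contZ; apply: contM; last exact: cf.
  exact: (cont_scale (cont_euler_harmonic (in_time_lt1 hs Ky))).
Qed.

End Homogeneous.

(** If m'' + (n - 2) m' = h then (e^(c s) m)'' = e^(c s) (c^2 m + h) for this value of c: the
    first-order term disappears. *)
Definition half_codim : R := (n%:R - 2) / 2.
Local Notation c := half_codim.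

Definition flow (f : V -> R) (s : R) : R :=
  expR (c * s) * smean (fun y => u (expR s *: y) * f y).

Definition dflow (f : V -> R) (s : R) : R :=
  expR (c * s) * (c * smean (fun y => u (expR s *: y) * f y)
    + smean (fun y => euler u1 (expR s *: y) * f y)).

Lemma der_expRM (k s : R) : is_derive s 1 (fun s : R => expR (k * s)) (expR (k * s) * k).
Proof.
apply: (@is_derive_comp1 R R^o expR (fun s : R => k * s)).
by rewrite -[X in is_derive _ _ _ X]mulr1; apply: derZ; exact: is_derive_id.
Qed.

Lemma flow_der f f1 f2 s : homogeneous_data f f1 f2 -> in_time s ->
  is_derive s 1 (flow f) (dflow f s).
Proof.
move=> hf hs; apply: is_derive_eq (derM (der_expRM c s) (smean_flow_der hf hs)) _.
by rewrite /dflow; ring.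
Qed.

(* The flow turns the Laplace-Beltrami operator acting on f into d^2/ds^2. *)
Lemma dflow_der f f1 f2 s : homogeneous_data f f1 f2 -> in_time s ->
  is_derive s 1 (dflow f) (flow (fun y => c ^+ 2 * f y - slap f2 y) s).
Proof.
move=> hf hs.
have d := derM (der_expRM c s)
  (derD (derZ c (smean_flow_der hf hs)) (smean_flow_der2 hf hs)).
apply: is_derive_eq d _.
have G := smean_flow_green hf hs.
have cu y : K y -> {for y, continuous (fun y => u (expR s *: y))}.
  by move=> Ky; exact: (cont_scale (hd_cont hu (in_time_lt1 hs Ky))).
have cf y : K y -> {for y, continuous f}.
  by move=> /(shell_neq0 a0) y0; exact: (ho_cont hf y0).
have -> : flow (fun y => c ^+ 2 * f y - slap f2 y) s = expR (c * s) *
    (c ^+ 2 * smean (fun y => u (expR s *: y) * f y) - smean (fun y => u (expR s *: y) * slap f2 y)).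
  rewrite /flow; congr (_ * _); rewrite -smeanZ // -?smeanB //.
  - by congr (smean _); apply: funext => y; ring.
  - by move=> y Ky; apply: contZ; apply: contM; [exact: cu | exact: cf].
  - move=> y Ky; apply: contM; first exact: cu.
    by apply: cont_slap => i; have /(shell_neq0 a0) y0 := Ky; exact: (ho_cont2 hf i y0).
  - by move=> y Ky; apply: contM; [exact: cu | exact: cf].
rewrite -G.
have -> : (n%:R - 2 : R) = 2 * c by rewrite /half_codim mulrCA mulfV ?mulr1 // pnatr_eq0.
by ring.
Qed.

End HarmonicFlow.

(** * The Poisson kernel *)

Section KernelOfAngle.
Context {R : realType}.
Variables (A k : R).
Implicit Types (l z t : R).

(* With z = <x, y> / |y| and A = |x|^2, [kpoisson l z] is |S| times the Poisson kernel
   at l x and y / |y|, when k = n / 2. *)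
Definition kq l z : R := 1 + A * l ^+ 2 - 2 * l * z.
Definition kr l z : R := kq l z `^ (- k).
Definition kpoisson l z : R := (1 - A * l ^+ 2) * kr l z.
Definition kpoisson_z l z : R := 2 * l * k * kpoisson l z / kq l z.
Definition kpoisson_zz l z : R := 4 * l ^+ 2 * k * (k + 1) * kpoisson l z / kq l z ^+ 2.
(** The suffixes [_t] and [_tt] stand for derivatives in t with l = e^t, so that dl/dt = l; the
    factor 2 A l^2 - 2 l z is the t-derivative of [kq]. *)
Definition kpoisson_t l z : R :=
  (- 2 * A * l ^+ 2 - k * (1 - A * l ^+ 2) * (2 * A * l ^+ 2 - 2 * l * z) / kq l z) * kr l z.
Definition kpoisson_tt l z : R :=
  (- 4 * A * l ^+ 2 + 4 * k * A * l ^+ 2 * (2 * A * l ^+ 2 - 2 * l * z) / kq l z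
  - k * (1 - A * l ^+ 2) * (4 * A * l ^+ 2 - 2 * l * z) / kq l z
  + k * (k + 1) * (1 - A * l ^+ 2) * (2 * A * l ^+ 2 - 2 * l * z) ^+ 2 / kq l z ^+ 2) * kr l z.

(** q = (1 - l z)^2 + l^2 (A - z^2), and l z < 1 because (l z)^2 <= A l^2 < 1. *)
Lemma kq_gt0 l z : A * l ^+ 2 < 1 -> z ^+ 2 <= A -> 0 < kq l z.
Proof.
move=> Al zA.
have lz : (l * z) ^+ 2 <= A * l ^+ 2 by rewrite exprMn mulrC ler_wpM2r // sqr_ge0.
have h : l * z < 1.
  rewrite ltNge; apply/negP => h; have := lt_le_trans Al (le_refl _).
  by apply/negP; rewrite -leNgt (le_trans _ lz) // expr_ge1 // (le_trans ler01).
have : 0 < (1 - l * z) ^+ 2 by rewrite exprn_gt0 // subr_gt0.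
by move: lz; rewrite /kq; set u := l * z => lz u0; nra.
Qed.

Lemma der_powR (f : R -> R) t (df : R) : 0 < f t -> is_derive t 1 f df ->
  is_derive t 1 (fun s => f s `^ (- k)) (- k * df / f t * f t `^ (- k)).
Proof.
move=> f0 hf.
have := @is_derive_comp1 R R^o (fun x => x `^ (- k)) f t 1 _ _ hf (is_derive1_powR (- k) f0).
congr is_derive; rewrite powRB; last by rewrite (gt_eqF f0) implybT.
by rewrite powRr1 ?ltW //; field; rewrite gt_eqF.
Qed.

Lemma der_kpoisson l z : 0 < kq l z ->
  is_derive z 1 (kpoisson l) (kpoisson_z l z).
Proof.
move=> q0.
have dq : is_derive z 1 (kq l) (- 2 * l).
  by apply: is_derive_eq; rewrite /GRing.scale /=; ring.
apply: is_derive_eq (derZ (1 - A * l ^+ 2) (der_powR q0 dq)) _.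
by rewrite /kpoisson_z /kpoisson /kr; field; rewrite gt_eqF.
Qed.

Lemma der_kpoisson_z l z : 0 < kq l z ->
  is_derive z 1 (kpoisson_z l) (kpoisson_zz l z).
Proof.
move=> q0.
have dq : is_derive z 1 (kq l) (- 2 * l).
  by apply: is_derive_eq; rewrite /GRing.scale /=; ring.
have q0' : kq l z != 0 by rewrite gt_eqF.
apply: is_derive_eq (derM (derZ (2 * l * k) (der_kpoisson q0)) (derV q0' dq)) _.
by rewrite /kpoisson_zz /kpoisson_z /kpoisson; field.
Qed.

Let der_l t : is_derive t 1 (fun t : R => expR t ^+ 2) (2 * expR t ^+ 2).
Proof.
apply: is_derive_eq (derX 1 (is_derive_expR t)) _.
by rewrite expr1 -mulrA -expr2.
Qed.

Let der_kq t z : is_derive t 1 (fun t : R => kq (expR t) z)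
  (2 * A * expR t ^+ 2 - 2 * expR t * z).
Proof.
have d := derB (derD (derC 1 t 1) (derZ A (der_l t))) (derM (derZ 2 (is_derive_expR t)) (derC z t 1)).
by apply: is_derive_eq d _; ring.
Qed.

Lemma der_kpoisson_t t z : 0 < kq (expR t) z ->
  is_derive t 1 (fun t => kpoisson (expR t) z) (kpoisson_t (expR t) z).
Proof.
move=> q0.
have d := derM (derB (derC 1 t 1) (derZ A (der_l t))) (@der_powR (fun t => kq (expR t) z) t _ q0 (der_kq t z)).
apply: is_derive_eq d _.
by rewrite /kpoisson_t /kpoisson /kr; field; rewrite gt_eqF.
Qed.

Lemma der_kpoisson_tt t z : 0 < kq (expR t) z ->
  is_derive t 1 (fun t => kpoisson_t (expR t) z) (kpoisson_tt (expR t) z).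
Proof.
move=> q0; have q0' : kq (expR t) z != 0 by rewrite gt_eqF.
have dp := derB (derC 1 t 1) (derZ A (der_l t)).
have dqt := derB (derZ (2 * A) (der_l t)) (derM (derZ 2 (is_derive_expR t)) (derC z t 1)).
have d := derM (derB (derZ (- 2 * A) (der_l t))
   (derM (derM (derZ k dp) dqt) (@derV R R^o (fun t => kq (expR t) z) t 1 _ q0' (der_kq t z)))) (@der_powR (fun t => kq (expR t) z) t _ q0 (der_kq t z)).
apply: is_derive_eq d _.
by rewrite /kpoisson_tt /kr; field.
Qed.

(* This is the harmonicity of the Poisson kernel in x, in polar coordinates. *)
Lemma kpoisson_wave l z : 0 < kq l z ->
  kpoisson_tt l z + (2 * k - 2) * kpoisson_t l z =
  - (kpoisson_zz l z * (A - z ^+ 2) - (2 * k - 1) * z * kpoisson_z l z).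
Proof.
move=> q0; have q0' : kq l z != 0 by rewrite gt_eqF.
apply/eqP; rewrite -subr_eq0; apply/eqP.
rewrite /kpoisson_tt /kpoisson_t /kpoisson_zz /kpoisson_z /kpoisson.
rewrite -[LHS]mulr1 -(mulfV (expf_neq0 2 q0')) mulrA.
apply/eqP; rewrite mulf_eq0; apply/orP; left.
rewrite [X in X == _](_ : _ = 0) //; move: q0'; rewrite /kq => q0'; field.
by [].
Qed.

Lemma kpoisson_ge0 l z : A * l ^+ 2 <= 1 -> 0 <= kpoisson l z.
Proof. by move=> h; rewrite mulr_ge0 ?powR_ge0 // subr_ge0. Qed.

Section Continuity.
Variables (T : topologicalType) (fl fz : T -> R) (p : T).
Hypotheses (cl : {for p, continuous fl}) (cz : {for p, continuous fz}).
Hypothesis q0 : 0 < kq (fl p) (fz p).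

Let cA : {for p, continuous (fun s => A * fl s ^+ 2)}.
Proof. by apply: contZ; exact: contX. Qed.

Let ct : {for p, continuous (fun s => 2 * A * fl s ^+ 2 - 2 * fl s * fz s)}.
Proof.
apply: contB; first by apply: contZ; exact: contX.
by apply: contM => //; exact: contZ.
Qed.

Let cq : {for p, continuous (fun s => kq (fl s) (fz s))}.
Proof.
apply: contB; first by apply: contD => //; exact: cont_cst.
by apply: contM => //; exact: contZ.
Qed.

Let cqV m : {for p, continuous (fun s => (kq (fl s) (fz s) ^+ m)^-1)}.
Proof.
by apply: contV; [rewrite expf_neq0 // gt_eqF | exact: contX].
Qed.

Let cqV1 : {for p, continuous (fun s => (kq (fl s) (fz s))^-1)}.
Proof. by apply: contV; rewrite // gt_eqF. Qed.

Let cr : {for p, continuous (fun s => kr (fl s) (fz s))}.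
Proof.
apply: (@cont_comp _ _ _ (fun s => kq (fl s) (fz s)) (fun x => x `^ (- k))) => //.
apply: differentiable_continuous; apply/derivable1_diffP.
by case: (is_derive1_powR (- k) q0).
Qed.

Lemma cont_kpoisson : {for p, continuous (fun s => kpoisson (fl s) (fz s))}.
Proof. by apply: contM => //; apply: contB => //; exact: cont_cst. Qed.

Lemma cont_kpoisson_z : {for p, continuous (fun s => kpoisson_z (fl s) (fz s))}.
Proof.
apply: contM => //; apply: contM; last exact: cont_kpoisson.
by apply: contM; [exact: contZ | exact: cont_cst].
Qed.

Lemma cont_kpoisson_zz : {for p, continuous (fun s => kpoisson_zz (fl s) (fz s))}.
Proof.
apply: contM; last exact: cqV; apply: contM; last exact: cont_kpoisson.
apply: contM; last exact: cont_cst; apply: contM; last exact: cont_cst.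
by apply: contZ; exact: contX.
Qed.

Lemma cont_kpoisson_t : {for p, continuous (fun s => kpoisson_t (fl s) (fz s))}.
Proof.
apply: contM => //; apply: contB; first by apply: contZ; exact: contX.
apply: contM => //; apply: contM => //; apply: contZ.
by apply: contB => //; exact: cont_cst.
Qed.

Lemma cont_kpoisson_tt : {for p, continuous (fun s => kpoisson_tt (fl s) (fz s))}.
Proof.
have c1 : {for p, continuous (fun s => 1 - A * fl s ^+ 2)}.
  by apply: contB => //; exact: cont_cst.
have c2 (b : R) : {for p, continuous (fun s => b * fl s ^+ 2)}.
  by apply: contZ; exact: contX.
apply: contM => //; apply: contD.
  apply: contB; first apply: contD => //.
    by apply: contM => //; apply: contM.
  apply: contM => //; apply: contM; first exact: contZ.
  by apply: contB => //; apply: contM => //; exact: contZ.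
apply: contM; last exact: cqV.
by apply: contM; [exact: contZ | exact: contX].
Qed.

End Continuity.

End KernelOfAngle.

(** * The kernel as a function of the direction y / |y| *)

Section AngleFunction.
Context {R : realType} {n : nat}.
Local Notation V := 'rV[R]_n.
Local Notation e i := (delta_mx ord0 i : V).
Implicit Types (x y : V).

Definition dotp x y : R := \sum_i x ord0 i * y ord0 i.

(** This is |x| times the cosine of the angle between x and y, the variable z of the kernel. *)
Definition angle x y : R := dotp x y / enorm y.

Definition angle1 x (i : 'I_n) y : R :=
  x ord0 i / enorm y - dotp x y * y ord0 i / enorm y ^+ 3.

Definition angle2 x (i : 'I_n) y : R :=
  - 2 * x ord0 i * y ord0 i / enorm y ^+ 3 - dotp x y / enorm y ^+ 3
  + 3 * dotp x y * y ord0 i ^+ 2 / enorm y ^+ 5.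

Lemma der_dotp x i y : is_derive y (e i) (dotp x) (x ord0 i).
Proof.
apply: is_derive_eq; first by apply: der_sum => j; apply: derZ; exact: der_coord.
by under eq_bigr do rewrite mulrC; rewrite sum_coord_delta.
Qed.

Lemma cont_dotp x y : {for y, continuous (dotp x)}.
Proof. by apply: cont_sum => j; apply: contZ; exact: cont_coord. Qed.

Lemma der_enorm i y : y != 0 -> is_derive y (e i) (@enorm R n) (y ord0 i / enorm y).
Proof.
move=> y0; have s0 : 0 < sqnorm y by rewrite sqnorm_gt0.
apply: is_derive_eq (is_derive_comp1 (der_sqnorm i y) (is_derive1_sqrt s0)) _.
by rewrite -enormE; field; rewrite gt_eqF // enorm_gt0.
Qed.

Lemma cont_enorm y : {for y, continuous (@enorm R n)}.
Proof.
apply: (@cont_comp R _ _ (@sqnorm R n) Num.sqrt); first exact: cont_sqnorm.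
exact: sqrt_continuous.
Qed.

Lemma cont_enormX y m : y != 0 -> {for y, continuous (fun y => (enorm y ^+ m)^-1)}.
Proof.
move=> y0; apply: contV; first by rewrite expf_neq0 // gt_eqF // enorm_gt0.
by apply: contX; exact: cont_enorm.
Qed.

Lemma cont_enormV y : y != 0 -> {for y, continuous (fun y : V => (enorm y)^-1)}.
Proof. by move=> y0; apply: contV; [rewrite gt_eqF // enorm_gt0 | exact: cont_enorm]. Qed.

Lemma der_angle x i y : y != 0 -> is_derive y (e i) (angle x) (angle1 x i y).
Proof.
move=> y0; have r0 : enorm y != 0 by rewrite gt_eqF // enorm_gt0.
apply: is_derive_eq (derM (der_dotp x i y) (derV r0 (der_enorm i y0))) _.
by rewrite /angle1; field.
Qed.

Lemma der_angle1 x i y : y != 0 -> is_derive y (e i) (angle1 x i) (angle2 x i y).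
Proof.
move=> y0; have r0 : enorm y != 0 by rewrite gt_eqF // enorm_gt0.
have d1 := derZ (x ord0 i) (derV r0 (der_enorm i y0)).
have r3 : enorm y ^+ 3 != 0 by rewrite expf_neq0.
have d2 := derM (derM (der_dotp x i y) (der_coord i i y))
  (@derV R V (fun y => enorm y ^+ 3) y _ _ r3 (derX 2 (der_enorm i y0))).
apply: is_derive_eq (derB d1 d2) _.
by rewrite /angle2 eqxx /=; field.
Qed.

Lemma cont_angle x y : y != 0 -> {for y, continuous (angle x)}.
Proof. by move=> y0; apply: contM; [exact: cont_dotp | exact: cont_enormV]. Qed.

Lemma cont_angle1 x i y : y != 0 -> {for y, continuous (angle1 x i)}.
Proof.
move=> y0; apply: contB; first by apply: contZ; exact: cont_enormV.
apply: contM; last exact: cont_enormX.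
by apply: contM; [exact: cont_dotp | exact: cont_coord].
Qed.

Lemma cont_angle2 x i y : y != 0 -> {for y, continuous (angle2 x i)}.
Proof.
move=> y0; apply: contD; first apply: contB.
- apply: contM; last exact: cont_enormX.
  by apply: contZ; exact: cont_coord.
- by apply: contM; [exact: cont_dotp | exact: cont_enormX].
- apply: contM; last exact: cont_enormX.
  apply: contM; first by apply: contZ; exact: cont_dotp.
  by apply: contX; exact: cont_coord.
Qed.

Lemma angle_euler x y : y != 0 -> \sum_i y ord0 i * angle1 x i y = 0.
Proof.
move=> y0; have r0 : enorm y != 0 by rewrite gt_eqF // enorm_gt0.
transitivity (\sum_i ((enorm y)^-1 * (x ord0 i * y ord0 i)
   + - (dotp x y / enorm y ^+ 3) * y ord0 i ^+ 2)).
  by apply: eq_bigr => i _; rewrite /angle1; field.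
rewrite big_split /= -!mulr_sumr -/(dotp x y) -/(sqnorm y) -enorm_sqr; field.
exact: r0.
Qed.

Lemma angle_grad x y : y != 0 ->
  \sum_i angle1 x i y ^+ 2 = (sqnorm x - angle x y ^+ 2) / sqnorm y.
Proof.
move=> y0; have r0 : enorm y != 0 by rewrite gt_eqF // enorm_gt0.
transitivity (\sum_i ((enorm y)^-2 * x ord0 i ^+ 2
   + - (2 * dotp x y / enorm y ^+ 4) * (x ord0 i * y ord0 i)
   + (dotp x y ^+ 2 / enorm y ^+ 6) * y ord0 i ^+ 2)).
  by apply: eq_bigr => i _; rewrite /angle1; field.
rewrite !big_split /= -!mulr_sumr -/(dotp x y) -/(sqnorm y) -/(sqnorm x) -!enorm_sqr.
by rewrite /angle; field.
Qed.

(** A linear form restricted to the sphere is a spherical harmonic of degree one, with eigenvalue n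
    - 1. *)
Lemma angle_lap x y : y != 0 ->
  \sum_i angle2 x i y = - (n%:R - 1) * angle x y / sqnorm y.
Proof.
move=> y0; have r0 : enorm y != 0 by rewrite gt_eqF // enorm_gt0.
transitivity (\sum_i (- 2 / enorm y ^+ 3 * (x ord0 i * y ord0 i)
   + - (dotp x y / enorm y ^+ 3) * 1
   + (3 * dotp x y / enorm y ^+ 5) * y ord0 i ^+ 2)).
  by apply: eq_bigr => i _; rewrite /angle2; field.
rewrite !big_split /= -!mulr_sumr -/(dotp x y) -/(sqnorm y) sumr_const card_ord -enorm_sqr.
by rewrite /angle; field.
Qed.

(** Cauchy-Schwarz, read off from the nonnegativity of the squared gradient just computed. *)
Lemma angle_sqr_le x y : y != 0 -> angle x y ^+ 2 <= sqnorm x.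
Proof.
move=> y0; have s0 : 0 < sqnorm y by rewrite sqnorm_gt0.
have : 0 <= \sum_i angle1 x i y ^+ 2 by apply: sumr_ge0 => i _; exact: sqr_ge0.
by rewrite angle_grad // pmulr_lge0 ?invr_gt0 // subr_ge0.
Qed.

Lemma sqnormB x y : sqnorm (x - y) = sqnorm x + sqnorm y - 2 * dotp x y.
Proof.
rewrite /sqnorm /dotp mulr_sumr -big_split /= -sumrB; apply: eq_bigr => i _.
by rewrite !mxE; ring.
Qed.

Local Notation k := (n%:R / 2 : R).
Local Notation pk x := (kpoisson (sqnorm x) k).

Definition spoisson x (l : R) y : R := pk x l (angle x y).

Lemma spoisson_homogeneous x l : sqnorm x * l ^+ 2 < 1 ->
  homogeneous_data (spoisson x l)
   (fun i y => kpoisson_z (sqnorm x) k l (angle x y) * angle1 x i y)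
   (fun i y => kpoisson_zz (sqnorm x) k l (angle x y) * angle1 x i y ^+ 2
     + kpoisson_z (sqnorm x) k l (angle x y) * angle2 x i y).
Proof.
move=> xl.
have q0 y : y != 0 -> 0 < kq (sqnorm x) l (angle x y).
  by move=> y0; apply: kq_gt0 => //; exact: angle_sqr_le.
have cl y : {for y, continuous (fun _ : V => l)} by exact: cont_cst.
have ca y : y != 0 -> {for y, continuous (angle x)} by exact: cont_angle.
split=> [y i y0|y i y0|y y0|y i y0|y i y0|y y0].
- exact: is_derive_comp1 (der_angle x i y0) (der_kpoisson k (q0 y y0)).
- have d := is_derive_comp1 (der_angle x i y0) (der_kpoisson_z k (q0 y y0)).
  by apply: is_derive_eq (derM d (der_angle1 x i y0)) _; ring.
- exact: (@cont_kpoisson R _ _ _ (fun=> l) (angle x) y (cl y) (ca y y0) (q0 y y0)).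
- apply: contM; last exact: cont_angle1.
  exact: (@cont_kpoisson_z R _ _ _ (fun=> l) (angle x) y (cl y) (ca y y0) (q0 y y0)).
- apply: contD; apply: contM.
  + exact: (@cont_kpoisson_zz R _ _ _ (fun=> l) (angle x) y (cl y) (ca y y0) (q0 y y0)).
  + by apply: contX; exact: cont_angle1.
  + exact: (@cont_kpoisson_z R _ _ _ (fun=> l) (angle x) y (cl y) (ca y y0) (q0 y y0)).
  + exact: cont_angle2.
- under eq_bigr do rewrite mulrCA.
  by rewrite -mulr_sumr angle_euler // mulr0.
Qed.

(** By the chain rule, on functions of z = [angle x y] the operator |y|^2 Lap acts as (A - z^2)
    d^2/dz^2 - (n - 1) z d/dz; [kpoisson_wave] at 2k = n then turns it into derivatives in t. *)
Lemma slap_spoisson x l y : y != 0 -> sqnorm x * l ^+ 2 < 1 ->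
  slap (fun i y => kpoisson_zz (sqnorm x) k l (angle x y) * angle1 x i y ^+ 2
     + kpoisson_z (sqnorm x) k l (angle x y) * angle2 x i y) y =
  - (kpoisson_tt (sqnorm x) k l (angle x y)
     + (n%:R - 2) * kpoisson_t (sqnorm x) k l (angle x y)).
Proof.
move=> y0 xl; have s0 : sqnorm y != 0 by rewrite gt_eqF // sqnorm_gt0.
have q0 : 0 < kq (sqnorm x) l (angle x y) by apply: kq_gt0 => //; exact: angle_sqr_le.
have nk : 2 * k = n%:R by field.
have := kpoisson_wave k q0; rewrite nk => ->.
rewrite opprK /slap big_split /= -!mulr_sumr angle_grad // angle_lap //.
by field.
Qed.

End AngleFunction.

Lemma MVT_is_derive (R : realType) (g g' : R -> R) (p q : R) : p <= q ->
  (forall s, p <= s <= q -> is_derive s 1 g (g' s)) ->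
  exists2 s, p <= s <= q & g q - g p = (q - p) * g' s.
Proof.
move=> pq dg.
have [s spq E] : exists2 s, s \in `[p, q]%R & g q - g p = g' s * (q - p).
  apply: MVT_segment => // [s|].
    by rewrite in_itv /= => /andP[ps sq]; apply: dg; rewrite !ltW.
  apply: continuous_in_subspaceT => s; rewrite inE /= in_itv /= => spq.
  by apply: differentiable_continuous; apply/derivable1_diffP; case: (dg s spq).
by exists s; [move: spq; rewrite in_itv | rewrite E mulrC].
Qed.

Lemma constant_of_derive0 (R : realType) (g : R -> R) (p q : R) : p <= q ->
  (forall s, p <= s <= q -> is_derive s 1 g 0) -> g p = g q.
Proof.
move=> pq dg; have [s _ /eqP] := MVT_is_derive (g' := fun=> 0) pq dg.
by rewrite mulr0 subr_eq0 => /eqP.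
Qed.

(** * The Poisson formula in the limit *)

Section PoissonFormula.
Context {R : realType} {n : nat}.
Local Notation V := 'rV[R]_n.
Local Notation e i := (delta_mx ord0 i : V).
Implicit Types (x y z : V).
Local Notation k := (n%:R / 2 : R).
Hypothesis n_ge2 : (2 <= n)%N.
Variables (a b : R).
Hypotheses (a0 : 0 < a) (ab : a < b) (b1 : b < 1).
Local Notation K := (@shell R n a b).
Local Notation smean := (@smean R n a b).

Definition spoisson_t x (l : R) y : R := kpoisson_t (sqnorm x) k l (angle x y).

Lemma cont_spoisson_pair x (g : R -> R) (s : R) y : y != 0 -> sqnorm x * g s ^+ 2 < 1 ->
  {for s, continuous g} ->
  {for (s, y), continuous (fun p : R * V => spoisson x (g p.1) p.2)} /\
  {for (s, y), continuous (fun p : R * V => spoisson_t x (g p.1) p.2)}.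
Proof.
move=> y0 xs cg.
have cl : {for (s, y), continuous (fun p : R * V => g p.1)}.
  exact: (@cont_fst R V R g s y cg).
have ca : {for (s, y), continuous (fun p : R * V => angle x p.2)}.
  exact: (@cont_snd R V R (angle x) s y (cont_angle y0)).
have q0 : 0 < kq (sqnorm x) (g s) (angle x y).
  by apply: kq_gt0 => //; exact: angle_sqr_le.
split.
- exact: (@cont_kpoisson R _ _ _ _ (fun p : R * V => angle x p.2) (s, y) cl ca q0).
- exact: (@cont_kpoisson_t R _ _ _ _ (fun p : R * V => angle x p.2) (s, y) cl ca q0).
Qed.

Definition in_kernel x (t : R) : Prop := sqnorm x * expR t ^+ 2 < 1.

Lemma in_kernel_near x t : in_kernel x t -> \forall s \near t, in_kernel x s.
Proof.
move=> ht.
have c : {for t, continuous (fun t : R => sqnorm x * expR t ^+ 2)}.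
  by apply: contZ; apply: contX; exact: continuous_expR.
exact: (c [set x | x < 1] (open_nbhs_nbhs (conj (@open_lt R 1) ht))).
Qed.

Lemma in_kernel_le x s t : s <= t -> in_kernel x t -> in_kernel x s.
Proof.
move=> st; apply: le_lt_trans; rewrite ler_wpM2l ?sqnorm_ge0 //.
by apply: lerXn2r; rewrite ?nnegrE ?expR_ge0 // ler_expR.
Qed.

Lemma kq_spoisson_gt0 x t y : in_kernel x t -> K y ->
  0 < kq (sqnorm x) (expR t) (angle x y).
Proof. by move=> ht /(shell_neq0 a0) y0; apply: kq_gt0 => //; exact: angle_sqr_le. Qed.

Section Flow.
Variables (u : V -> R) (u1 : 'I_n -> V -> R) (u2 : 'I_n -> 'I_n -> V -> R).
Hypothesis hu : harmonic_data 1 u u1 u2.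
Variables (x : V) (s t : R).
Hypotheses (hs : in_time b s) (ht : in_kernel x t).

(** The Wronskian, in the logarithm of the dilation, of u along rays and of the kernel. The
    parameter [d] advances both times together. *)
Let F (d : R) y := euler u1 (expR (d + s) *: y) * spoisson x (expR (d + t)) y
  - u (expR (d + s) *: y) * spoisson_t x (expR (d + t)) y.

Let F' (d : R) y := euler2 u1 u2 (expR (d + s) *: y) * spoisson x (expR (d + t)) y
  - u (expR (d + s) *: y) * kpoisson_tt (sqnorm x) k (expR (d + t)) (angle x y).

Let inb (d : R) : d <= 0 -> in_time b (d + s) /\ in_kernel x (d + t).
Proof.
move=> d0; split; last by apply: in_kernel_le ht; rewrite gerDr.
apply: le_lt_trans hs; rewrite ler_wpM2r ?(ltW (lt_trans a0 ab)) //.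
by apply: lerXn2r; rewrite ?nnegrE ?expR_ge0 // ler_expR gerDr.
Qed.

Let cont_exp_shift (c d : R) : {for d, continuous (fun d => expR (d + c))}.
Proof.
apply: (@cont_comp R _ _ (fun d : R => d + c) expR); last exact: continuous_expR.
by apply: contD; [exact: cvg_id | exact: cont_cst].
Qed.

Let der_F (d : R) : d <= 0 -> is_derive d 1 (fun d => smean (F d)) (smean (F' d)).
Proof.
move=> /inb[hs' ht'].
have near_in : \forall d' \near d, in_time b (d' + s) /\ in_kernel x (d' + t).
  have sh (c : R) : {for d, continuous (fun d : R => d + c)}.
    by apply: contD; [exact: cvg_id | exact: cont_cst].
  apply: filterI; first exact: (sh s _ (in_time_near hs')).
  exact: (sh t _ (in_kernel_near ht')).
apply: (@smean_is_derive R n a b ab F F' d) => [||y Ky].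
- apply: filterS near_in => d' [hs1 ht1] y Ky.
  have q0 := kq_spoisson_gt0 ht1 Ky; have v1 := in_time_lt1 hs1 Ky.
  have sh (g : R -> R) (c g' : R) : is_derive (d' + c) 1 g g' ->
      is_derive d' 1 (fun d => g (d + c)) g'.
    move=> /is_derive_shift0 h; apply/is_derive_shift0.
    by under eq_fun do rewrite -addrA.
  have d1 := sh _ s _ (der_ray_euler hu v1).
  have d2 := sh _ s _ (der_ray_harmonic hu v1).
  have d3 := sh _ t _ (der_kpoisson_t k q0).
  have d4 := sh _ t _ (der_kpoisson_tt k q0).
  apply: is_derive_eq (derB (derM d1 d3) (derM d2 d4)) _.
  by rewrite /F' /spoisson; ring.
- apply: filterS near_in => d' [hs1 ht1] y Ky.
  have v1 := in_time_lt1 hs1 Ky.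
  have q0 := kq_spoisson_gt0 ht1 Ky.
  have ca : {for y, continuous (angle x)} by apply: cont_angle; exact: (shell_neq0 a0 Ky).
  have cl : {for y, continuous (fun _ : V => expR (d' + t))} by exact: cont_cst.
  apply: contB; apply: contM.
  + exact: (cont_scale (cont_euler_harmonic hu v1)).
  + exact: (@cont_kpoisson R _ _ _ _ (angle x) y cl ca q0).
  + exact: (cont_scale (hd_cont hu v1)).
  + exact: (@cont_kpoisson_t R _ _ _ _ (angle x) y cl ca q0).
- have v1 := in_time_lt1 hs' Ky; have q0 := kq_spoisson_gt0 ht' Ky.
  have [c1 c2] := @cont_spoisson_pair x (fun d => expR (d + t)) d y
    (shell_neq0 a0 Ky) ht' (@cont_exp_shift t d).
  have cl : {for (d, y), continuous (fun p : R * V => expR (p.1 + t))}.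
    exact: (@cont_fst R V R (fun d => expR (d + t)) d y (@cont_exp_shift t d)).
  have ca : {for (d, y), continuous (fun p : R * V => angle x p.2)}.
    exact: (@cont_snd R V R (angle x) d y (cont_angle (shell_neq0 a0 Ky))).
  apply: contB; apply: contM => //.
  + exact: (@cont_scale_pair R n (fun d => expR (d + s)) _ d y (@cont_exp_shift s d) (cont_euler2_harmonic hu v1)).
  + exact: (@cont_scale_pair R n (fun d => expR (d + s)) _ d y (@cont_exp_shift s d) (hd_cont hu v1)).
  + exact: (@cont_kpoisson_tt R _ _ _ _ (fun p : R * V => angle x p.2) (d, y) cl ca q0).
Qed.

(** Green's formula exchanges E^2 u + (n - 2) E u for minus |y|^2 Lap of the kernel, which equals
    P_tt + (n - 2) P_t. Both factors thus obey the same second-order equation under the mean, and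
    Abel's identity for the Wronskian follows. *)
Let F'_F (d : R) : d <= 0 -> smean (F' d) = - (n%:R - 2) * smean (F d).
Proof.
move=> /inb[hs' ht'].
have hG := spoisson_homogeneous ht'.
have G := smean_flow_green hu a0 ab b1 hG hs'.
have cu y : K y -> {for y, continuous (fun y => u (expR (d + s) *: y))}.
  by move=> Ky; exact: (cont_scale (hd_cont hu (in_time_lt1 hs' Ky))).
have cE y : K y -> {for y, continuous (fun y => euler u1 (expR (d + s) *: y))}.
  by move=> Ky; exact: (cont_scale (cont_euler_harmonic hu (in_time_lt1 hs' Ky))).
have cE2 y : K y -> {for y, continuous (fun y => euler2 u1 u2 (expR (d + s) *: y))}.
  by move=> Ky; exact: (cont_scale (cont_euler2_harmonic hu (in_time_lt1 hs' Ky))).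
have ca y : K y -> {for y, continuous (angle x)}.
  by move=> Ky; apply: cont_angle; exact: (shell_neq0 a0 Ky).
have cl y : {for y, continuous (fun _ : V => expR (d + t))} by exact: cont_cst.
have cs y : K y -> {for y, continuous (spoisson x (expR (d + t)))}.
  by move=> Ky; exact: (@cont_kpoisson R _ _ _ _ (angle x) y (cl y) (ca y Ky) (kq_spoisson_gt0 ht' Ky)).
have ct y : K y -> {for y, continuous (spoisson_t x (expR (d + t)))}.
  by move=> Ky; exact: (@cont_kpoisson_t R _ _ _ _ (angle x) y (cl y) (ca y Ky) (kq_spoisson_gt0 ht' Ky)).
have ctt y : K y -> {for y, continuous (fun y => kpoisson_tt (sqnorm x) k (expR (d + t)) (angle x y))}.
  by move=> Ky; exact: (@cont_kpoisson_tt R _ _ _ _ (angle x) y (cl y) (ca y Ky) (kq_spoisson_gt0 ht' Ky)).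
have H : smean (fun y => u (expR (d + s) *: y) * slap
     (fun i y => kpoisson_zz (sqnorm x) k (expR (d + t)) (angle x y) * angle1 x i y ^+ 2
     + kpoisson_z (sqnorm x) k (expR (d + t)) (angle x y) * angle2 x i y) y) =
   - (smean (fun y => u (expR (d + s) *: y) * kpoisson_tt (sqnorm x) k (expR (d + t)) (angle x y))
    + (n%:R - 2) * smean (fun y => u (expR (d + s) *: y) * spoisson_t x (expR (d + t)) y)).
  rewrite -[RHS]mulN1r -smeanZ //; last first.
    by move=> y Ky; apply: contM; [exact: cu | exact: ct].
  rewrite -smeanD //.
  - rewrite -smeanZ //; last first.
      move=> y Ky; apply: contD; first by apply: contM; [exact: cu | exact: ctt].
      by apply: contZ; apply: contM; [exact: cu | exact: ct].
    apply: (eq_smean ab) => y Ky.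
    by rewrite slap_spoisson ?(shell_neq0 a0 Ky) // /spoisson_t; ring.
  - by move=> y Ky; apply: contM; [exact: cu | exact: ctt].
  - by move=> y Ky; apply: contZ; apply: contM; [exact: cu | exact: ct].
rewrite H opprK in G.
rewrite /F' /F !smeanB //.
- move: G; set A1 := smean _; set A2 := smean _; set A3 := smean _; set A4 := smean _ => G.
  by apply/eqP; rewrite -subr_eq0; apply/eqP; move/eqP: G; rewrite -subr_eq0 => /eqP G; rewrite -[RHS]G; ring.
- by move=> y Ky; apply: contM; [exact: cE | exact: cs].
- by move=> y Ky; apply: contM; [exact: cu | exact: ct].
- by move=> y Ky; apply: contM; [exact: cE2 | exact: cs].
- by move=> y Ky; apply: contM; [exact: cu | exact: ctt].
Qed.

(** By Abel's identity e^((n-2) d) <F d> is constant for d <= 0. As d tends to minus infinity the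
    exponential stays at most 1, since n >= 2, and F d tends to 0 uniformly on the shell, so the
    constant is 0. *)
Lemma green_poisson :
  smean (fun y => euler u1 (expR s *: y) * spoisson x (expR t) y
    - u (expR s *: y) * spoisson_t x (expR t) y) = 0.
Proof.
pose H (d : R) := expR ((n%:R - 2) * d) * smean (F d).
have dH (d : R) : d <= 0 -> is_derive d 1 H 0.
  move=> d0; apply: is_derive_eq (derM (der_expRM (n%:R - 2) d) (der_F d0)) _.
  by rewrite F'_F //; ring.
have HE (d : R) : d <= 0 -> H d = H 0.
  by move=> d0; apply: constant_of_derive0 => // d' /andP[_ ?]; exact: dH.
have H0 : H 0 = smean (fun y => euler u1 (expR s *: y) * spoisson x (expR t) y
    - u (expR s *: y) * spoisson_t x (expR t) y).
  by rewrite /H mulr0 expR0 mul1r /F !add0r.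
rewrite -H0; apply/eqP; rewrite -normr_le0; apply/ler_addgt0Pr => eps eps0.
rewrite add0r.
set m := smean (fun=> 1).
(* With l = e^d the limit at minus infinity becomes the value at l = 0, an ordinary point of
   continuity at which E u and P_t both vanish. *)
pose Phi (l : R) y := euler u1 ((l * expR s) *: y) * spoisson x (l * expR t) y
   - u ((l * expR s) *: y) * spoisson_t x (l * expR t) y.
have clin (c l : R) : {for l, continuous (fun l : R => l * c)}.
  by apply: contM; [exact: cvg_id | exact: cont_cst].
have cPhi y : K y -> {for (0 : R, y), continuous (fun p : R * V => Phi p.1 p.2)}.
  move=> Ky; have y0 := shell_neq0 a0 Ky.
  have v1 : sqnorm ((0 * expR s) *: y) < 1 by rewrite mul0r scale0r /sqnorm big1 ?ltr01 // => i _; rewrite mxE expr0n.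
  have k0 : sqnorm x * (0 * expR t) ^+ 2 < 1 by rewrite mul0r expr0n mulr0.
  have [c1 c2] := @cont_spoisson_pair x (fun l => l * expR t) 0 y y0 k0 (clin (expR t) 0).
  apply: contB; apply: contM => //.
  + exact: (@cont_scale_pair R n (fun l => l * expR s) _ 0 y (clin (expR s) 0) (cont_euler_harmonic hu v1)).
  + exact: (@cont_scale_pair R n (fun l => l * expR s) _ 0 y (clin (expR s) 0) (hd_cont hu v1)).
have Phi0 y : Phi 0 y = 0.
  rewrite /Phi !mul0r scale0r /euler big1 => [|i _]; last by rewrite mxE mul0r.
  rewrite /spoisson_t /kpoisson_t expr0n /= !(mulr0, mul0r) subr0 /=.
  by rewrite !(mulr0, mul0r, subr0).
have m0 : 0 <= m.
  have := @smean_le R n a b ab (fun=> 0) 0; rewrite mul0r.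
  have := @smean_le R n a b ab (fun=> 1) 1.
  rewrite normr1 mul1r => h _; exact: le_trans (normr_ge0 _) (h (fun _ _ => lexx _)).
have eps1 : 0 < eps / (m + 1) by rewrite divr_gt0 // ltr_wpDl.
have /nbhs_normP[d /= d0 hd] :=
  @uniform_on_compact R R V K Phi 0 (@compact_shell R n a b) cPhi _ eps1.
pose l := Num.min 1 (d / 2).
have l0 : 0 < l by rewrite lt_min ltr01 divr_gt0.
have ld : l < d.
  by rewrite gt_min; apply/orP; right; rewrite ltr_pdivrMr // ltr_pMr // ltr1n.
have lnl : ln l <= 0 by apply: ln_le0; rewrite ge_min lexx.
rewrite -(HE _ lnl) /H normrM.
have e1 : `|expR ((n%:R - 2) * ln l)| <= 1.
  rewrite ger0_norm ?expR_ge0 // expR_le1 mulr_ge0_le0 // subr_ge0.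
  by rewrite (ler_nat R 2).
have FP : F (ln l) = Phi l.
  by apply: funext => y; rewrite /F /Phi !expRD lnK.
have e2 : `|smean (F (ln l))| <= eps.
  apply: (@le_trans _ _ (eps / (m + 1) * m)).
    apply: (smean_le ab) => y Ky; rewrite FP.
    have := hd l _ y Ky; rewrite Phi0 subr0; apply.
    by rewrite /= sub0r normrN ger0_norm // ltW.
  by rewrite mulrAC ler_pdivrMr ?ltr_wpDl // ler_pM2l // lerDl.
by rewrite -[leRHS]mul1r; apply: ler_pM.
Qed.

End Flow.

End PoissonFormula.

(** * Normalisation, transport and concentration of the kernel *)

Section PoissonLimit.
Context {R : realType} {n : nat}.
Local Notation V := 'rV[R]_n.
Local Notation e i := (delta_mx ord0 i : V).
Implicit Types (x y z : V).
Local Notation k := (n%:R / 2 : R).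
Hypothesis n_ge2 : (2 <= n)%N.

Lemma harmonic_cst (c r : R) :
  harmonic_data r (fun _ : V => c) (fun _ _ => 0) (fun _ _ _ => 0).
Proof.
split=> [y i _|y i j _|y _|y i _|y i j _|y _].
- exact: derC.
- exact: derC.
- exact: cont_cst.
- exact: cont_cst.
- exact: cont_cst.
- by rewrite big1.
Qed.

Section Shell.
Variables (a b : R).
Hypotheses (a0 : 0 < a) (ab : a < b) (b1 : b < 1).
Local Notation K := (@shell R n a b).
Local Notation smean := (@smean R n a b).

Lemma smean1_ge0 : 0 <= smean (fun=> 1).
Proof.
have := @smean_le R n a b ab (fun=> 1) 1.
by rewrite normr1 mul1r => h; exact: le_trans (normr_ge0 _) (h (fun _ _ => lexx _)).
Qed.

Lemma smean_abs_le (g h : V -> R) : (forall y, K y -> {for y, continuous g}) ->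
  (forall y, K y -> {for y, continuous h}) -> (forall y, K y -> `|g y| <= h y) ->
  `|smean g| <= smean h.
Proof.
move=> cg ch gh.
have bd f : (forall y, K y -> {for y, continuous f}) ->
    bounded_fun (fun y => weight a b y * f y).
  exact: (bounded_wcontinuous (@weight_ge0 R n a b) (weight_le ab)
    (@compact_shell R n a b) (weight_out ab)).
have pw y : - (weight a b y * h y) <= weight a b y * g y <= weight a b y * h y.
  have [Ky|nKy] := pselect (K y); last by rewrite (weight_out ab nKy) !mul0r oppr0 lexx.
  have := gh y Ky; rewrite ler_norml => /andP[h1 h2].
  by rewrite -mulrN !ler_wpM2l // weight_ge0.
have bh := bd h ch.
rewrite ler_norml; apply/andP; split.
- rewrite -mulN1r /smean -(smeanZ ab) //; apply: le_mean; [|exact: bd|].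
    by apply: bd => y Ky; apply: contZ; exact: ch.
  by move=> y; rewrite mulN1r mulrN; case/andP: (pw y).
- by apply: le_mean; [exact: bd | exact: bd |] => y; case/andP: (pw y).
Qed.

Lemma cont_spoisson x t y : in_kernel x t -> K y ->
  {for y, continuous (spoisson x (expR t))} /\ {for y, continuous (spoisson_t x (expR t))}.
Proof.
move=> ht Ky; have q0 := kq_spoisson_gt0 a0 ht Ky.
have ca : {for y, continuous (angle x)} by apply: cont_angle; exact: (shell_neq0 a0 Ky).
have cl : {for y, continuous (fun _ : V => expR t)} by exact: cont_cst.
split.
- exact: (@cont_kpoisson R _ _ _ _ (angle x) y cl ca q0).
- exact: (@cont_kpoisson_t R _ _ _ _ (angle x) y cl ca q0).
Qed.

(** The Wronskian identity for u = 1, where the term with the Euler operator vanishes. *)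
Lemma smean_spoisson_t x t : in_kernel x t -> smean (spoisson_t x (expR t)) = 0.
Proof.
move=> ht.
have := green_poisson n_ge2 a0 ab b1 (harmonic_cst 1 1) (in_time_le0 a0 ab b1 (lexx 0)) ht.
rewrite (_ : smean _ = smean (fun y => - 1 * spoisson_t x (expR t) y)).
  rewrite (smeanZ ab) => [/eqP|y Ky]; last by case: (cont_spoisson ht Ky).
  by rewrite mulN1r oppr_eq0 => /eqP.
apply: (eq_smean ab) => y _; rewrite /euler big1 => [|i _]; last by rewrite mulr0.
by rewrite mul0r sub0r mul1r mulN1r.
Qed.

(** The mean of the kernel at e^t x has zero derivative in t, and as e^t tends to 0 the kernel tends
    uniformly to 1. This takes the place of the normalisation of the Poisson integral. *)
Lemma smean_spoisson x t : in_kernel x t -> smean (spoisson x (expR t)) = smean (fun=> 1).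
Proof.
move=> ht.
have dN (s : R) : s <= t -> is_derive s 1 (fun s => smean (spoisson x (expR s))) 0.
  move=> st; have hs := in_kernel_le st ht.
  rewrite -(smean_spoisson_t hs).
  apply: (@smean_is_derive R n a b ab (fun s => spoisson x (expR s))
    (fun s => spoisson_t x (expR s)) s) => [||y Ky].
  - apply: filterS (in_kernel_near hs) => s' hs' y Ky.
    exact: (der_kpoisson_t k (kq_spoisson_gt0 a0 hs' Ky)).
  - by apply: filterS (in_kernel_near hs) => s' hs' y Ky; have [] := cont_spoisson hs' Ky.
  - have [_] := @cont_spoisson_pair _ _ x expR s y (shell_neq0 a0 Ky) hs (@continuous_expR R s).
    exact.
apply/eqP; rewrite -subr_eq0 -normr_le0; apply/ler_addgt0Pr => eps eps0; rewrite add0r.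
have cPhi y : K y -> {for (0 : R, y), continuous (fun p : R * V => spoisson x p.1 p.2)}.
  move=> Ky; have k0 : sqnorm x * (0 : R) ^+ 2 < 1 by rewrite expr0n mulr0.
  have [+ _] := @cont_spoisson_pair _ _ x id 0 y (shell_neq0 a0 Ky) k0 (@cvg_id _ (nbhs (0 : R))).
  exact.
have Phi0 y : spoisson x 0 y = 1.
  by rewrite /spoisson /kpoisson /kr /kq expr0n /= !(mulr0, mul0r) !subr0 addr0 powR1 mulr1.
set m := smean (fun=> 1).
have eps1 : 0 < eps / (m + 1) by rewrite divr_gt0 // ltr_wpDl // smean1_ge0.
have /nbhs_normP[d /= d0 hd] :=
  @uniform_on_compact R R V K (spoisson x) 0 (@compact_shell R n a b) cPhi _ eps1.
pose l := Num.min (expR t) (d / 2).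
have l0 : 0 < l by rewrite lt_min expR_gt0 divr_gt0.
have ld : l < d.
  by rewrite gt_min; apply/orP; right; rewrite ltr_pdivrMr // ltr_pMr // ltr1n.
have lnl : ln l <= t by rewrite -[t]expRK ler_ln ?posrE ?expR_gt0 // ge_min lexx.
have hl := in_kernel_le lnl ht.
have <- : smean (spoisson x (expR (ln l))) = smean (spoisson x (expR t)).
  apply: (@constant_of_derive0 R (fun s => smean (spoisson x (expR s))) _ _ lnl).
  by move=> s /andP[_ st]; exact: dN.
rewrite /m -(smeanB ab) => [|y Ky|y Ky]; last exact: cont_cst.
  apply: (@le_trans _ _ (eps / (m + 1) * m)).
    apply: (smean_le ab) => y Ky; rewrite lnK //.
    have := hd l _ y Ky; rewrite Phi0; apply.
    by rewrite /= sub0r normrN ger0_norm // ltW.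
  by rewrite mulrAC ler_pdivrMr ?ltr_wpDl ?smean1_ge0 // ler_pM2l // lerDl.
by case: (cont_spoisson hl Ky).
Qed.

Section Transport.
Variables (u : V -> R) (u1 : 'I_n -> V -> R) (u2 : 'I_n -> 'I_n -> V -> R).
Hypothesis hu : harmonic_data 1 u u1 u2.

(** The two times run in opposite directions, so the derivative in s is exactly the mean of the
    Wronskian, which is zero. *)
Lemma smean_transport x (d : R) : d <= 0 -> in_kernel x (- d) ->
  smean (fun y => u (expR d *: y) * spoisson x (expR (- d)) y) =
  smean (fun y => u y * spoisson x 1 y).
Proof.
move=> d0 hd.
have dT (s : R) : d <= s <= 0 -> is_derive s 1
    (fun s => smean (fun y => u (expR s *: y) * spoisson x (expR (- s)) y)) 0.
  move=> /andP[ds s0].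
  have hs := in_time_le0 a0 ab b1 s0.
  have hk : in_kernel x (- s) by apply: in_kernel_le hd; rewrite lerN2.
  have near_in : \forall s' \near s, in_time b s' /\ in_kernel x (- s').
    apply: filterI; first exact: in_time_near.
    have cN : {for s, continuous (fun s : R => - s)} by exact: opp_continuous.
    exact: (cN _ (in_kernel_near hk)).
  rewrite -(green_poisson n_ge2 a0 ab b1 hu hs hk).
  apply: (@smean_is_derive R n a b ab (fun s y => u (expR s *: y) * spoisson x (expR (- s)) y)
   (fun s y => euler u1 (expR s *: y) * spoisson x (expR (- s)) y
    - u (expR s *: y) * spoisson_t x (expR (- s)) y) s) => [||y Ky].
  - apply: filterS near_in => s' [hs' hk'] y Ky.
    have q0 := kq_spoisson_gt0 a0 hk' Ky.
    have dN : is_derive s' 1 (fun s : R => - s) (- 1).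
      by apply: derN; exact: is_derive_id.
    have d2 := @is_derive_comp1 R R^o (fun t => kpoisson (sqnorm x) k (expR t) (angle x y))
      (fun s => - s) s' 1 _ _ dN (der_kpoisson_t k q0).
    apply: is_derive_eq (derM (der_ray_harmonic hu (in_time_lt1 hs' Ky)) d2) _.
    by rewrite /spoisson /spoisson_t; ring.
  - apply: filterS near_in => s' [hs' hk'] y Ky; apply: contM.
      exact: (cont_scale (hd_cont hu (in_time_lt1 hs' Ky))).
    by case: (cont_spoisson hk' Ky).
  - have ceN : {for s, continuous (fun s : R => expR (- s))}.
      by apply: (@cont_comp R _ _ (fun s : R => - s) expR);
        [exact: opp_continuous | exact: continuous_expR].
    have [c1 c2] := @cont_spoisson_pair _ _ x (fun s => expR (- s)) s y (shell_neq0 a0 Ky) hk ceN.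
    have v1 := in_time_lt1 hs Ky.
    apply: contB; apply: contM => //.
    + exact: (@cont_scale_pair R n expR _ s y (@continuous_expR R s) (cont_euler_harmonic hu v1)).
    + exact: (@cont_scale_pair R n expR _ s y (@continuous_expR R s) (hd_cont hu v1)).
have -> := constant_of_derive0 d0 dT; rewrite oppr0 expR0.
by congr (smean _); apply: funext => y; rewrite scale1r.
Qed.

End Transport.

End Shell.

Section Limit.
Variables (u : V -> R) (u1 : 'I_n -> V -> R) (u2 : 'I_n -> 'I_n -> V -> R).
Hypothesis hu : harmonic_data 1 u u1 u2.

(** The law of cosines, arranged to separate the radial deviation from the angular one; for l >= 0
    the latter is nonnegative by Cauchy-Schwarz. *)
Lemma sqnorm_sub_angle (l : R) x y : y != 0 ->
  sqnorm (l *: y - x) = (l * enorm y - enorm x) ^+ 2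
    + 2 * (l * enorm y) * (enorm x - angle x y).
Proof.
move=> y0; have r0 : enorm y != 0 by rewrite gt_eqF // enorm_gt0.
have -> : sqnorm (l *: y - x) = sqnorm (l *: y) + sqnorm x - 2 * (l * dotp x y).
  rewrite sqnormB; congr (_ - 2 * _); rewrite /dotp mulr_sumr.
  by apply: eq_bigr => i _; rewrite mxE mulrCA mulrC.
by rewrite sqnormZ -!enorm_sqr /angle; field.
Qed.

Lemma angle_le_enorm x y : y != 0 -> `|angle x y| <= enorm x.
Proof.
move=> y0; rewrite -(ler_pXn2r (n := 2)) ?nnegrE ?normr_ge0 ?enorm_ge0 //.
by rewrite real_normK ?num_real // enorm_sqr; exact: angle_sqr_le.
Qed.

(** The radial part is at most (d1 / 2)^2 <= d1 / 2 <= d / 4, the angular part less than d / 2. *)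
Lemma sqnorm_sub_lt x y (l eta d d1 : R) : y != 0 -> l = enorm x + eta ->
  0 < eta -> eta <= d1 / 2 -> d1 <= 1 -> d1 <= d / 2 -> l <= 1 ->
  1 - d1 / 2 <= enorm y -> enorm y <= 1 -> enorm x - angle x y < d / 4 ->
  sqnorm (l *: y - x) < d.
Proof.
move=> y0 lE eta0 etad d11 d1d l1 y1 yr small.
rewrite sqnorm_sub_angle //.
have := angle_le_enorm x y0; rewrite ler_norml => /andP[_ ar].
have := enorm_ge0 x; have := enorm_ge0 y.
move: lE y1 yr small ar.
set r := enorm x; set rho := enorm y; set z := angle x y.
move=> lE y1 yr small ar rho0 r0.
have l0 : 0 <= l by lra.
have ly1 : l * rho <= l by rewrite ler_piMr.
have ly0 : 0 <= l * rho by exact: mulr_ge0.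
have h0 : r * (1 - d1 / 2) <= l * rho by apply: ler_pM => //; lra.
have h00 : r * d1 <= d1 by rewrite ler_piMl; lra.
have h1 : `|l * rho - r| <= d1 / 2 by rewrite ler_norml; apply/andP; split; lra.
have h2 : (l * rho - r) ^+ 2 <= d1 / 2 * (d1 / 2).
  by rewrite -real_normK ?num_real // expr2; exact: ler_pM.
have h3 : 2 * (l * rho) * (r - z) <= 2 * (r - z).
  rewrite ler_wpM2r ?subr_ge0 //; lra.
have h4 : d1 / 2 * (d1 / 2) <= d1 / 2 * 1 by rewrite ler_wpM2l; lra.
by move: h2 h3 h4; set q := _ ^+ 2; set w := 2 * _ * _; set w' := d1 / 2 * _; lra.
Qed.

(** The kernel is evaluated at x / l, close to the sphere: its numerator (l^2 - |x|^2) / l^2 is of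
    order eta, while q is at least d / 2 away from the ray through x. *)
Lemma spoisson_far x y (l eta d : R) : y != 0 -> 0 < d -> 0 < eta ->
  l = enorm x + eta -> l <= 1 -> d / 4 <= enorm x - angle x y ->
  spoisson x l^-1 y <= 16 / d * eta * (2 * (d / 4)) `^ (- k).
Proof.
move=> y0 d0 eta0 lE l1 big.
have := angle_le_enorm x y0; rewrite ler_norml => /andP[ra _].
have r0 := enorm_ge0 x.
have l0 : 0 < l by rewrite lE ltr_wpDl.
have il : 1 <= l^-1 by rewrite invf_ge1.
rewrite /spoisson /kpoisson.
have qd : 2 * (d / 4) <= kq (sqnorm x) l^-1 (angle x y).
  have -> : kq (sqnorm x) l^-1 (angle x y) =
      (1 - l^-1 * enorm x) ^+ 2 + 2 * (l^-1 * (enorm x - angle x y)).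
    by rewrite /kq -enorm_sqr; ring.
  have h1 : 0 <= (1 - l^-1 * enorm x) ^+ 2 by exact: sqr_ge0.
  have h2 : 1 * (d / 4) <= l^-1 * (enorm x - angle x y).
    by apply: ler_pM => //; rewrite divr_ge0 // ltW.
  by move: h1 h2; set q := _ ^+ 2; set w := l^-1 * _; lra.
have d40 : 0 < 2 * (d / 4) by rewrite mulr_gt0 // divr_gt0.
have rk : kr (sqnorm x) k l^-1 (angle x y) <= (2 * (d / 4)) `^ (- k).
  rewrite /kr !powRN lef_pV2 ?posrE ?powR_gt0 ?(lt_le_trans d40) //.
  have k0 : 0 <= k by rewrite divr_ge0 // ler0n.
  have q0 := le_trans (ltW d40) qd.
  by apply: ge0_ler_powR => //; rewrite nnegrE // ltW.
have rl : 0 <= 1 - sqnorm x * l^-1 ^+ 2.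
  rewrite subr_ge0 -enorm_sqr -exprMn expr_le1 ?mulr_ge0 ?invr_ge0 ?(ltW l0) //.
  by rewrite ler_pdivrMr // mul1r lE lerDl ltW.
apply: ler_pM => //; first exact: powR_ge0.
(* The difference |x| - z is at most 2 |x|, so the far region is empty unless |x| >= d / 8. This
   bounds l from below, also for x near 0. *)
have rd : d / 8 <= enorm x by move: ra big; lra.
rewrite -enorm_sqr; set r := enorm x in lE rd r0 *.
have h1 : eta * 2 <= 16 / d * eta * l.
  rewrite [leRHS](_ : _ = eta * (16 / d * l)); last by ring.
  rewrite ler_wpM2l ?(ltW eta0) // mulrAC ler_pdivlMr //.
  by lra.
have h2 : l ^+ 2 - r ^+ 2 <= eta * 2 * l.
  rewrite [leLHS](_ : _ = eta * (l + r)); last by rewrite lE; ring.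
  by rewrite -mulrA ler_wpM2l ?(ltW eta0) //; lra.
have h3 : eta * 2 * l <= 16 / d * eta * l * l by rewrite ler_wpM2r // ltW.
have l2 : 0 < l ^+ 2 by rewrite exprn_gt0.
have -> : 1 - r ^+ 2 * l^-1 ^+ 2 = (l ^+ 2 - r ^+ 2) / l ^+ 2.
  by field; rewrite gt_eqF.
rewrite ler_pdivrMr //; apply: le_trans h2 (le_trans h3 _).
by rewrite expr2 mulrA.
Qed.

(* As d decreases to ln |x| the kernel at e^-d x concentrates on the ray through x,
   while u (e^d y) is evaluated near x; the mean does not depend on d. *)
Lemma poisson_limit x (eps : R) : sqnorm x < 1 -> 0 < eps ->
  exists2 a1 : R, a1 < 1 & forall a b : R, 0 < a -> a1 <= a -> a < b -> b < 1 ->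
    `|smean a b (fun y => u y * spoisson x 1 y) - u x * smean a b (fun _ : V => 1)|
      <= eps * smean a b (fun _ : V => 1).
Proof.
move=> x1 eps0.
have eps2 : 0 < eps / 2 by rewrite divr_gt0.
have [d d0 hd] : exists2 d : R, 0 < d & forall z, sqnorm (z - x) < d -> `|u z - u x| <= eps / 2.
  have /cvgrPdist_le /(_ _ eps2) /nbhs_normP[r /= r0 hr] := hd_cont hu x1.
  exists (r ^+ 2); first by rewrite exprn_gt0.
  move=> z zx; rewrite distrC; apply: hr => /=; rewrite distrC.
  apply: le_lt_trans (norm_le_enorm _) _.
  rewrite -(ltr_pXn2r (n := 2)) ?nnegrE ?enorm_ge0 ?(ltW r0) //.
  by rewrite enorm_sqr.
pose d1 := Num.min 1 (d / 2).
have d10 : 0 < d1 by rewrite lt_min ltr01 divr_gt0.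
have d11 : d1 <= 1 by rewrite ge_min lexx.
have d1d : d1 <= d / 2 by rewrite ge_min lexx orbT.
exists (1 - d1 / 2) => [|a b a0 a1 ab b1]; first by rewrite gtrBl divr_gt0.
set m := smean a b (fun=> 1).
have m0 : 0 <= m by exact: smean1_ge0.
pose r := enorm x.
have r1 : r < 1.
  by rewrite -(ltr_pXn2r (n := 2)) ?nnegrE ?enorm_ge0 // enorm_sqr expr1n.
have r0 : 0 <= r by exact: enorm_ge0.
have [M M0 hM] : exists2 M : R, 0 <= M & forall y, sqnorm y <= b -> `|u y| <= M.
  have c : forall y, @shell R n (-1) b y -> {for y, continuous u}.
    by move=> y /andP[_ yb]; apply: (hd_cont hu); exact: le_lt_trans b1.
  have [M M0 hM] := continuous_bounded_on (@compact_shell R n (-1) b) c.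
  exists M => // y yb; apply: hM; apply/andP; split => //.
  by apply: le_trans (sqnorm_ge0 y); rewrite lerN10.
have ux : `|u x| <= `|u x| by [].
have d20 : 0 < 2 * (d / 4) by rewrite mulr_gt0 // divr_gt0.
pose C := (M + `|u x|) * (2 * (d / 4)) `^ (- k).
have C0 : 0 <= C by rewrite mulr_ge0 ?powR_ge0 // addr_ge0.
(* Three requirements: the near estimate, l < 1, and a far part below eps / 2. The last involves
   [M], a bound of u on |y|^2 <= b, so [eta] and [l] depend on the shell. That is harmless: the
   transported mean does not depend on [l], and the threshold for [a] depends on [d1] alone. *)
pose eta := Num.min (d1 / 2) (Num.min ((1 - r) / 2) (eps / 2 / (16 / d * (C + 1)))).
have C1 : 0 < 16 / d * (C + 1) by rewrite mulr_gt0 ?divr_gt0 // ltr_wpDl.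
have eta0 : 0 < eta.
  by rewrite !lt_min !divr_gt0 // subr_gt0.
have etad : eta <= d1 / 2 by rewrite ge_min lexx.
have etar : eta <= (1 - r) / 2 by rewrite !ge_min lexx orbT.
have etae : eta <= eps / 2 / (16 / d * (C + 1)) by rewrite !ge_min lexx !orbT.
have [l lE] : exists l : R, l = r + eta by exists (r + eta).
have l0 : 0 < l by rewrite lE ltr_wpDl.
have rl : r < l by rewrite lE ltrDl.
have l1 : l < 1 by rewrite lE; move: etar; lra.
have lnl : ln l <= 0 by apply: ln_le0; exact: ltW.
have el : expR (ln l) = l by rewrite lnK.
have eNl : expR (- ln l) = l^-1 by rewrite expRN el.
have xk : sqnorm x * (l^-1) ^+ 2 < 1.
  rewrite -enorm_sqr -exprMn expr_lt1 // ?mulr_ge0 ?invr_ge0 ?(ltW l0) //.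
  by rewrite ltr_pdivrMr // mul1r.
have hk : in_kernel x (- ln l) by rewrite /in_kernel eNl.
have uK y : shell a b y -> sqnorm (l *: y) <= b.
  move=> /andP[_ yb]; rewrite sqnormZ; apply: le_trans yb.
  rewrite ler_piMl ?sqnorm_ge0 // expr_le1 // ?ltW //.
have cu y : shell a b y -> {for y, continuous (fun y => u (l *: y))}.
  by move=> /uK h; apply: cont_scale; apply: (hd_cont hu); exact: le_lt_trans b1.
have cs y : shell a b y -> {for y, continuous (spoisson x l^-1)}.
  by move=> Ky; rewrite -eNl; case: (cont_spoisson a0 hk Ky).
have pm : smean a b (spoisson x l^-1) = m.
  by rewrite -eNl; exact: smean_spoisson.
have T := smean_transport a0 ab b1 hu lnl hk.
rewrite el eNl in T.
rewrite -T -pm -(smeanZ ab) // -(smeanB ab); last first.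
- by move=> y Ky; apply: contZ; exact: cs.
- by move=> y Ky; apply: contM; [exact: cu | exact: cs].
have -> : eps * smean a b (spoisson x l^-1) = smean a b (fun y => eps / 2 * spoisson x l^-1 y + eps / 2 * 1).
  rewrite (smeanD ab).
  - have E1 : smean a b (fun y => eps / 2 * spoisson x l^-1 y) = eps / 2 * m.
      by rewrite (smeanZ ab (eps / 2) cs) pm.
    have E2 : smean a b (fun _ : V => eps / 2 * 1) = eps / 2 * m.
      by apply: (smeanZ ab) => y _; exact: cont_cst.
    by rewrite E1 E2 pm -mulrDl -splitr.
  - by move=> y Ky; apply: contZ; exact: cs.
  - by move=> y Ky; apply: contZ; exact: cont_cst.
apply: (smean_abs_le ab) => [y Ky|y Ky|y Ky].
- by apply: contB; [apply: contM; [exact: cu | exact: cs] | apply: contZ; exact: cs].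
- by apply: contD; [apply: contZ; exact: cs | exact: cont_cst].
have y0 := shell_neq0 a0 Ky.
have q0 : 0 < kq (sqnorm x) l^-1 (angle x y) by apply: kq_gt0 => //; exact: angle_sqr_le.
have p0 : 0 <= spoisson x l^-1 y by apply: kpoisson_ge0; exact: ltW.
rewrite -mulrBl normrM (ger0_norm p0).
have ry : enorm y < 1.
  have /andP[_ yb] := Ky.
  rewrite -(ltr_pXn2r (n := 2)) ?nnegrE ?enorm_ge0 // enorm_sqr expr1n.
  exact: le_lt_trans b1.
have ya : 1 - d1 / 2 <= enorm y.
  have /andP[ya _] := Ky.
  apply: (@le_trans _ _ (enorm y ^+ 2)); first by rewrite enorm_sqr (le_trans a1).
  by rewrite expr2 ler_piMl ?enorm_ge0 // ltW.
have [small|big] := ltP (enorm x - angle x y) (d / 4).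
  have H : `|u (l *: y) - u x| <= eps / 2.
    by apply: hd; exact: sqnorm_sub_lt y0 lE eta0 etad d11 d1d (ltW l1) ya (ltW ry) small.
  apply: (@le_trans _ _ (eps / 2 * spoisson x l^-1 y)); first exact: ler_wpM2r p0 _ _ H.
  by rewrite lerDl mulr1 (ltW eps2).
apply: (@le_trans _ _ (eps / 2 * 1)); last by rewrite lerDr (mulr_ge0 (ltW eps2) p0).
rewrite mulr1.
have uM : `|u (l *: y) - u x| <= M + `|u x|.
  by apply: le_trans (ler_normB _ _) _; rewrite lerD2r; apply: hM; exact: uK.
have pb := spoisson_far y0 d0 eta0 lE (ltW l1) big.
apply: (@le_trans _ _ ((M + `|u x|) * (16 / d * eta * (2 * (d / 4)) `^ (- k)))).
  by apply: ler_pM uM pb; rewrite ?normr_ge0.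
rewrite [leLHS](_ : _ = 16 / d * C * eta); last by rewrite /C; ring.
have e0 : 0 <= 16 / d by rewrite divr_ge0 // (ltW d0).
apply: (@le_trans _ _ (16 / d * (C + 1) * eta)).
  by rewrite ler_wpM2r ?(ltW eta0) // ler_wpM2l // lerDl.
by rewrite mulrC -(ler_pdivlMr _ _ C1).
Qed.

End Limit.

End PoissonLimit.

(** * Even Taylor expansion *)

Section EvenTaylor.
Context {R : realType}.
Implicit Types (f g v dv : R -> R).

Lemma ge0_of_derive (f f' : R -> R) (s : R) : 0 <= f 0 ->
  (forall t, 0 <= t <= s -> is_derive t 1 f (f' t)) ->
  (forall t, 0 <= t <= s -> 0 <= f' t) ->
  forall t, 0 <= t <= s -> 0 <= f t.
Proof.
move=> f0 df f'0 t /andP[t0 ts].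
have [|r /andP[r0 rt] E] := @MVT_is_derive R f f' 0 t t0.
  by move=> r /andP[r0 rt]; apply: df; rewrite r0 (le_trans rt).
have : 0 <= f t - f 0 by rewrite E subr0 mulr_ge0 // f'0 // r0 (le_trans rt).
by rewrite subr_ge0; exact: le_trans.
Qed.

(** Nonnegativity is integrated twice, once for g - f and once for g + f. *)
Lemma second_order_comparison (f f' f'' g g' g'' : R -> R) (s : R) :
  (forall t, 0 <= t <= s -> is_derive t 1 f (f' t)) ->
  (forall t, 0 <= t <= s -> is_derive t 1 f' (f'' t)) ->
  (forall t, 0 <= t <= s -> is_derive t 1 g (g' t)) ->
  (forall t, 0 <= t <= s -> is_derive t 1 g' (g'' t)) ->
  f' 0 = 0 -> g' 0 = 0 -> `|f 0| <= g 0 ->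
  (forall t, 0 <= t <= s -> `|f'' t| <= g'' t) ->
  forall t, 0 <= t <= s -> `|f t| <= g t.
Proof.
move=> df df' dg dg' f'0 g'0 fg0 fg'' t ts.
have sub0 : 0 <= g t - f t.
  apply: (@ge0_of_derive (fun t => g t - f t) (fun t => g' t - f' t) s) => // [|r rs|r rs].
  - by rewrite subr_ge0 (le_trans (ler_norm _)).
  - exact: derB (dg r rs) (df r rs).
  apply: (@ge0_of_derive (fun t => g' t - f' t) (fun t => g'' t - f'' t) s) => // [|q qs|q qs].
  - by rewrite g'0 f'0 subr0.
  - exact: derB (dg' q qs) (df' q qs).
  - by rewrite subr_ge0 (le_trans (ler_norm _)) // fg''.
have add0 : 0 <= g t + f t.
  apply: (@ge0_of_derive (fun t => g t + f t) (fun t => g' t + f' t) s) => // [|r rs|r rs].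
  - by move: fg0; rewrite ler_norml => /andP[+ _]; rewrite -subr_ge0 opprK addrC.
  - exact: derD (dg r rs) (df r rs).
  apply: (@ge0_of_derive (fun t => g' t + f' t) (fun t => g'' t + f'' t) s) => // [|q qs|q qs].
  - by rewrite g'0 f'0 addr0.
  - exact: derD (dg' q qs) (df' q qs).
  - by have := fg'' q qs; rewrite ler_norml => /andP[+ _]; rewrite -subr_ge0 opprK addrC.
by rewrite ler_norml -subr_ge0 opprK addrC add0 -subr_ge0 sub0.
Qed.

Let T (i : nat) (t : R) : R := t ^+ i / i`!%:R.

Let der_T i (t : R) : is_derive t 1 (T i.+1) (T i t).
Proof.
have f0 : i`!%:R != 0 :> R by rewrite pnatr_eq0 -lt0n fact_gt0.
have i0 : i.+1%:R != 0 :> R by rewrite pnatr_eq0.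
have d := derM (derX i (is_derive_id t (1 : R))) (derC (i.+1`!%:R^-1) t 1).
apply: is_derive_eq d _; rewrite /T factS natrM; field.
by rewrite f0 nat1r.
Qed.

Let evenpoly (c : nat -> R) (N : nat) (t : R) : R := \sum_(i < N) c i * T i.*2 t.

Let der_evenpoly c N (t : R) : is_derive t 1 (evenpoly c N.+1)
  (\sum_(i < N) c i.+1 * T i.*2.+1 t).
Proof.
have -> : evenpoly c N.+1 = (fun t => c 0%N + \sum_(i < N) c i.+1 * T i.*2.+2 t).
  apply: funext => s; rewrite /evenpoly big_ord_recl /T expr0 fact0 divr1 mulr1.
  by congr (_ + _); apply: eq_bigr => i _.
have d : is_derive t 1 (fun t => \sum_(i < N) c i.+1 * T i.*2.+2 t)
   (\sum_(i < N) c i.+1 * T i.*2.+1 t).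
  by apply: der_sum => i; apply: derZ; exact: der_T.
by have := derD (derC (c 0%N) t 1) d; rewrite add0r.
Qed.

Let der_evenpoly2 (c : nat -> R) N (t : R) : is_derive t 1 (fun t => \sum_(i < N) c i.+1 * T i.*2.+1 t)
  (evenpoly (fun i => c i.+1) N t).
Proof. by apply: der_sum => i; apply: derZ; exact: der_T. Qed.

Lemma sum_quarter N : \sum_(i < N) (4^-1 : R) ^+ i <= 2.
Proof.
suff -> : \sum_(i < N) (4^-1 : R) ^+ i = 4 / 3 * (1 - 4^-1 ^+ N).
  have : 0 <= (4^-1 : R) ^+ N by rewrite exprn_ge0 // invr_ge0.
  by set x := _ ^+ N; lra.
elim: N => [|N IH]; first by rewrite big_ord0 expr0 subrr mulr0.
by rewrite big_ord_recr /= IH exprS; set x := _ ^+ N; lra.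
Qed.

(* The even part of the Taylor expansion at t0 only involves the values v m t0. *)
Lemma even_taylor_bound (v dv : nat -> R -> R) (t0 s B C C' : R) :
  0 <= s -> 0 <= B -> 0 <= C -> 0 <= C' -> B * s <= 2^-1 ->
  (forall m (t : R), t0 - s <= t <= t0 + s -> is_derive t 1 (v m) (dv m t)) ->
  (forall m (t : R), t0 - s <= t <= t0 + s -> is_derive t 1 (dv m) (v m.+1 t)) ->
  (forall m, `|v m t0| <= C * B ^+ m.*2 * (m.*2)`!%:R) ->
  (forall m (t : R), t0 - s <= t <= t0 + s -> `|v m t| <= C' * B ^+ m.*2 * (m.*2)`!%:R) ->
  `|v 0%N (t0 + s)| <= `|v 0%N (t0 - s)| + 4 * C.
Proof.
move=> s0 B0 C0 C'0 Bs hv hdv vt0 vt.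
(* Twice the even part about [t0]. Its derivative [dS] vanishes at t = 0, so the unknown values
   [dv m t0] never enter. *)
pose S m t := v m (t0 + t) + v m (t0 - t).
pose dS m t := dv m (t0 + t) - dv m (t0 - t).
have inp t : 0 <= t <= s -> t0 - s <= t0 + t <= t0 + s.
  by move=> /andP[h1 h2]; rewrite !lerD2l h2 (le_trans _ h1) // oppr_le0.
have inm t : 0 <= t <= s -> t0 - s <= t0 - t <= t0 + s.
  by move=> /andP[h1 h2]; rewrite !lerD2l lerN2 h2 (le_trans _ s0) // oppr_le0.
have shp (g : R -> R) (g' t : R) : is_derive (t0 + t) 1 g g' ->
    is_derive t 1 (fun t => g (t0 + t)) g'.
  move=> h; rewrite -[g']mulr1; apply: (@is_derive_comp1 R R^o g (fun t => t0 + t)) => //.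
  by have := derD (derC t0 t 1) (is_derive_id t (1 : R)); rewrite add0r.
have shm (g : R -> R) (g' t : R) : is_derive (t0 - t) 1 g g' ->
    is_derive t 1 (fun t => g (t0 - t)) (- g').
  move=> h; rewrite -(mulrN1 g').
  apply: (@is_derive_comp1 R R^o g (fun t => t0 - t)) => //.
  by have := derB (derC t0 t 1) (is_derive_id t (1 : R)); rewrite sub0r.
have dSm m (t : R) : 0 <= t <= s -> is_derive t 1 (S m) (dS m t).
  by move=> ts; apply: derD; [apply: shp; exact/hv/inp | apply: shm; exact/hv/inm].
have ddSm m (t : R) : 0 <= t <= s -> is_derive t 1 (dS m) (S m.+1 t).
  move=> ts; rewrite /S -[v m.+1 (t0 - t)]opprK.
  by apply: derB; [apply: shp; exact/hdv/inp | apply: shm; exact/hdv/inm].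
pose A i := 2 * C * B ^+ i.*2 * (i.*2)`!%:R.
pose A' i := 2 * C' * B ^+ i.*2 * (i.*2)`!%:R.
(* Coefficients of order below [j] use the bound at the centre [t0]; the top one, the Taylor
   remainder, uses the bound on the whole interval. Passing from [j] to [j.+1] integrates the bound
   for [S m.+1] twice. *)
pose c j m i := if (i < j)%N then A (m + i)%N else A' (m + i)%N.
have bound j : forall m t, 0 <= t <= s -> `|S m t| <= evenpoly (c j m) j.+1 t.
  elim: j => [|j IH] m t ts.
    rewrite /evenpoly big_ord1 /c ltnn addn0 /T expr0 fact0 divr1 mulr1 /A'.
    apply: le_trans (ler_normD _ _) _.
    have := vt m _ (inp t ts); have := vt m _ (inm t ts).
    by set x := `|_|; set y := `|_|; set w := B ^+ _; set f := _%:R; lra.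
  have E : (fun i => c j.+1 m i.+1) = c j m.+1.
    by apply: funext => i; rewrite /c ltnS addnS addSn.
  apply: (second_order_comparison (dSm m) (ddSm m)
    (fun r _ => der_evenpoly (c j.+1 m) j.+1 r)
    (fun r _ => der_evenpoly2 (c j.+1 m) j.+1 r)) => //.
  - by rewrite /dS addr0 subr0 subrr.
  - by rewrite big1 // => i _; rewrite /T expr0n /= mul0r mulr0.
  - rewrite /evenpoly big_ord_recl /c /= addn0 /T expr0 fact0 divr1 mulr1.
    rewrite big1 => [|i _]; last by rewrite expr0n /= mul0r mulr0.
    rewrite addr0 /S addr0 subr0; apply: le_trans (ler_normD _ _) _.
    have := vt0 m; rewrite /A; set x := `|_|; set w := B ^+ _; set f := _%:R; lra.
  - by move=> r rs; rewrite E; exact: IH.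
have ss : 0 <= s <= s by rewrite s0 lexx.
have term (D : R) i : 0 <= D -> 2 * D * B ^+ i.*2 * (i.*2)`!%:R * T i.*2 s <= 2 * D * 4^-1 ^+ i.
  move=> D0; have f0 : (i.*2)`!%:R != 0 :> R by rewrite pnatr_eq0 -lt0n fact_gt0.
  rewrite /T [leLHS](_ : _ = 2 * D * (B * s) ^+ i.*2); last by rewrite exprMn; field.
  rewrite ler_wpM2l ?mulr_ge0 // -mul2n exprM; apply: lerXn2r; rewrite ?nnegrE ?sqr_ge0 ?invr_ge0 //.
  rewrite [4^-1](_ : _ = 2^-1 ^+ 2 :> R); last by field.
  by apply: lerXn2r; rewrite ?nnegrE ?invr_ge0 // mulr_ge0.
(* The remainder carries [C'] but is at most 2 C' / 4^j, which tends to 0; the remaining terms add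
   up to at most 2 C times 2. *)
have fin : `|S 0%N s| <= 4 * C.
  apply/ler_addgt0Pr => eps eps0.
  have : \forall j \near \oo, 2 * C' * 4^-1 ^+ j < eps.
    have c0 : (fun j : nat => 2 * C' * 4^-1 ^+ j) @ \oo --> 2 * C' * 0.
      apply: cvgM; first exact: cvg_cst.
      by apply: cvg_expr; rewrite ger0_norm ?invr_ge0 // invf_lt1 // ltr1n.
    rewrite mulr0 in c0.
    have /cvgrPdist_lt /(_ _ eps0) := c0.
    apply: filterS => j; rewrite sub0r normrN; apply: le_lt_trans; exact: ler_norm.
  case=> j _ /(_ j (leqnn j)) /= hj.
  apply: le_trans (bound j 0%N s ss) _.
  rewrite /evenpoly big_ord_recr /= /c ltnn add0n; apply: lerD; last first.
    by apply: le_trans (ltW hj); exact: term.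
  apply: (@le_trans _ _ (\sum_(i < j) 2 * C * 4^-1 ^+ i)).
    by apply: ler_sum => i _; rewrite ltn_ord add0n; exact: term.
  rewrite -mulr_sumr [leRHS](_ : _ = 2 * C * 2); last by ring.
  by rewrite ler_wpM2l ?mulr_ge0 // sum_quarter.
have -> : v 0%N (t0 + s) = S 0%N s - v 0%N (t0 - s) by rewrite /S addrK.
by apply: le_trans (ler_normB _ _) _; rewrite addrC lerD2l.
Qed.

End EvenTaylor.

(** * Iterated partial derivatives *)

Section Words.
Context {R : realType} {n : nat}.
Local Notation V := 'rV[R]_n.
Local Notation e i := (delta_mx ord0 i : V).
Implicit Types (x y z : V) (s t : seq 'I_n).
Variable D : set V.
Hypothesis oD : open D.

Let nearD x : D x -> \forall y \near x, D y.
Proof. by move=> Dx; move: oD; rewrite openE; apply. Qed.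

Definition smooth_on (g : V -> R) : Prop := forall s x, D x ->
  (forall i, derivable (pderivs s g) x (e i)) /\ {for x, continuous (pderivs s g)}.

Lemma smooth_onP g : smooth_on g <-> forall k, Ck_on k D g.
Proof.
split=> [sg k|Cg s x Dx].
  by split=> [s i x _ Dx|s x _ Dx]; have [] := sg s x Dx.
split=> [i|]; first by have [+ _] := Cg (size s).+1; apply.
by have [_] := Cg (size s); apply.
Qed.

Lemma pderivs_cat s t (g : V -> R) : pderivs (s ++ t) g = pderivs s (pderivs t g).
Proof. by rewrite /pderivs foldr_cat. Qed.

Lemma smooth_der g s i x : smooth_on g -> D x ->
  is_derive x (e i) (pderivs s g) (pderivs (i :: s) g x).
Proof. by move=> sg Dx; apply: derivableP; have [] := sg s x Dx. Qed.

Lemma smooth_pderivs g t : smooth_on g -> smooth_on (pderivs t g).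
Proof. by move=> sg s x Dx; rewrite -pderivs_cat; exact: sg. Qed.

(** Iterated derivatives are identified by exhibiting a family indexed by words that is closed under
    differentiation. The equalities hold only on [D]; openness makes them local, so that they can be
    differentiated. *)
Lemma pderivs_family (g : V -> R) (G : seq 'I_n -> V -> R) :
  (forall x, D x -> g x = G [::] x) ->
  (forall s i x, D x -> is_derive x (e i) (G s) (G (i :: s) x)) ->
  (forall s x, D x -> {for x, continuous (G s)}) ->
  smooth_on g /\ forall s x, D x -> pderivs s g x = G s x.
Proof.
move=> g0 dG cG.
have E s x : D x -> pderivs s g x = G s x.
  elim: s x => [|i s IH] x Dx; first exact: g0.
  have d : is_derive x (e i) (pderivs s g) (G (i :: s) x).
    apply: (near_der _ (dG s i x Dx)).
    by apply: filterS (nearD Dx) => y Dy; rewrite IH.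
  exact: (@derive_val _ _ _ _ _ _ _ d).
split=> // s x Dx; split=> [i|].
  have d : is_derive x (e i) (pderivs s g) (G (i :: s) x).
    apply: (near_der _ (dG s i x Dx)).
    by apply: filterS (nearD Dx) => y Dy; rewrite E.
  exact: (@ex_derive _ _ _ _ _ _ _ d).
move=> A; rewrite E // => hA.
suff : nbhs x (pderivs s g @^-1` A) by [].
apply: filterS (filterI (nearD Dx) (cG s x Dx A hA)) => y [Dy Ay].
by rewrite /preimage /= E.
Qed.

Lemma smooth_eq g f : (forall x, D x -> f x = g x) -> smooth_on g ->
  smooth_on f /\ forall s x, D x -> pderivs s f x = pderivs s g x.
Proof.
move=> fg sg; apply: (pderivs_family (G := fun s => pderivs s g)) => //.
- by move=> s i x Dx; exact: smooth_der.
- by move=> s x Dx; have [] := sg s x Dx.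
Qed.

Lemma smoothD f g : smooth_on f -> smooth_on g ->
  smooth_on (fun y => f y + g y) /\
  forall s x, D x -> pderivs s (fun y => f y + g y) x = pderivs s f x + pderivs s g x.
Proof.
move=> sf sg; apply: (pderivs_family (G := fun s y => pderivs s f y + pderivs s g y)) => //.
- by move=> s i x Dx; apply: derD; exact: smooth_der.
- by move=> s x Dx; apply: contD; [have [] := sf s x Dx | have [] := sg s x Dx].
Qed.

Lemma smoothZ (c : R) g : smooth_on g ->
  smooth_on (fun y => c * g y) /\
  forall s x, D x -> pderivs s (fun y => c * g y) x = c * pderivs s g x.
Proof.
move=> sg; apply: (pderivs_family (G := fun s y => c * pderivs s g y)) => //.
- by move=> s i x Dx; apply: derZ; exact: smooth_der.
- by move=> s x Dx; apply: contZ; have [] := sg s x Dx.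
Qed.

Lemma smooth_sum m (g : 'I_m -> V -> R) : (forall i, smooth_on (g i)) ->
  smooth_on (fun y => \sum_i g i y) /\
  forall s x, D x -> pderivs s (fun y => \sum_i g i y) x = \sum_i pderivs s (g i) x.
Proof.
move=> sg; apply: (pderivs_family (G := fun s y => \sum_i pderivs s (g i) y)) => //.
- by move=> s i x Dx; apply: der_sum => j; exact: smooth_der.
- by move=> s x Dx; apply: cont_sum => j; have [] := sg j s x Dx.
Qed.

(** All words obtained by deleting one occurrence of [a], with multiplicity. They index the Leibniz
    terms in which one derivative falls on the coordinate of index [a]. *)
Fixpoint erasures (a : 'I_n) s : seq (seq 'I_n) :=
  if s is i :: s' then
    [seq i :: t | t <- erasures a s'] ++ (if i == a then [:: s'] else [::])
  else [::].

Lemma size_erasures a s : (size (erasures a s) <= size s)%N.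
Proof.
elim: s => //= i s IH; rewrite size_cat size_map.
by case: (i == a) => /=; rewrite ?addn1 ?addn0 // ltnW.
Qed.

Lemma mem_erasures a s t : t \in erasures a s -> size t = (size s).-1.
Proof.
elim: s t => //= i s IH t; rewrite mem_cat => /orP[/mapP[t' /[dup] h /IH E ->]|].
  by rewrite /= E; case: s h {IH E}.
by case: (i == a) => //; rewrite inE => /eqP ->.
Qed.

Lemma smooth_coordM (a : 'I_n) g : smooth_on g ->
  smooth_on (fun y => y ord0 a * g y) /\
  forall s x, D x -> pderivs s (fun y => y ord0 a * g y) x =
    x ord0 a * pderivs s g x + \sum_(t <- erasures a s) pderivs t g x.
Proof.
move=> sg; apply: (pderivs_family (G := fun s y =>
    y ord0 a * pderivs s g y + \sum_(t <- erasures a s) pderivs t g y)) => //.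
- by move=> x Dx; rewrite big_nil addr0.
- move=> s i x Dx.
  have d1 := derM (der_coord i a x) (smooth_der s i sg Dx).
  have d2 : is_derive x (e i) (fun y => \sum_(t <- erasures a s) pderivs t g y)
      (\sum_(t <- erasures a s) pderivs (i :: t) g x).
    elim: (erasures a s) => [|t r IH].
      under eq_fun do rewrite big_nil.
      by rewrite big_nil; exact: derC.
    under eq_fun do rewrite big_cons.
    by rewrite big_cons; apply: derD => //; exact: smooth_der.
  apply: is_derive_eq (derD d1 d2) _.
  rewrite /= big_cat big_map /=.
  have -> : (i == a)%:R * pderivs s g x =
      \sum_(t <- (if i == a then [:: s] else [::])) pderivs t g x.
    by case: (i == a); rewrite ?big_seq1 ?big_nil ?mul1r ?mul0r.
  by ring.
- move=> s x Dx; apply: contD.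
    by apply: contM; [exact: cont_coord | have [] := sg s x Dx].
  elim: (erasures a s) => [|t r IH].
    have -> : (fun y => \sum_(t <- [::]) pderivs t g y) = (fun=> 0).
      by apply: funext => y; rewrite big_nil.
    exact: cont_cst.
  have -> : (fun y => \sum_(t0 <- t :: r) pderivs t0 g y) =
     (fun y => pderivs t g y + \sum_(t0 <- r) pderivs t0 g y).
    by apply: funext => y; rewrite big_cons.
  by apply: contD => //; have [] := sg t x Dx.
Qed.

End Words.

(** * Symmetry of mixed derivatives, and words against multi-indices *)

Section Schwarz.
Context {R : realType} {n : nat}.
Local Notation V := 'rV[R]_n.
Local Notation e i := (delta_mx ord0 i : V).
Implicit Types (x y z : V).

(** The mean value theorem twice: in direction i for the difference of [f] across the step h e_j,
    then in direction j for [fi]. *)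
Lemma second_difference (f : V -> R) (fi fij : V -> R) (i j : 'I_n) x (d h : R) :
  0 < h -> 2 * h < d ->
  (forall z, `|z - x| < d -> is_derive z (e i) f (fi z)) ->
  (forall z, `|z - x| < d -> is_derive z (e j) fi (fij z)) ->
  exists2 z, `|z - x| < d &
    f (h *: e i + (h *: e j + x)) - f (h *: e j + x) - (f (h *: e i + x) - f x) =
    h ^+ 2 * fij z.
Proof.
move=> h0 hd df dfi.
have inb (a b : R) : `|a| <= h -> `|b| <= h -> `|a *: e i + (b *: e j + x) - x| < d.
  move=> ah bh; rewrite addrA addrK; apply: le_lt_trans hd.
  apply: le_trans (ler_normD _ _) _; rewrite !normrZ mulr_natl mulr2n.
  by apply: lerD; rewrite -[leRHS]mulr1; apply: ler_pM => //; exact: norm_delta_mx.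
have hh : `|h| <= h by rewrite ger0_norm // ltW.
have h00 : `|0 : R| <= h by rewrite normr0 ltW.
pose g (t : R) := f (t *: e i + (h *: e j + x)) - f (t *: e i + x).
have dg (t : R) : `|t| <= `|h| ->
    is_derive t 1 g (fi (t *: e i + (h *: e j + x)) - fi (t *: e i + x)).
  rewrite (ger0_norm (ltW h0)) => th; apply: derB.
    apply/is_derive_shift0; have /is_derive_line := df _ (inb t h th hh).
    by under eq_fun do rewrite addrA -scalerDl.
  apply/is_derive_shift0; have := inb t 0 th h00; rewrite scale0r add0r => /df /is_derive_line.
  by under eq_fun do rewrite addrA -scalerDl.
have [t th Eg] := MVT0 dg; rewrite (ger0_norm (ltW h0)) in th.
have -> : f (h *: e i + (h *: e j + x)) - f (h *: e j + x) - (f (h *: e i + x) - f x) =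
    g h - g 0.
  by rewrite /g !scale0r !add0r; ring.
rewrite Eg.
have [|r rh] := @MVT_coord R n fi fij (t *: e i + x) j h.
  move=> r; rewrite (ger0_norm (ltW h0)) => rh; apply: dfi.
  by rewrite addrCA; exact: inb.
rewrite (ger0_norm (ltW h0)) in rh.
rewrite addrCA => ->; exists (r *: e j + (t *: e i + x)); first by rewrite addrCA; exact: inb.
by rewrite mulrA expr2.
Qed.

(** The second difference is symmetric in i and j, so the two mixed derivatives agree at two points
    close to [x]; continuity brings both points to [x]. *)
Lemma schwarz (f fi fj fij fji : V -> R) (i j : 'I_n) (D : set V) x : open D -> D x ->
  (forall z, D z -> is_derive z (e i) f (fi z)) ->
  (forall z, D z -> is_derive z (e j) f (fj z)) ->
  (forall z, D z -> is_derive z (e j) fi (fij z)) ->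
  (forall z, D z -> is_derive z (e i) fj (fji z)) ->
  {for x, continuous fij} -> {for x, continuous fji} -> fij x = fji x.
Proof.
move=> oD Dx dfi dfj dfij dfji cij cji.
apply/eqP; rewrite -subr_eq0 -normr_le0; apply/ler_addgt0Pr => eps eps0; rewrite add0r.
have eps2 : 0 < eps / 2 by rewrite divr_gt0.
have : \forall z \near x, D z /\ (`|fij x - fij z| <= eps / 2 /\ `|fji x - fji z| <= eps / 2).
  apply: filterI; first by move: oD; rewrite openE; apply.
  by apply: filterI; [move/cvgrPdist_le: cij | move/cvgrPdist_le: cji]; apply.
move=> /nbhs_normP[d /= d0 hd].
have hd' z : `|z - x| < d -> D z /\ (`|fij x - fij z| <= eps / 2 /\ `|fji x - fji z| <= eps / 2).
  by move=> zx; apply: hd; rewrite /= distrC.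
have h0 : 0 < d / 4 by rewrite divr_gt0.
have h1 : 2 * (d / 4) < d by lra.
have [z1 z1x E1] := second_difference h0 h1
  (fun z zx => dfi z (hd' z zx).1) (fun z zx => dfij z (hd' z zx).1).
have [z2 z2x E2] := second_difference h0 h1
  (fun z zx => dfj z (hd' z zx).1) (fun z zx => dfji z (hd' z zx).1).
have E : fij z1 = fji z2.
  have hn : (d / 4) ^+ 2 != 0 by rewrite expf_neq0 // gt_eqF.
  apply: (mulfI hn); rewrite -E1 -E2 [d / 4 *: e i + (_ + _)]addrCA; ring.
rewrite -(subrKA (fij z1)) (le_trans (ler_normD _ _)) // [leRHS]splitr lerD //.
  exact: (hd' z1 z1x).2.1.
by rewrite E distrC; exact: (hd' z2 z2x).2.2.
Qed.

Lemma pderivs_swap (D : set V) (g : V -> R) s (i j : 'I_n) x : open D -> smooth_on D g -> D x ->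
  pderivs (i :: j :: s) g x = pderivs (j :: i :: s) g x.
Proof.
move=> oD sg Dx.
apply: (@schwarz (pderivs s g) (pderivs (j :: s) g) (pderivs (i :: s) g)
  (pderivs (i :: j :: s) g) (pderivs (j :: i :: s) g) j i D x) => //.
- by move=> z Dz; exact: (smooth_der s j sg Dz).
- by move=> z Dz; exact: (smooth_der s i sg Dz).
- by move=> z Dz; exact: (smooth_der (j :: s) i sg Dz).
- by move=> z Dz; exact: (smooth_der (i :: s) j sg Dz).
- by have [] := sg (i :: j :: s) x Dx.
- by have [] := sg (j :: i :: s) x Dx.
Qed.

Lemma eq_pderivs (D : set V) (f g : V -> R) s : open D ->
  (forall x, D x -> f x = g x) -> forall x, D x -> pderivs s f x = pderivs s g x.
Proof.
move=> oD fg; elim: s => [|i s IH] x Dx; first exact: fg.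
apply: near_eq_derive.
by move: oD; rewrite openE => /(_ x Dx); apply: filterS => y Dy; exact: IH.
Qed.

(** Exchanging neighbouring letters moves a letter past a block, hence a block past a block, and
    block exchanges generate all permutations. An equality on the open set [D] persists under the
    outer derivatives. *)
Lemma pderivs_perm (D : set V) (g : V -> R) s t x : open D -> smooth_on D g -> D x ->
  perm_eq s t -> pderivs s g x = pderivs t g x.
Proof.
move=> oD sg Dx st; move: x Dx.
have rot1 (i : 'I_n) (r s' : seq 'I_n) x : D x ->
    pderivs (i :: r ++ s') g x = pderivs (r ++ i :: s') g x.
  elim: r x => [|j r IH] x Dx //.
  transitivity (pderivs (j :: i :: r ++ s') g x); first exact: pderivs_swap oD sg Dx.
  exact: (@eq_pderivs D (pderivs (i :: r ++ s') g) (pderivs (r ++ i :: s') g) [:: j] oD IH).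
have mv (s1 s2 s3 : seq 'I_n) x : D x ->
    pderivs (s1 ++ s2 ++ s3) g x = pderivs (s2 ++ s1 ++ s3) g x.
  elim: s1 x => [|i s1 IH] x Dx //=.
  have -> : 'D_(e i) (pderivs (s1 ++ s2 ++ s3) g) x = pderivs (i :: s2 ++ s1 ++ s3) g x.
    exact: (@eq_pderivs D (pderivs (s1 ++ s2 ++ s3) g) (pderivs (s2 ++ s1 ++ s3) g) [:: i] oD IH).
  exact: rot1.
apply: (@catCA_perm_ind _ (fun t => forall x, D x -> pderivs s g x = pderivs t g x)) st _ => //.
by move=> s1 s2 s3 H x Dx; rewrite H // mv.
Qed.

Lemma mi_word_perm s : perm_eq (mi_word [ffun i : 'I_n => count_mem i s]) s.
Proof.
apply/allP => i _ /=; rewrite /mi_word count_flatten -map_comp.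
have -> : sumn [seq (count_mem i \o (fun i0 => nseq ([ffun i : 'I_n => count_mem i s] i0) i0)) j | j <- enum 'I_n] =
  \sum_(j < n) (if j == i then count_mem i s else 0)%N.
  rewrite sumnE big_map big_enum /=; apply: eq_bigr => j _.
  by rewrite /= count_nseq ffunE /=; case: eqP => [->|_]; rewrite ?mul1n ?mul0n.
by rewrite -big_mkcond big_pred1_eq.
Qed.

Lemma mi_size_count s : mi_size [ffun i : 'I_n => count_mem i s] = size s.
Proof.
rewrite /mi_size; under eq_bigr do rewrite ffunE.
elim: s => [|i s IH]; first by rewrite big1.
rewrite /= big_split /= IH (bigD1 i) //= eqxx big1 // => j ji.
by rewrite eq_sym (negbTE ji).
Qed.

End Schwarz.

(** * Powers of the Laplace-Beltrami operator *)

Section SphereBounds.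
Context {R : realType} {n : nat}.
Local Notation V := 'rV[R]_n.
Local Notation e i := (delta_mx ord0 i : V).
Implicit Types (x y z : V) (s t : seq 'I_n).

Definition punctured : set V := [set x | x != 0].

Lemma open_punctured : open punctured.
Proof.
have -> : punctured = (@sqnorm R n) @^-1` [set r | 0 < r].
  by apply/seteqP; split=> x; rewrite /punctured /= sqnorm_gt0.
by apply: open_comp => [y _|]; [exact: cont_sqnorm | exact: open_gt].
Qed.
Let oD := open_punctured.

Lemma enorm1_neq0 x : enorm x = 1 -> punctured x.
Proof. by move=> x1; rewrite /punctured /= -enorm_gt0 x1. Qed.

Definition lbop (c : R) (g : V -> R) y : R :=
  c ^+ 2 * g y - slap (fun i => pderivs [:: i; i] g) y.

Let X (a : 'I_n) (g : V -> R) y : R := y ord0 a * g y.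

Let lap (g : V -> R) y : R := \sum_i pderivs [:: i; i] g y.

(** Writing |y|^2 Lap g as the sum of y_a (y_a Lap g) reduces every derivative of A g to two uses of
    the Leibniz rule for a single coordinate. *)
Let lbopE c (g : V -> R) y :
  lbop c g y = c ^+ 2 * g y + -1 * \sum_a X a (X a (lap g)) y.
Proof.
rewrite /lbop /slap mulN1r; congr (_ - _); rewrite /sqnorm mulr_suml.
by apply: eq_bigr => a _; rewrite /X mulrA expr2.
Qed.

Let smooth_lap g : smooth_on punctured g -> smooth_on punctured (lap g).
Proof. by move=> sg; have [] := smooth_sum oD (fun i => smooth_pderivs [:: i; i] sg). Qed.

Let smooth_X a g : smooth_on punctured g -> smooth_on punctured (X a g).
Proof. by move=> sg; have [] := smooth_coordM oD a sg. Qed.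

Let smooth_XX g : smooth_on punctured g ->
  smooth_on punctured (fun y => \sum_a X a (X a (lap g)) y).
Proof.
by move=> sg; have [] := smooth_sum oD (fun a => smooth_X a (smooth_X a (smooth_lap sg))).
Qed.

Lemma smooth_lbop c g : smooth_on punctured g -> smooth_on punctured (lbop c g).
Proof.
move=> sg; have [s1 _] := smoothZ oD (c ^+ 2) sg; have [s2 _] := smoothZ oD (-1) (smooth_XX sg).
have [s3 _] := smoothD oD s1 s2.
by have [] := smooth_eq oD (fun y _ => lbopE c g y) s3.
Qed.

Definition words_le (G : nat -> R) (g : V -> R) : Prop :=
  forall s x, enorm x = 1 -> `|pderivs s g x| <= G (size s).

(** On the unit sphere a coordinate is at most 1 in absolute value, and a word of length j has at
    most j erasures. *)
Let words_le_X a G g : smooth_on punctured g -> words_le G g ->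
  words_le (fun j => G j + j%:R * G j.-1) (X a g).
Proof.
move=> sg hG s x x1; have Dx := enorm1_neq0 x1.
have [_ ->//] := smooth_coordM oD a sg.
apply: le_trans (ler_normD _ _) _; apply: lerD.
  rewrite normrM -[leRHS]mul1r; apply: ler_pM => //; last exact: hG.
  by rewrite -x1; exact: coord_le_enorm.
have Gs t : t \in erasures a s -> `|pderivs t g x| <= G (size s).-1.
  by move=> /mem_erasures <-; exact: hG.
have [s0|s0] := posnP (size s).
  by rewrite (size0nil s0) big_nil normr0 mul0r.
have G0 : 0 <= G (size s).-1.
  case: s s0 {Gs} => // i s _ /=; exact: le_trans (normr_ge0 _) (hG s x x1).
apply: le_trans (ler_norm_sum _ _ _) _.
rewrite big_seq; apply: le_trans (ler_sum _ Gs) _.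
rewrite -big_seq big_const_seq count_predT iter_addr addr0 -[leLHS]mulr_natl.
by rewrite ler_wpM2r // ler_nat size_erasures.
Qed.

Let words_le_lap G g : smooth_on punctured g -> words_le G g ->
  words_le (fun j => n%:R * G j.+2) (lap g).
Proof.
move=> sg hG s x x1; have Dx := enorm1_neq0 x1.
have [_ ->//] := smooth_sum oD (fun i => smooth_pderivs [:: i; i] sg).
apply: le_trans (ler_norm_sum _ _ _) _.
apply: (@le_trans _ _ (\sum_(i < n) G (size s).+2)).
  apply: ler_sum => i _; rewrite -pderivs_cat; apply: le_trans (hG _ x x1) _.
  by rewrite size_cat addn2.
by rewrite sumr_const card_ord mulr_natl.
Qed.

Lemma words_le_lbop c G g : smooth_on punctured g -> words_le G g ->
  words_le (fun j => c ^+ 2 * G j + n%:R * (n%:R * G j.+2 + j%:R * (n%:R * G j.-1.+2)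
     + j%:R * (n%:R * G j.-1.+2 + j.-1%:R * (n%:R * G j.-2.+2)))) (lbop c g).
Proof.
move=> sg hG s x x1; have Dx := enorm1_neq0 x1.
have [s1 E1] := smoothZ oD (c ^+ 2) sg; have [s2 E2] := smoothZ oD (-1) (smooth_XX sg).
have [s3 E3] := smoothD oD s1 s2.
have [_ ->//] := smooth_eq oD (fun y _ => lbopE c g y) s3.
rewrite E3 // E1 // E2 //; apply: le_trans (ler_normD _ _) _; apply: lerD.
  by rewrite normrM (ger0_norm (sqr_ge0 c)) ler_wpM2l ?sqr_ge0 // hG.
rewrite mulN1r normrN.
have [_ ->//] := smooth_sum oD (fun a => smooth_X a (smooth_X a (smooth_lap sg))).
apply: le_trans (ler_norm_sum _ _ _) _.
set c0 := (X in n%:R * X); apply: (@le_trans _ _ (\sum_(a < n) c0)); last first.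
  by rewrite sumr_const card_ord mulr_natl.
apply: ler_sum => a _.
have H := words_le_X a (smooth_X a (smooth_lap sg)) (words_le_X a (smooth_lap sg) (words_le_lap sg hG)).
by have H2 := H s x x1; exact H2.
Qed.

(** The extra factor N + j + 2 of the larger factorial absorbs the [j] of the Leibniz rule. At j = 0
    the truncated predecessor makes the left factorial too large, but the factor [j] vanishes
    there. *)
Let fact_step1 N j : (j * (N + j.-1.+2)`! <= (N.+2 + j)`!)%N.
Proof.
case: j => [//|j]; rewrite /= [(N.+2 + _)%N]addSn factS addSn -[(N + j.+2)%N]addSnnS leq_mul //.
by rewrite ltnS leqW // (leq_trans (leqnSn j)) // leq_addl.
Qed.

Let fact_step2 N j : (j * (j.-1 * (N + j.-2.+2)`!) <= (N.+2 + j)`!)%N.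
Proof.
case: j => [|[|j]] //=.
rewrite [(N.+2 + _)%N]addSn factS addSn factS addnS; apply: leq_mul.
  by rewrite ltnS leqW // leqW // leq_addl.
by apply: leq_mul; rewrite // leqW // leqW // leq_addl.
Qed.

(** One application of A costs two derivatives, hence two steps of the factorial, together with a
    factor at most [F ^+ 2]; the rate [q] does not deteriorate. Carrying words of every length [j]
    along is what closes the induction. *)
Lemma words_le_iter_lbop c (K q : R) g m : 0 <= c -> 0 <= K -> 0 <= q ->
  smooth_on punctured g -> words_le (fun j => K * j`!%:R * q ^+ j) g ->
  smooth_on punctured (iter m (lbop c) g) /\
  words_le (fun j => K * (c + n%:R * (q + 1)) ^+ m.*2 * (m.*2 + j)`!%:R * q ^+ j)
    (iter m (lbop c) g).
Proof.
move=> c0 K0 q0 sg hg; set F := c + n%:R * (q + 1).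
have n0 : 0 <= n%:R :> R by rewrite ler0n.
have F0 : 0 <= F by rewrite addr_ge0 // mulr_ge0 // addr_ge0.
elim: m => [|m [IHs IHw]].
  by split=> // s x x1; rewrite expr0 mulr1 add0n; exact: hg.
split; first exact: smooth_lbop.
move=> s x x1; apply: le_trans (words_le_lbop c IHs IHw s x1) _.
move: (size s) => j.
pose P := K * F ^+ m.*2; have P0 : 0 <= P by rewrite mulr_ge0 // exprn_ge0.
pose W := ((m.*2.+2 + j)`!%:R : R).
have W0 : 0 <= W by rewrite /W ler0n.
have qj i : 0 <= q ^+ i by rewrite exprn_ge0.
have t0 : (m.*2 + j)`!%:R <= W by rewrite /W ler_nat leq_fact // leq_add2r ltnW.
have t2 : (m.*2 + j.+2)`!%:R <= W by rewrite /W !addSnnS.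
have t1 : j%:R * (m.*2 + j.-1.+2)`!%:R * q ^+ j.-1.+2 <= W * (q * q ^+ j).
  have h : j%:R * (m.*2 + j.-1.+2)`!%:R <= W by rewrite -natrM ler_nat fact_step1.
  have [j0|j0] := posnP j; first by rewrite {1}j0 !mul0r !mulr_ge0.
  by rewrite prednK // in h *; rewrite -exprS ler_wpM2r.
have t3 : j%:R * (j.-1%:R * (m.*2 + j.-2.+2)`!%:R) * q ^+ j.-2.+2 <= W * q ^+ j.
  have h : j%:R * (j.-1%:R * (m.*2 + j.-2.+2)`!%:R) <= W by rewrite -!natrM ler_nat fact_step2.
  have [j0|j0] := posnP j; first by rewrite {1}j0 !mul0r !mulr_ge0.
  have [j1|j1] := posnP j.-1; first by rewrite [j.-1%:R](_ : _ = 0 :> R) ?j1 // mul0r mulr0 mul0r !mulr_ge0.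
  by rewrite [X in q ^+ X](_ : _ = j) ?ler_wpM2r // !prednK.
rewrite [leRHS](_ : _ = P * (F ^+ 2 * (W * q ^+ j))); last first.
  by rewrite /P /W doubleS [F ^+ m.*2.+2]exprS exprS; ring.
(* The parts q^2, 2 q and 1 come from the Leibniz terms in which no, one or both of the two
   coordinate factors are differentiated. *)
have FF : c ^+ 2 + n%:R * (n%:R * (q ^+ 2 + 2 * q + 1)) <= F ^+ 2.
  have : 0 <= c * (n%:R * (q + 1)) by rewrite mulr_ge0 // mulr_ge0 // addr_ge0.
  by rewrite /F; set A := n%:R; move=> h; nra.
apply: (@le_trans _ _ (P * ((c ^+ 2 + n%:R * (n%:R * (q ^+ 2 + 2 * q + 1))) * (W * q ^+ j)))); last first.
  by rewrite ler_wpM2l // ler_wpM2r // mulr_ge0.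
have e0 : (m.*2 + j)`!%:R * q ^+ j <= W * q ^+ j by rewrite ler_wpM2r.
have e2 : (m.*2 + j.+2)`!%:R * q ^+ j.+2 <= W * (q ^+ 2 * q ^+ j).
  by rewrite -exprD add2n ler_wpM2r // exprn_ge0.
have n2 : 0 <= n%:R * n%:R :> R by rewrite mulr_ge0.
have c2 : 0 <= c ^+ 2 by exact: sqr_ge0.
rewrite -/P.
rewrite [leLHS](_ : _ = P * (c ^+ 2 * ((m.*2 + j)`!%:R * q ^+ j) + n%:R * n%:R *
   ((m.*2 + j.+2)`!%:R * q ^+ j.+2 + 2 * (j%:R * (m.*2 + j.-1.+2)`!%:R * q ^+ j.-1.+2)
    + j%:R * (j.-1%:R * (m.*2 + j.-2.+2)`!%:R) * q ^+ j.-2.+2))); last by rewrite /P; ring.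
rewrite [X in _ <= P * X](_ : _ = c ^+ 2 * (W * q ^+ j) + n%:R * n%:R *
   (W * (q ^+ 2 * q ^+ j) + 2 * (W * (q * q ^+ j)) + W * q ^+ j)); last by ring.
rewrite ler_wpM2l // lerD // ?ler_wpM2l // lerD // lerD // ler_wpM2l //.
Qed.

Definition degree0 (g : V -> R) : Prop :=
  forall (l : R) y, 0 < l -> y != 0 -> g (l *: y) = g y.

Lemma pderivs_scale (g h : V -> R) (l mu : R) s : l != 0 ->
  smooth_on punctured g -> smooth_on punctured h ->
  (forall y, y != 0 -> g (l *: y) = mu * h y) ->
  forall y, y != 0 -> pderivs s g (l *: y) = mu / l ^+ size s * pderivs s h y.
Proof.
move=> l0 sg sh gl; elim: s => [|i s IH] y y0; first by rewrite /= expr0 divr1 gl.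
have ly : punctured (l *: y) by rewrite /punctured /= scaler_eq0 negb_or l0.
have d1 := is_derive_comp_scale (smooth_der s i sg ly).
have d2 : is_derive y (e i) (fun y => pderivs s g (l *: y))
    (mu / l ^+ size s * pderivs (i :: s) h y).
  apply: (near_der _ (derZ (mu / l ^+ size s) (smooth_der s i sh y0))).
  by move: oD; rewrite openE => /(_ y y0); apply: filterS => z z0; rewrite IH.
have := @derive_val _ _ _ _ _ _ _ d1; rewrite (@derive_val _ _ _ _ _ _ _ d2) => E.
apply: (mulfI l0); rewrite -E exprS; field.
by rewrite l0 expf_neq0.
Qed.

Lemma degree0_lbop c g : smooth_on punctured g -> degree0 g -> degree0 (lbop c g).
Proof.
move=> sg hg l y l0 y0; have ln : l != 0 by rewrite gt_eqF.
suff E : slap (fun i => pderivs [:: i; i] g) (l *: y) = slap (fun i => pderivs [:: i; i] g) y.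
  by rewrite /lbop E (hg l y l0 y0).
have d i : pderivs [:: i; i] g (l *: y) = 1 / l ^+ 2 * pderivs [:: i; i] g y.
  apply: (@pderivs_scale g g l 1 [:: i; i] ln sg sg) y0 => z z0.
  by rewrite mul1r (hg l z l0 z0).
have ds : \sum_i pderivs [:: i; i] g (l *: y) = 1 / l ^+ 2 * \sum_i pderivs [:: i; i] g y.
  by rewrite mulr_sumr; apply: eq_bigr => i _; exact: d.
rewrite /slap; apply: (etrans (congr2 *%R (sqnormZ l y) ds)).
by move: (sqnorm y) (\sum_i _) => r S; field.
Qed.

(** Euler's identity: [g] is constant on the ray through y, so its derivative at y in the direction
    y is 0, and the C^1 formula for that derivative is the Euler sum. *)
Lemma degree0_homogeneous g : smooth_on punctured g -> degree0 g ->
  homogeneous_data g (fun i => pderivs [:: i] g) (fun i => pderivs [:: i; i] g).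
Proof.
move=> sg hg; split=> [y i y0|y i y0|y y0|y i y0|y i y0|y y0].
- exact: (smooth_der [::] i sg y0).
- exact: (smooth_der [:: i] i sg y0).
- by have [] := sg [::] y y0.
- by have [] := sg [:: i] y y0.
- by have [] := sg [:: i; i] y y0.
have d1 : is_derive y y g (\sum_i y ord0 i * pderivs [:: i] g y).
  apply: (@C1_is_derive R n g (fun i => pderivs [:: i] g) punctured y y oD y0) => i.
    by move=> z z0; exact: (smooth_der [::] i sg z0).
  by have [] := sg [:: i] y y0.
have d2 : is_derive y y g 0.
  apply/is_derive_line; apply: (@near_der R R^o (fun=> g y) _ 0 1 0 _ (@derC R R^o (g y) 0 1)).
  have : \forall h \near (0 : R), `|h| < 1.
    by apply: (@nbhs0_lt R R^o); rewrite ltr01.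
  apply: filterS => h h1; have -> : h *: y + y = (h + 1) *: y by rewrite scalerDl scale1r.
  rewrite hg //.
  by move: h1; rewrite ltr_norml => /andP[h1 _]; rewrite -ltrBlDr sub0r.
by rewrite -(@derive_val _ _ _ _ _ _ _ d1) (@derive_val _ _ _ _ _ _ _ d2).
Qed.

End SphereBounds.

(** * The main estimate *)

Section FlowEstimate.
Context {R : realType} {n : nat}.
Local Notation V := 'rV[R]_n.
Implicit Types (x y z : V).
Variables (u : V -> R) (u1 : 'I_n -> V -> R) (u2 : 'I_n -> 'I_n -> V -> R).
Hypothesis hu : harmonic_data 1 u u1 u2.
Local Notation c := (@half_codim R n).
Hypothesis c0 : 0 <= c.

Lemma degree0_le (g : V -> R) (M : R) y : degree0 g ->
  (forall z, enorm z = 1 -> `|g z| <= M) -> y != 0 -> `|g y| <= M.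
Proof.
move=> dg gM y0; have ey : 0 < enorm y by rewrite enorm_gt0.
rewrite -(dg (enorm y)^-1 y) ?invr_gt0 //; apply: gM.
by rewrite enormZ ?invr_ge0 ?(ltW ey) // mulVf // gt_eqF.
Qed.

Lemma iter_lbop_degree0 (g : V -> R) m : smooth_on punctured g -> degree0 g ->
  smooth_on punctured (iter m (lbop c) g) /\ degree0 (iter m (lbop c) g).
Proof.
move=> sg dg; elim: m => [//|m [s d]].
by split; [exact: smooth_lbop | exact: degree0_lbop].
Qed.

Section Shell.
Variables (a b : R).
Hypotheses (a0 : 0 < a) (ab : a < b) (b1 : b < 1).
Local Notation S := (smean a b (fun _ : V => 1)).

Lemma flow_le (g : V -> R) (M K s : R) : 0 <= M -> 0 <= K -> s <= 0 ->
  (forall y, shell a b y -> `|u (expR s *: y)| <= M) ->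
  (forall y, shell a b y -> `|g y| <= K) -> `|flow u a b g s| <= M * S * K.
Proof.
move=> M0 K0 s0 uM gK; rewrite /flow normrM.
have e1 : `|expR (c * s)| <= 1.
  by rewrite ger0_norm ?expR_ge0 // -expR0 ler_expR mulr_ge0_le0.
rewrite -[leRHS]mul1r; apply: ler_pM => //.
rewrite mulrAC; apply: smean_le => // y Ky.
by rewrite normrM; apply: ler_pM => //; [exact: uM | exact: gK].
Qed.

(** The Taylor expansion is centred at -sg with step sg. [M] bounds u only on |y| <= e^(-sg); the
    bound [Mb] on the larger ball enters the remainder alone and disappears. The constant is 5 = 4 +
    1, the 1 being the flow at -2 sg. *)
Lemma smean_harmonic_le (g : V -> R) (K q sg M : R) : 0 <= K -> 0 <= q -> 0 <= M ->
  0 <= sg -> (c + n%:R * (q + 1)) * sg <= 2^-1 ->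
  (forall y, sqnorm y <= expR (- sg) ^+ 2 -> `|u y| <= M) ->
  smooth_on punctured g -> degree0 g -> words_le (fun j => K * j`!%:R * q ^+ j) g ->
  `|smean a b (fun y => u y * g y)| <= 5 * M * K * S.
Proof.
move=> K0 q0 M0 sg0; set B := c + _ => Bs uM smg dg wg.
have B0 : 0 <= B by rewrite addr_ge0 // mulr_ge0 ?ler0n // addr_ge0.
have b0 := ltW (lt_trans a0 ab).
have S0 : 0 <= S by exact: smean1_ge0.
have [Mb Mb0 hMb] : exists2 M, 0 <= M & forall y, shell 0 b y -> `|u y| <= M.
  apply: (continuous_bounded_on (@compact_shell R n 0 b)) => y /andP[_ yb].
  exact: (hd_cont hu (le_lt_trans yb b1)).
have bnd m y : y != 0 -> `|iter m (lbop c) g y| <= K * B ^+ m.*2 * (m.*2)`!%:R.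
  have [sm dm] := iter_lbop_degree0 m smg dg.
  move=> y0; apply: (degree0_le dm) y0 => z z1.
  have [_ w] := words_le_iter_lbop m c0 K0 q0 smg wg.
  by have := w [::] z z1; rewrite /= addn0 expr0 mulr1.
have hom m := let: conj s d := iter_lbop_degree0 m smg dg in degree0_homogeneous s d.
have bnd0 m : 0 <= K * B ^+ m.*2 * (m.*2)`!%:R by rewrite mulr_ge0 ?ler0n // mulr_ge0 // exprn_ge0.
have neg (t : R) : - sg - sg <= t <= - sg + sg -> t <= 0 by rewrite addNr => /andP[].
have it (t : R) : - sg - sg <= t <= - sg + sg -> in_time b t.
  by move=> /neg; exact: (in_time_le0 a0 ab b1).
have scal (r t : R) y : 0 <= r -> t <= - r -> shell a b y ->
    sqnorm (expR t *: y) <= expR (- r) ^+ 2.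
  move=> r0 tr /shell_lt1 y1; rewrite sqnormZ -[leRHS]mulr1.
  apply: ler_pM; rewrite ?sqr_ge0 ?sqnorm_ge0 // ?(ltW (y1 b1)) //.
  by rewrite ler_sqr ?nnegrE ?expR_ge0 // ler_expR.
have small (t : R) m : t <= - sg ->
    `|flow u a b (iter m (lbop c) g) t| <= M * S * (K * B ^+ m.*2 * (m.*2)`!%:R).
  move=> ts; apply: flow_le => //.
  - by rewrite (le_trans ts) // oppr_le0.
  - by move=> y Ky; apply: uM; exact: scal.
  - by move=> y /(shell_neq0 a0); exact: bnd.
pose v m := flow u a b (iter m (lbop c) g).
pose dv m := dflow u u1 a b (iter m (lbop c) g).
have C0 : 0 <= M * S * K by rewrite !mulr_ge0.
have C1 : 0 <= Mb * S * K by rewrite !mulr_ge0.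
have dv1 m (t : R) : - sg - sg <= t <= - sg + sg -> is_derive t 1 (v m) (dv m t).
  by move=> ts; exact: (flow_der hu a0 ab (hom m) (it t ts)).
have dv2 m (t : R) : - sg - sg <= t <= - sg + sg -> is_derive t 1 (dv m) (v m.+1 t).
  by move=> ts; exact: (dflow_der hu a0 ab b1 (hom m) (it t ts)).
have v0 m : `|v m (- sg)| <= M * S * K * B ^+ m.*2 * (m.*2)`!%:R.
  by have := small (- sg) m (lexx _); rewrite !mulrA.
have v1 m (t : R) : - sg - sg <= t <= - sg + sg ->
    `|v m t| <= Mb * S * K * B ^+ m.*2 * (m.*2)`!%:R.
  move=> ts; have t0 := neg t ts.
  have : `|v m t| <= Mb * S * (K * B ^+ m.*2 * (m.*2)`!%:R).
    apply: (flow_le Mb0 (bnd0 m) t0) => y; last by move=> /(shell_neq0 a0); exact: bnd.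
    move=> /andP[_ yb]; apply: hMb; rewrite /shell /= sqnorm_ge0 /= sqnormZ.
    apply: le_trans yb; rewrite ler_piMl ?sqnorm_ge0 // expr_le1 ?expR_ge0 //.
    by rewrite -expR0 ler_expR.
  by rewrite !mulrA.
have := even_taylor_bound sg0 B0 C0 C1 Bs dv1 dv2 v0 v1.
rewrite /v /=.
have h2 := small (- sg - sg) 0%N.
rewrite addNr {1}/flow mulr0 !expR0 mul1r.
under eq_fun do rewrite scale1r.
move=> h; apply: le_trans h _.
have {h2} : `|flow u a b g (- sg - sg)| <= M * S * K.
  by move: h2; rewrite /= expr0 fact0 !mulr1; apply; rewrite gerDl oppr_le0.
by move: `|_| => w; lra.
Qed.

End Shell.
End FlowEstimate.

(** * Volume of balls *)

Section BallVolume.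
Context {R : realType}.
Local Open Scope ereal_scope.

(** The integral of a nonnegative function is a supremum over the simple functions below it.
    Iterated volumes are compared through this, without any question about their slices. *)
Lemma ge0_le_integralT (d : measure_display) (T : measurableType d)
    (mu : {measure set T -> \bar R}) (f g : T -> \bar R) :
  (forall t, 0 <= f t) -> (forall t, f t <= g t) -> \int[mu]_t f t <= \int[mu]_t g t.
Proof.
move=> f0 fg; have g0 t : 0 <= g t by exact: le_trans (f0 t) (fg t).
rewrite !ge0_integralTE //; apply: le_ereal_sup => _ [h hf <-].
by exists h => // x; exact: le_trans (hf x) (fg x).
Qed.

Lemma integral_cst_itv (k r : R) : (0 <= r)%R ->
  \int[@lebesgue_measure R]_t ((cst k%:E) \_ `[(- r)%R, r]) t = (k * (2 * r))%:E.
Proof.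
move=> r0; rewrite -integral_mkcond integral_cst //=.
rewrite lebesgue_measure_itv /= lte_fin opprK.
case: ltP => rr; first by rewrite -EFinM mulr_natl mulr2n.
by rewrite mule0 (_ : r = 0%R) ?mulr0 //; apply/eqP; rewrite eq_le r0 andbT; lra.
Qed.

(** [r] is the square of the radius, so that the slice at height t has parameter r - t^2. *)
Definition ball_volume (m : nat) (r : R) : \bar R :=
  integral_rV (fun x : 'rV[R]_m => (\1_[set x | (sqnorm x < r)%R] x)%:E).

Let indic_ball m (r : R) (y : 'rV[R]_m) :
  \1_[set x | (sqnorm x < r)%R] y = (sqnorm y < r)%R%:R :> R.
Proof. by rewrite indicE mem_setE. Qed.

Lemma sqnorm_row_mx m (t : R) (y : 'rV[R]_m) :
  @sqnorm R m.+1 (row_mx (t%:M : 'rV[R]_1) y) = (t ^+ 2 + sqnorm y)%R.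
Proof.
rewrite /sqnorm (@big_split_ord _ _ _ 1 m) big_ord1; congr (_ + _)%R.
  apply: etrans (congr1 (fun z => z ^+ 2)%R (row_mxEl (t%:M : 'rV[R]_1) y ord0 ord0)) _.
  by rewrite mxE eqxx mulr1n.
apply: eq_bigr => i _.
exact: (congr1 (fun z => z ^+ 2)%R (row_mxEr (t%:M : 'rV[R]_1) y ord0 i)).
Qed.

Lemma ball_volumeS m (r : R) :
  ball_volume m.+1 r = \int[@lebesgue_measure R]_t ball_volume m (r - t ^+ 2)%R.
Proof.
rewrite /ball_volume /=; apply: eq_integral => t _; congr integral_rV.
apply: funext => y; rewrite !indic_ball; congr ((_ : bool)%:R)%:E.
by rewrite ltrBrDl; congr (_ < r)%R; exact: sqnorm_row_mx.
Qed.

Lemma ball_volume_ge0 m (r : R) : 0 <= ball_volume m r.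
Proof.
elim: m r => [|m IH] r; first by rewrite /ball_volume /= lee_fin indicE ler0n.
by rewrite ball_volumeS; apply: integral_ge0.
Qed.

Lemma ball_volume_le0 m (r : R) : (r <= 0)%R -> ball_volume m r = 0.
Proof.
elim: m r => [|m IH] r r0.
  rewrite /ball_volume /= indic_ball; case: ltP => // h.
  by have := le_lt_trans (sqnorm_ge0 0) (lt_le_trans h r0); rewrite ltxx.
rewrite ball_volumeS; apply: integral0_eq => t _; apply: IH.
by rewrite subr_le0 (le_trans r0) // sqr_ge0.
Qed.

Lemma le_ball_volume m (r s : R) : (r <= s)%R -> ball_volume m r <= ball_volume m s.
Proof.
elim: m r s => [|m IH] r s rs.
  rewrite /ball_volume /= lee_fin !indic_ball ler_nat.
  by case: ltP => // h; rewrite (lt_le_trans h rs).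
rewrite !ball_volumeS; apply: ge0_le_integralT => t; first exact: ball_volume_ge0.
by apply: IH; rewrite lerB.
Qed.

(** The ball lies in the cube of side 2: slices with |t| > 1 are empty. *)
Lemma ball_volume_le m (r : R) : (r <= 1)%R -> ball_volume m r <= (2 ^+ m)%:E.
Proof.
elim: m r => [|m IH] r r1.
  by rewrite /ball_volume /= lee_fin indicE expr0 lern1 leq_b1.
rewrite ball_volumeS exprS mulrC -[X in (_ * X)%:E]mulr1 -(integral_cst_itv (2 ^+ m) ler01).
apply: ge0_le_integralT => t; first exact: ball_volume_ge0.
rewrite patchE mem_setE in_itv /= -ler_norml; case: (leP `|t|%R 1%R) => [_|t1].
  by rewrite /=; apply: IH; rewrite lerBlDr (le_trans r1) // lerDl sqr_ge0.
rewrite ball_volume_le0 // subr_le0 (le_trans r1) // -real_normK ?num_real //.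
by rewrite -[1%R](expr1n _ 2) ltW // ltr_pXn2r ?nnegrE.
Qed.

(** For |t| <= r / 2 and r <= 1 one has t^2 <= r / 2, so these slices all contain the ball of
    parameter r / 2. *)
Lemma ball_volume_gt0 m (r : R) : (0 < r)%R -> (r <= 1)%R -> 0 < ball_volume m r.
Proof.
elim: m r => [|m IH] r r0 r1.
  rewrite /ball_volume /= lte_fin indic_ball.
  by rewrite /sqnorm big_ord0 r0 ltr01.
have s0 : (0 < r / 2)%R by rewrite divr_gt0.
have s1 : (r / 2 <= 1)%R by lra.
have v0 := IH _ s0 s1.
have vf : ball_volume m (r / 2) \is a fin_num.
  by rewrite ge0_fin_numE ?ball_volume_ge0 // (le_lt_trans (ball_volume_le m s1)) ?ltry.
set v := fine (ball_volume m (r / 2)).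
have v1 : (0 < v)%R by rewrite fine_gt0 // v0 -ge0_fin_numE ?ball_volume_ge0.
rewrite ball_volumeS.
apply: (@lt_le_trans _ _ (v * (2 * (r / 2)))%:E); first by rewrite lte_fin !mulr_gt0.
rewrite -(integral_cst_itv v (ltW s0)).
apply: ge0_le_integralT => t.
  by rewrite patchE; case: ifP => // _; rewrite lee_fin ltW.
rewrite patchE mem_setE in_itv /= -ler_norml; case: (leP `|t|%R (r / 2)%R) => [tr|_]; last exact: ball_volume_ge0.
rewrite /= /v fineK //; apply: le_ball_volume.
rewrite -real_normK ?num_real //.
have := normr_ge0 t; move: (`|t|%R) tr => w; nra.
Qed.

(** [fine] sends an infinite value to 0, so the volume has to be both finite and positive. *)
Lemma sphere_area_neq0 n : (0 < n)%N -> (sphere_area R n != 0)%R.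
Proof.
move=> n0; rewrite /sphere_area.
have -> : integral_rV (fun x : 'rV[R]_n => (\1_(@eball R n) x)%:E) = ball_volume n 1.
  rewrite /ball_volume; congr (integral_rV _); apply: funext => x; congr (_ %:E).
  by congr (\1_ _ _); apply/seteqP; split=> z; rewrite /= eballE.
rewrite mulf_neq0 ?pnatr_eq0 -?lt0n // gt_eqF // fine_gt0 // ball_volume_gt0 //=.
by rewrite (le_lt_trans (ball_volume_le n (lexx _))) ?ltry.
Qed.

End BallVolume.

(** * The boundary functional *)

Section BoundaryFunctional.
Context {R : realType} {n : nat}.
Local Notation V := 'rV[R]_n.
Implicit Types (x y z : V) (g h : V -> R).
Hypothesis n_ge2 : (2 <= n)%N.

(** If every coordinate lies between sqrt(t1 / n) and sqrt(t2 / n), then |y|^2 lies in the middle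
    third of [a, b], where both factors of the bump are at least (b - a) / 3. *)
Lemma smean1_gt0 (a b : R) : 0 < a -> a < b -> b < 1 -> 0 < smean a b (fun _ : V => 1).
Proof.
move=> a0 ab b1; have n0 : 0 < n%:R :> R by rewrite ltr0n (leq_trans _ n_ge2).
have n1 : 1 <= n%:R :> R by rewrite ler1n (leq_trans _ n_ge2).
pose t1 := (2 * a + b) / 3; pose t2 := (a + 2 * b) / 3.
have t10 : 0 < t1 by rewrite /t1; lra.
have t12 : t1 < t2 by rewrite /t1 /t2; lra.
have t2n : t2 / n%:R <= 1 by rewrite ler_pdivrMr // mul1r (le_trans _ n1) // /t2; lra.
have d0 : 0 < ((b - a) / 3) ^+ 4 by rewrite exprn_gt0 // divr_gt0 // subr_gt0.
apply: (@mean_box_gt0 R n (fun y => weight a b y * 1) ((b - a) ^+ 4)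
  (Num.sqrt (t1 / n%:R)) (Num.sqrt (t2 / n%:R)) (((b - a) / 3) ^+ 4)) => //.
- by move=> y; rewrite mulr1 weight_ge0.
- by move=> y; rewrite mulr1 weight_le.
- have p : 0 < t2 / n%:R by rewrite divr_gt0 // (lt_trans t10).
  by rewrite ltr_sqrt // ltr_pM2r // invr_gt0.
- by rewrite -[leRHS]sqrtr1 ler_sqrt.
move=> y hy; have sq j : t1 / n%:R <= y ord0 j ^+ 2 <= t2 / n%:R.
  have /andP[y1 y2] := hy j.
  have y0 : 0 <= y ord0 j by exact: le_trans (sqrtr_ge0 _) y1.
  have r1 : 0 <= t1 / n%:R by exact: (divr_ge0 (ltW t10) (ltW n0)).
  have r2 : 0 <= t2 / n%:R by exact: (divr_ge0 (ltW (lt_trans t10 t12)) (ltW n0)).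
  rewrite -[t1 / _](sqr_sqrtr r1) -[t2 / _](sqr_sqrtr r2).
  by rewrite !ler_sqr ?nnegrE ?sqrtr_ge0 // y1 y2.
have sumc (r : R) : \sum_(j < n) r / n%:R = r.
  by rewrite sumr_const card_ord -[LHS]mulr_natr divfK // gt_eqF.
have q1 : t1 <= sqnorm y by rewrite -[t1]sumc; apply: ler_sum => j _; have /andP[] := sq j.
have q2 : sqnorm y <= t2 by rewrite -[t2]sumc; apply: ler_sum => j _; have /andP[] := sq j.
rewrite mulr1 /weight /bump; move: (sqnorm y) q1 q2; rewrite /t1 /t2 => s s1 s2.
have h1 : (b - a) / 3 <= s - a by lra.
have h2 : (b - a) / 3 <= b - s by lra.
have h0 : 0 <= (b - a) / 3 by rewrite divr_ge0 // subr_ge0 ltW.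
have h3 : ((b - a) / 3) ^+ 2 <= (s - a) * (b - s) by rewrite expr2 ler_pM.
rewrite (_ : 4 = 2 * 2)%N // exprM ler_sqr ?nnegrE ?exprn_ge0 //.
- by rewrite le_max h3 orbT.
- by rewrite le_max lexx.
Qed.

(** Consecutive values bound the shells that approach the sphere; the shift by 2 keeps the first
    one, 1/2, away from 0. *)
Definition inner (k : nat) : R := 1 - k.+2%:R^-1.

Lemma inner_gt0 k : 0 < inner k.
Proof. by rewrite subr_gt0 invf_lt1 ?ltr0n // ltr1n. Qed.

Lemma inner_ltS k : inner k < inner k.+1.
Proof. by rewrite ltrD2l ltrN2 ltf_pV2 ?posrE ?ltr0n // ltr_nat. Qed.

Lemma inner_lt1 k : inner k < 1.
Proof. by rewrite gtrDl oppr_lt0 invr_gt0 ltr0n. Qed.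

Lemma inner_near (a : R) : a < 1 -> \forall k \near \oo, a <= inner k.
Proof.
move=> a1; exists (Num.truncn (1 - a)^-1) => // k /= hk.
rewrite lerBrDr -lerBrDl invf_ple ?posrE ?ltr0n ?subr_gt0 //.
apply: ltW; apply: lt_le_trans (truncnS_gt _) _.
by rewrite ler_nat (leq_trans _ (leqnSn _)) // ltnS.
Qed.

Definition shell_mean k g : R := smean (inner k) (inner k.+1) g.

Definition shell_average g k : R := shell_mean k g / shell_mean k (fun=> 1).

Let S k : R := shell_mean k (fun=> 1).

Let S0 k : 0 < S k.
Proof. exact: smean1_gt0 (inner_gt0 k) (inner_ltS k) (inner_lt1 _). Qed.

(* The boundary value of u tested against g. *)
Definition boundary_pairing (u g : V -> R) : R :=
  sphere_area R n * ulim (shell_average (fun y => u y * g y)).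

Variables (u : V -> R) (u1 : 'I_n -> V -> R) (u2 : 'I_n -> 'I_n -> V -> R).
Hypothesis hu : harmonic_data 1 u u1 u2.

(** A real form of the bound of the h-norm by K, with q = 1/h, stated for all words of
    derivatives. *)
Definition analytic_data (K q : R) g : Prop :=
  [/\ smooth_on punctured g, degree0 g & words_le (fun j => K * j`!%:R * q ^+ j) g].

(** [sg] is chosen so that B sg = 1/2, and B involves only n and [q]. The ball on which u must be
    bounded is thus the same for all shells and for all [g] with this [q]. *)
Lemma shell_average_bound (q : R) : 0 <= q -> exists2 C : R, 0 <= C &
  forall (K : R) g, 0 <= K -> analytic_data K q g ->
    forall k, `|shell_average (fun y => u y * g y) k| <= C * K.
Proof.
move=> q0; have n0 : 0 <= n%:R :> R by rewrite ler0n.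
have c0 : 0 <= @half_codim R n by rewrite divr_ge0 // subr_ge0 ler_nat.
set B := @half_codim R n + n%:R * (q + 1).
have B0 : 0 < B.
  by rewrite ltr_wpDl // mulr_gt0 ?ltr0n ?(leq_trans _ n_ge2) // ltr_wpDl.
pose sg := (2 * B)^-1; have sg0 : 0 < sg by rewrite invr_gt0 mulr_gt0.
have Bs : B * sg <= 2^-1 by rewrite /sg invfM mulrCA mulfV ?mulr1 // gt_eqF.
have [M M0 hM] : exists2 M, 0 <= M & forall y, shell 0 (expR (- sg) ^+ 2) y -> `|u y| <= M.
  apply: (continuous_bounded_on (@compact_shell R n 0 (expR (- sg) ^+ 2))) => y /andP[_ yb].
  apply: (hd_cont hu); apply: (le_lt_trans yb).
  by rewrite expr_lt1 ?expR_ge0 // -expR0 ltr_expR oppr_lt0.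
exists (5 * M) => [|K g K0 [sm dg wg] k]; first by rewrite mulr_ge0.
rewrite normrM normfV (gtr0_norm (S0 k)) ler_pdivrMr //.
apply: (smean_harmonic_le hu c0 (inner_gt0 k) (inner_ltS k) (inner_lt1 _) K0 q0 M0 (ltW sg0) Bs) => //.
by move=> y yb; apply: hM; rewrite /shell /= sqnorm_ge0.
Qed.

Let cu k y : shell (inner k) (inner k.+1) y -> {for y, continuous u}.
Proof. by move=> /(shell_lt1 (inner_lt1 _)); exact: (hd_cont hu). Qed.

Let cug k g y : smooth_on punctured g -> shell (inner k) (inner k.+1) y ->
  {for y, continuous (fun y => u y * g y)}.
Proof.
move=> sm Ky; apply: contM; first exact: cu Ky.
by have [] := sm [::] y (shell_neq0 (inner_gt0 k) Ky).
Qed.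

Lemma boundary_pairingD (K q K' q' : R) g h : 0 <= K -> 0 <= K' -> 0 <= q -> 0 <= q' ->
  analytic_data K q g -> analytic_data K' q' h ->
  boundary_pairing u (fun y => g y + h y) = boundary_pairing u g + boundary_pairing u h.
Proof.
move=> K0 K'0 q0 q'0 ag ah.
have [C _ hC] := shell_average_bound q0; have [C' _ hC'] := shell_average_bound q'0.
rewrite /boundary_pairing -mulrDr -(ulimD (hC K g K0 ag) (hC' K' h K'0 ah)); congr (_ * ulim _).
apply: funext => k; rewrite /shell_average -mulrDl; congr (_ / _); rewrite /shell_mean.
have [sg _ _] := ag; have [sh _ _] := ah.
rewrite -(@smeanD R n _ _ (inner_ltS k) _ _ (fun y => cug sg) (fun y => cug sh)).
by congr smean; apply: funext => y; rewrite mulrDr.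
Qed.

Lemma boundary_pairingZ (K q c : R) g : 0 <= K -> 0 <= q -> analytic_data K q g ->
  boundary_pairing u (fun y => c * g y) = c * boundary_pairing u g.
Proof.
move=> K0 q0 ag; have [C _ hC] := shell_average_bound q0.
rewrite /boundary_pairing mulrCA -(ulimZ c (hC K g K0 ag)); congr (_ * ulim _).
apply: funext => k; rewrite /shell_average mulrA; congr (_ / _); rewrite /shell_mean.
have [sg _ _] := ag.
rewrite -(@smeanZ R n _ _ (inner_ltS k) _ _ (fun y => cug sg)).
by congr smean; apply: funext => y; rewrite mulrCA.
Qed.

Lemma boundary_pairing_le (q : R) : 0 <= q -> exists2 C : R, 0 <= C &
  forall (K : R) g, 0 <= K -> analytic_data K q g -> `|boundary_pairing u g| <= C * K.
Proof.
move=> q0; have [C C0 hC] := shell_average_bound q0.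
exists (`|sphere_area R n| * C) => [|K g K0 ag]; first by rewrite mulr_ge0.
by rewrite normrM -mulrA ler_wpM2l //; apply: ulim_norm_le; exact: hC.
Qed.

Lemma eq_boundary_pairing g h : (forall y, y != 0 -> g y = h y) ->
  boundary_pairing u g = boundary_pairing u h.
Proof.
move=> gh; rewrite /boundary_pairing; congr (_ * ulim _); apply: funext => k.
rewrite /shell_average; congr (_ / _); apply: (eq_smean (inner_ltS k)) => y Ky.
by rewrite gh // (shell_neq0 (inner_gt0 k) Ky).
Qed.

Lemma boundary_pairing0 : boundary_pairing u (fun=> 0) = 0.
Proof.
rewrite /boundary_pairing (_ : shell_average _ = fun=> 0) ?ulim_cst ?mulr0 //.
apply: funext => k; rewrite /shell_average /shell_mean.
have := @smean_le R n _ _ (inner_ltS k) (fun y => u y * 0) 0.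
rewrite mul0r normr_le0 => /(_ _)/eqP -> //; first by rewrite mul0r.
by move=> y _; rewrite mulr0 normr0.
Qed.

(** Against the kernel the shell averages converge in the ordinary sense, so the value is
    independent of the ultrafilter; the factor |S| of the pairing cancels the one in the kernel. *)
Lemma boundary_pairing_poisson x : sqnorm x < 1 ->
  boundary_pairing u (fun y => (sphere_area R n)^-1 * spoisson x 1 y) = u x.
Proof.
move=> x1; have n0 : (0 < n)%N by rewrite (leq_trans _ n_ge2).
have A0 := @sphere_area_neq0 R n n0.
have cs k y : shell (inner k) (inner k.+1) y -> {for y, continuous (fun y => u y * spoisson x 1 y)}.
  move=> Ky; apply: contM; first exact: cu Ky.
  have x1' : sqnorm x * 1 ^+ 2 < 1 by rewrite expr1n mulr1.
  exact: (ho_cont (spoisson_homogeneous x1') (shell_neq0 (inner_gt0 k) Ky)).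
rewrite /boundary_pairing.
rewrite (_ : shell_average _ = fun k => (sphere_area R n)^-1 *
    shell_average (fun y => u y * spoisson x 1 y) k); last first.
  apply: funext => k; rewrite /shell_average mulrA; congr (_ / _); rewrite /shell_mean.
  rewrite -(@smeanZ R n _ _ (inner_ltS k) _ _ (cs k)).
  by congr smean; apply: funext => y; rewrite mulrCA.
have lim : shell_average (fun y => u y * spoisson x 1 y) @ \oo --> u x.
  apply/cvgrPdist_le => eps eps0.
  have [a1 a11 h] := poisson_limit n_ge2 hu x1 eps0.
  apply: filterS (inner_near a11) => k ak.
  have hk := h _ _ (inner_gt0 k) ak (inner_ltS k) (inner_lt1 k.+1).
  rewrite distrC /shell_average -[u x](mulfK (lt0r_neq0 (S0 k))) -mulrBl.
  by rewrite normrM normfV (gtr0_norm (S0 k)) ler_pdivrMr.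
have lim2 : (fun k => (sphere_area R n)^-1 * shell_average (fun y => u y * spoisson x 1 y) k)
    @ \oo --> (sphere_area R n)^-1 * u x by apply: cvgM => //; exact: cvg_cst.
by rewrite (ulim_cvgn lim2) mulrA mulfV // mul1r.
Qed.

End BoundaryFunctional.

Section ComplexNorm.
Context {R : realType}.
Implicit Types z w : R[i].
Local Notation normc := ComplexField.Normc.normc.

Lemma norm_re_le z : `|complex.Re z| <= normc z.
Proof.
by case: z => a b; rewrite /= -sqrtr_sqr ler_wsqrtr // lerDl sqr_ge0.
Qed.

Lemma norm_im_le z : `|complex.Im z| <= normc z.
Proof.
by case: z => a b; rewrite /= -sqrtr_sqr ler_wsqrtr // lerDr sqr_ge0.
Qed.

Lemma normc_le_ReIm z : normc z <= `|complex.Re z| + `|complex.Im z|.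
Proof.
case: z => a b /=; rewrite -[leRHS]ger0_norm ?addr_ge0 // -sqrtr_sqr ler_wsqrtr //.
rewrite sqrrD !real_normK ?num_real // -addrA lerD2l lerDr.
by rewrite mulrn_wge0 // mulr_ge0.
Qed.

Lemma sum_complex (I : finType) (a b : I -> R) :
  \sum_i (a i +i* b i)%C = ((\sum_i a i) +i* (\sum_i b i))%C.
Proof. by apply/eqP; rewrite eq_complex !raddf_sum /= !eqxx. Qed.

End ComplexNorm.

(** * Analytic functions on the sphere and their extensions of degree 0 *)

Section HomogeneousExtension.
Context {R : realType} {n : nat}.
Local Notation V := 'rV[R]_n.
Local Notation normc := ComplexField.Normc.normc.
Implicit Types (x y z : V) (phi psi : esphere R n -> R[i]).

Lemma hom_extE phi y : forall y0 : enorm ((enorm y)^-1 *: y) == 1,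
  hom_ext phi y = phi (exist _ ((enorm y)^-1 *: y) y0).
Proof. by move=> y0; rewrite /hom_ext insubT. Qed.

Lemma enorm_normalize y : y != 0 -> enorm ((enorm y)^-1 *: y) == 1.
Proof.
move=> y0; have ey : 0 < enorm y by rewrite enorm_gt0.
by rewrite enormZ ?invr_ge0 ?(ltW ey) // mulVf // gt_eqF.
Qed.

Lemma hom_ext_lin (a : R[i]) phi psi y :
  hom_ext (fun w => a * phi w + psi w) y = a * hom_ext phi y + hom_ext psi y.
Proof. by rewrite /hom_ext; case: insubP => [w _ _|_] //=; rewrite mulr0 addr0. Qed.

Lemma hom_ext_degree0 phi (l : R) y : 0 < l -> hom_ext phi (l *: y) = hom_ext phi y.
Proof.
move=> l0; rewrite /hom_ext enormZ ?(ltW l0) // scalerA invfM mulrAC mulVf ?mul1r //.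
by rewrite gt_eqF.
Qed.

(** At l = 1 and w = y / |y| the quantity [kq] is |x - w|^2, and its power -n/2 is the inverse of |x
    - w|^n. *)
Lemma hom_ext_poisson x y : sqnorm x < 1 -> y != 0 ->
  hom_ext (poisson_kernel x) y = ((sphere_area R n)^-1 * spoisson x 1 y)%:C%C.
Proof.
move=> x1 y0; have w1 := enorm_normalize y0; rewrite (hom_extE _ w1) /poisson_kernel /=.
congr ((_ * _)%:C%C).
set w := _ *: y in w1 *.
have sw : sqnorm w = 1 by rewrite -enorm_sqr (eqP w1) expr1n.
have ang : angle x y = dotp x w.
  by rewrite /angle /dotp mulr_suml; apply: eq_bigr => i _; rewrite mxE mulrAC mulrA.
have qE : kq (sqnorm x) 1 (dotp x w) = sqnorm (x - w).
  by rewrite /kq sqnormB sw expr1n; ring.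
rewrite /spoisson ang /kpoisson /kr qE enorm_sqr expr1n mulr1; congr (_ * _).
rewrite powRN mulrC powRrM powR12_sqrt ?sqnorm_ge0 // powR_mulrn ?sqrtr_ge0 //.
Qed.

(* Partial derivatives commute, so the bounds over multi-indices in hnorm control all
   words of derivatives. *)
Lemma analytic_step_data phi (h K : R) : 0 < h -> analytic_step h phi ->
  (hnorm h phi <= K%:E)%E ->
  analytic_data K h^-1 (re_part (hom_ext phi)) /\ analytic_data K h^-1 (im_part (hom_ext phi)).
Proof.
move=> h0 [sm _] hK.
have sre : smooth_on punctured (re_part (hom_ext phi)).
  by apply/smooth_onP => k; have [] := sm k.
have sim : smooth_on punctured (im_part (hom_ext phi)).
  by apply/smooth_onP => k; have [] := sm k.
have bnd s x : enorm x = 1 ->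
    normc (cpderivs s (hom_ext phi) x) <= K * (size s)`!%:R * h^-1 ^+ size s.
  move=> x1; have Dx : punctured x := enorm1_neq0 x1.
  pose al : multi_index n := [ffun i => count_mem i s].
  have -> : cpderivs s (hom_ext phi) x = cpderivs (mi_word al) (hom_ext phi) x.
    rewrite /cpderivs; congr (_ +i* _)%C; symmetry.
      exact: pderivs_perm open_punctured sre Dx (mi_word_perm s).
    exact: pderivs_perm open_punctured sim Dx (mi_word_perm s).
  have xs : enorm x == 1 by rewrite x1.
  have f0 : 0 < (size s)`!%:R :> R by rewrite ltr0n fact_gt0.
  have : ((h ^+ size s / (size s)`!%:R)%:E *
      (normc (cpderivs (mi_word al) (hom_ext phi) x))%:E <= K%:E)%E.
    apply: le_trans hK; rewrite /hnorm.
    apply: le_trans (ereal_sup_ubound _); last by exists al.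
    rewrite /= mi_size_count; apply: lee_wpmul2l.
      by rewrite lee_fin divr_ge0 // ?exprn_ge0 ?ltW.
    by apply: ereal_sup_ubound; exists (exist _ x xs).
  rewrite -EFinM lee_fin => H.
  rewrite exprVn ler_pdivlMr ?exprn_gt0 // mulrC -ler_pdivrMr //.
  by rewrite mulrAC.
split; split=> //.
- by move=> l y l0 _; rewrite /re_part hom_ext_degree0.
- by move=> s x x1; exact: le_trans (norm_re_le _) (bnd s x x1).
- by move=> l y l0 _; rewrite /im_part hom_ext_degree0.
- by move=> s x x1; exact: le_trans (norm_im_le _) (bnd s x x1).
Qed.

(** Replaces the norms by pairs (K, q), which can be widened to a common pair for several functions.
    In the converse direction a factor 2 arises from |z| <= |Re z| + |Im z|. *)
Lemma analytic_sphereP phi : analytic_sphere phi <->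
  exists K q : R, [/\ 0 <= K, 0 <= q, analytic_data K q (re_part (hom_ext phi))
                     & analytic_data K q (im_part (hom_ext phi))].
Proof.
split=> [[h h0 hphi]|[K [q [K0 q0 [sr _ wr] [si _ wi]]]]].
  have [sm hlt] := hphi.
  have [K K0 hK] : exists2 K : R, 0 <= K & (hnorm h phi <= K%:E)%E.
    case E : (hnorm h phi) hlt => [r||] // _; last by exists 0 => //; rewrite leNye.
    by exists `|r| => //; rewrite lee_fin ler_norm.
  have [d1 d2] := analytic_step_data h0 hphi hK.
  by exists K, h^-1; split=> //; rewrite invr_ge0 ltW.
(* Taking q + 1 rather than q covers q = 0 and makes h q <= 1. *)
pose h := (q + 1)^-1; have q1 : 0 < q + 1 by rewrite ltr_wpDl.
have h0 : 0 < h by rewrite invr_gt0.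
exists h => //; split.
  by move=> k; split; [move: k; apply/smooth_onP | move: k; apply/smooth_onP].
apply: (@le_lt_trans _ _ (2 * K)%:E); last exact: ltry.
apply: ge_ereal_sup => _ [al _ <-].
have f0 : 0 < (mi_size al)`!%:R :> R by rewrite ltr0n fact_gt0.
apply: (@le_trans _ _ ((h ^+ mi_size al / (mi_size al)`!%:R)%:E *
    (2 * K * (mi_size al)`!%:R * q ^+ mi_size al)%:E)%E).
  apply: lee_wpmul2l; first by rewrite lee_fin divr_ge0 // ?exprn_ge0 // ltW.
  apply: ge_ereal_sup => _ [w _ <-]; rewrite lee_fin.
  have w1 : enorm (val w) = 1 by exact/eqP/(valP w).
  have sz : size (mi_word al) = mi_size al.
    rewrite /mi_word size_flatten /shape -map_comp sumnE big_map big_enum /=.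
    by apply: eq_bigr => i _; rewrite /= size_nseq.
  apply: le_trans (normc_le_ReIm _) _; rewrite /dsphere /=.
  have := wr (mi_word al) _ w1; have := wi (mi_word al) _ w1; rewrite sz.
  by move: `|_| `|_| => a b h1 h2; lra.
rewrite -EFinM lee_fin [leLHS](_ : _ = 2 * K * (h * q) ^+ mi_size al).
  rewrite -[leRHS]mulr1 ler_wpM2l ?mulr_ge0 // exprn_ile1 ?mulr_ge0 ?(ltW h0) //.
  by rewrite /h mulrC ler_pdivrMr // mul1r lerDl.
by rewrite exprMn; field; rewrite gt_eqF.
Qed.

Lemma analytic_data_widen (K q K' q' : R) (g : V -> R) : 0 <= K -> 0 <= q ->
  K <= K' -> q <= q' -> analytic_data K q g -> analytic_data K' q' g.
Proof.
move=> K0 q0 KK qq [sm dg wg]; split=> // s x x1; apply: le_trans (wg s x x1) _.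
apply: ler_pM; rewrite ?mulr_ge0 ?exprn_ge0 //; first by rewrite ler_wpM2r.
by rewrite lerXn2r ?nnegrE // (le_trans q0).
Qed.

Lemma analytic_dataD (K q K' : R) (g h : V -> R) :
  analytic_data K q g -> analytic_data K' q h ->
  analytic_data (K + K') q (fun y => g y + h y).
Proof.
move=> [sg dg wg] [sh dh wh]; have [s E] := smoothD open_punctured sg sh.
split=> // [l y l0 y0|t x x1]; first by rewrite dg // dh.
rewrite E; last exact: enorm1_neq0; rewrite !mulrDl; apply: le_trans (ler_normD _ _) _.
by apply: lerD; [exact: wg | exact: wh].
Qed.

Lemma analytic_dataZ (K q c : R) (g : V -> R) :
  analytic_data K q g -> analytic_data (`|c| * K) q (fun y => c * g y).
Proof.
move=> [sg dg wg]; have [s E] := smoothZ open_punctured c sg.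
split=> // [l y l0 y0|t x x1]; first by rewrite dg.
rewrite E; last exact: enorm1_neq0; rewrite normrM -!mulrA ler_wpM2l // mulrA.
exact: wg.
Qed.

End HomogeneousExtension.

(** * The complex functional and the representation of U *)

Section PoissonRepresentation.
Local Open Scope complex_scope.
Context {R : realType} {n : nat}.
Local Notation V := 'rV[R]_n.
Local Notation normc := ComplexField.Normc.normc.
Implicit Types (x y z : V) (phi psi : esphere R n -> R[i]).
Hypothesis n_ge2 : (2 <= n)%N.
Local Notation re phi := (re_part (hom_ext phi)).
Local Notation im phi := (im_part (hom_ext phi)).

Lemma re_hom_ext_lin (a : R[i]) phi psi : re (fun w => a * phi w + psi w) =
  (fun y => complex.Re a * re phi y + (- complex.Im a * im phi y + re psi y)).
Proof.
apply: funext => y; rewrite /re_part /im_part hom_ext_lin.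
by case: a (hom_ext phi y) (hom_ext psi y) => [a1 a2] [p1 p2] [q1 q2] /=; ring.
Qed.

Lemma im_hom_ext_lin (a : R[i]) phi psi : im (fun w => a * phi w + psi w) =
  (fun y => complex.Re a * im phi y + (complex.Im a * re phi y + im psi y)).
Proof.
apply: funext => y; rewrite /re_part /im_part hom_ext_lin.
by case: a (hom_ext phi y) (hom_ext psi y) => [a1 a2] [p1 p2] [q1 q2] /=; ring.
Qed.

Lemma analytic_sphere2 phi psi : analytic_sphere phi -> analytic_sphere psi ->
  exists K q : R, [/\ 0 <= K, 0 <= q,
    analytic_data K q (re phi) /\ analytic_data K q (im phi)
    & analytic_data K q (re psi) /\ analytic_data K q (im psi)].
Proof.
move=> /analytic_sphereP[K [q [K0 q0 a1 a2]]] /analytic_sphereP[K' [q' [K'0 q'0 b1 b2]]].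
exists (K + K'), (q + q'); split; rewrite ?addr_ge0 //.
  by split; [apply: (analytic_data_widen K0 q0 _ _ a1) | apply: (analytic_data_widen K0 q0 _ _ a2)];
    rewrite lerDl.
by split; [apply: (analytic_data_widen K'0 q'0 _ _ b1) | apply: (analytic_data_widen K'0 q'0 _ _ b2)];
  rewrite lerDr.
Qed.

Lemma analytic_sphere_lin (a : R[i]) phi psi : analytic_sphere phi -> analytic_sphere psi ->
  analytic_sphere (fun w => a * phi w + psi w).
Proof.
move=> ap aq; have [K [q [K0 q0 [p1 p2] [q1 q2]]]] := analytic_sphere2 ap aq.
apply/analytic_sphereP; rewrite re_hom_ext_lin im_hom_ext_lin.
pose K' := (`|complex.Re a| + (`|complex.Im a| + 1)) * K.
exists K', q; split=> //; first by rewrite mulr_ge0 // !addr_ge0.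
  rewrite /K' !mulrDl mul1r -(normrN (complex.Im a)).
  by do 2 (apply: analytic_dataD; first exact: analytic_dataZ).
rewrite /K' !mulrDl mul1r.
by do 2 (apply: analytic_dataD; first exact: analytic_dataZ).
Qed.

Section Functional.
Variables (u v : V -> R) (u1 v1 : 'I_n -> V -> R) (u2 v2 : 'I_n -> 'I_n -> V -> R).
Hypotheses (hu : harmonic_data 1 u u1 u2) (hv : harmonic_data 1 v v1 v2).
Local Notation pair := boundary_pairing.

(** The complex-bilinear extension of the real pairing: the product of u + i v and phi expanded,
    with no conjugation, so that the functional is complex-linear in phi. *)
Definition boundary_functional phi : R[i] :=
  (pair u (re phi) - pair v (im phi)) +i* (pair u (im phi) + pair v (re phi)).
Local Notation F := boundary_functional.

Let pair_lin w w1 w2 (hw : harmonic_data 1 w w1 w2) (a b K q : R) (g h k : V -> R) :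
  0 <= K -> 0 <= q ->
  analytic_data K q g -> analytic_data K q h -> analytic_data K q k ->
  pair w (fun y => a * g y + (b * h y + k y)) = a * pair w g + (b * pair w h + pair w k).
Proof.
move=> K0 q0 ag ah ak.
have ag' := analytic_dataZ a ag; have ah' := analytic_dataZ b ah.
have Ka : 0 <= `|a| * K by rewrite mulr_ge0.
have Kb : 0 <= `|b| * K by rewrite mulr_ge0.
rewrite (boundary_pairingD n_ge2 hw Ka (addr_ge0 Kb K0) q0 q0 ag' (analytic_dataD ah' ak)).
rewrite (boundary_pairingD n_ge2 hw Kb K0 q0 q0 ah' ak).
by rewrite (boundary_pairingZ n_ge2 hw a K0 q0 ag) (boundary_pairingZ n_ge2 hw b K0 q0 ah).
Qed.

Lemma boundary_functional_lin (a : R[i]) phi psi :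
  analytic_sphere phi -> analytic_sphere psi ->
  F (fun w => a * phi w + psi w) = a * F phi + F psi.
Proof.
move=> ap aq; have [K [q [K0 q0 [p1 p2] [q1 q2]]]] := analytic_sphere2 ap aq.
rewrite /F re_hom_ext_lin im_hom_ext_lin.
rewrite !(pair_lin hu _ _ K0 q0) // !(pair_lin hv _ _ K0 q0) //.
by case: a => a1 a2; apply/eqP; rewrite eq_complex /=; apply/andP; split; apply/eqP; ring.
Qed.

Lemma boundary_functionalZ (a : R[i]) phi : analytic_sphere phi ->
  analytic_sphere (fun w => a * phi w) /\ F (fun w => a * phi w) = a * F phi.
Proof.
(* Linearity is available for a phi + psi; taking psi = phi and a - 1 in place of a avoids a
   separate treatment of psi = 0. *)
move=> ap; have -> : (fun w => a * phi w) = (fun w => (a - 1) * phi w + phi w).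
  by apply: funext => w; rewrite mulrBl mul1r subrK.
split; first exact: analytic_sphere_lin.
by rewrite boundary_functional_lin // mulrBl mul1r subrK.
Qed.

Lemma boundary_functional_ball (h e : R) : 0 < h -> 0 < e -> exists2 r : R, 0 < r &
  forall phi, analytic_step h phi -> (hnorm h phi < r%:E)%E -> normc (F phi) < e.
Proof.
move=> h0 e0; have q0 : 0 <= h^-1 by rewrite invr_ge0 ltW.
have [C C0 hC] := boundary_pairing_le n_ge2 hu q0.
have [C' C'0 hC'] := boundary_pairing_le n_ge2 hv q0.
pose D := 2 * (C + C') + 1; have D0 : 0 < D by rewrite ltr_wpDl // mulr_ge0 // addr_ge0.
exists (e / D) => [|phi hphi hr]; first by rewrite divr_gt0.
have r0 : 0 < e / D by rewrite divr_gt0.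
have [d1 d2] := analytic_step_data h0 hphi (ltW hr).
apply: le_lt_trans (normc_le_ReIm _) _; rewrite /F /=.
apply: (@le_lt_trans _ _ (2 * (C + C') * (e / D))).
  have := hC _ _ (ltW r0) d1; have := hC _ _ (ltW r0) d2.
  have := hC' _ _ (ltW r0) d1; have := hC' _ _ (ltW r0) d2.
  have := ler_normB (pair u (re phi)) (pair v (im phi)).
  have := ler_normD (pair u (im phi)) (pair v (re phi)).
  rewrite [2 * (C + C') * (e / D)](_ : _ = 2 * (C * (e / D) + C' * (e / D))); last by ring.
  move: (C * (e / D)) (C' * (e / D)) => p q.
  move=> h1 h2 h3 h4 h5 h6; apply: le_trans (lerD h2 h1) _.
  by apply: le_trans (lerD (lerD h6 h3) (lerD h5 h4)) _; lra.
by rewrite -[ltRHS](divfK (lt0r_neq0 D0)) mulrC ltr_pM2l // /D ltrDl.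
Qed.

(** The set of analytic psi with |F psi| < e is absolutely convex by linearity and contains a ball
    of every step, so it is itself a basic neighbourhood of 0; translation by phi costs nothing. *)
Lemma boundary_functional_analytic : analytic_functional F.
Proof.
split=> [a phi psi|phi ap e e0]; first exact: boundary_functional_lin.
exists [set psi | analytic_sphere psi /\ normc (F psi) < e]; split.
- move=> a b psi chi ab [hp np] [hc nc].
  have [hz Fz] := boundary_functionalZ b hc.
  split; first exact: analytic_sphere_lin.
  rewrite boundary_functional_lin // Fz; apply: (le_lt_trans (le_normcD _ _)).
  rewrite !ComplexField.Normc.normcM.
  have ab1 : normc a + normc b <= 1.
    by move: ab; rewrite !normc_def -rmorphD lecE /= => /andP[_]; case: (a) (b) => [? ?] [? ?].
  have na : 0 <= normc a by exact: le_trans (normr_ge0 _) (norm_re_le a).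
  have nb : 0 <= normc b by exact: le_trans (normr_ge0 _) (norm_re_le b).
  move: (normc a) (normc b) (normc (F psi)) (normc (F chi)) ab1 na nb np nc => p q r s.
  move=> pq p0 q0 re se.
  (* [m] is the larger of the two values: p r + q s <= (p + q) m, which is at most m < e if m >= 0.
     The generalised values no longer carry their signs, so m < 0 remains as a case, with (p + q) m
     <= 0 < e. *)
  have [m mr [ms me]] : exists2 m, r <= m & s <= m /\ m < e.
    by have [rs|/ltW sr] := leP r s; [exists s | exists r].
  have m1 : p * r <= p * m by rewrite ler_wpM2l.
  have m2 : q * s <= q * m by rewrite ler_wpM2l.
  have [m0|m0] := leP 0 m; last by nra.
  by apply: le_lt_trans me; nra.
- by move=> psi [].
- move=> h h0; have [r r0 hr] := boundary_functional_ball h0 e0.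
  exists r => // psi hpsi nr; split; last exact: hr.
  by exists h.
- move=> psi [hp np]; change (normc (F (fun w => phi w + psi w) - F phi) < e).
  have := boundary_functional_lin 1 ap hp.
  rewrite mul1r (_ : (fun w => 1 * phi w + psi w) = (fun w => phi w + psi w)); last first.
    by apply: funext => w; rewrite mul1r.
  by move=> ->; rewrite addrAC subrr add0r.
Qed.

Lemma boundary_functional_poisson x : sqnorm x < 1 ->
  F (poisson_kernel x) = u x +i* v x.
Proof.
move=> x1; rewrite /F.
have r y : y != 0 -> re (poisson_kernel x) y = (sphere_area R n)^-1 * spoisson x 1 y.
  by move=> y0; rewrite /re_part hom_ext_poisson.
have i y : y != 0 -> im (poisson_kernel x) y = 0.
  by move=> y0; rewrite /im_part hom_ext_poisson.
rewrite !(eq_boundary_pairing _ r) !(eq_boundary_pairing _ i) !boundary_pairing0.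
rewrite (boundary_pairing_poisson n_ge2 hu x1) (boundary_pairing_poisson n_ge2 hv x1).
by rewrite subr0 add0r.
Qed.

End Functional.

Lemma harmonic_re_im (U : V -> R[i]) : harmonic_on (@eball R n) U ->
  harmonic_data 1 (re_part U) (fun i => pderivs [:: i] (re_part U))
    (fun i j => pderivs [:: i; j] (re_part U)) /\
  harmonic_data 1 (im_part U) (fun i => pderivs [:: i] (im_part U))
    (fun i j => pderivs [:: i; j] (im_part U)).
Proof.
move=> [[[dr cr] [di ci]] lap].
have part (g : V -> R) :
  (forall (s : seq 'I_n) i y, (size s < 2)%N -> eball y ->
     derivable (pderivs s g) y (delta_mx ord0 i)) ->
  (forall (s : seq 'I_n) y, (size s <= 2)%N -> eball y -> {for y, continuous (pderivs s g)}) ->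
  (forall y, eball y -> \sum_i pderivs [:: i; i] g y = 0) ->
  harmonic_data 1 g (fun i => pderivs [:: i] g) (fun i j => pderivs [:: i; j] g).
  move=> dg cg lg; split=> [y i|y i j|y|y i|y i j|y]; rewrite -eballE => By.
  - by apply: derivableP; exact: (dg [::]).
  - by apply: derivableP; exact: (dg [:: j]).
  - exact: (cg [::]).
  - exact: (cg [:: i]).
  - exact: (cg [:: i; j]).
  - exact: lg.
have sumE y : laplacian U y =
    (\sum_i pderivs [:: i; i] (re_part U) y) +i* (\sum_i pderivs [:: i; i] (im_part U) y).
  exact: sum_complex.
have lap0 y (By : eball y) := etrans (esym (sumE y)) (lap y By).
by split; apply: part => // y By; [exact: (congr1 (@complex.Re R) (lap0 y By))
  | exact: (congr1 (@complex.Im R) (lap0 y By))].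
Qed.

End PoissonRepresentation.

Theorem corollary5p4 (R : realType) (n : nat) (n_ge2 : (2 <= n)%N)
    (U : 'rV[R]_n -> R[i]) (harmU : harmonic_on (@eball R n) U) :
  exists f : (esphere R n -> R[i]) -> R[i],
    analytic_functional f /\
    (forall x : 'rV[R]_n, eball x -> U x = poisson_transform f x).
Proof.
have [hu hv] := harmonic_re_im harmU.
exists (boundary_functional (re_part U) (im_part U)); split.
  exact: (boundary_functional_analytic n_ge2 hu hv).
move=> x; rewrite eballE => x1; rewrite /poisson_transform.
by rewrite (boundary_functional_poisson n_ge2 hu hv x1) /re_part /im_part; case: (U x).
Qed.
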